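(* Suppose that $\xi\in L^2_{\mathcal{F}_T}$ and $f\in\mathbb{H}^2$ are real-valued. Then the BSDE $$Y_s=\xi+\int_s^T f_\tau\,d\tau-\int_s^T\langle Z_\tau,dW_\tau\rangle,\qquad\forall s\in[t,T],$$ admits a unique adapted solution $(Y,Z)\in\mathbb{S}^2\times\mathbb{H}^2$. For an adapted $\mathbb{R}^d$-valued process $z\in\mathbb{H}^2$, let $\widetilde Y^z$ denote the (not necessarily adapted) process $$\widetilde Y^z_s=\xi+\int_s^T f_\tau\,d\tau-\int_s^T\langle z_\tau,dW_\tau\rangle,\qquad\forall s\in[t,T].$$ Then $$\mathbb{E}\bigl|\widetilde Y^z_t-\mathbb{E}\widetilde Y^z_t\bigr|^2=\mathbb{E}\int_t^T\|Z_s-z_s\|^2\,ds .$$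
   Context: Let $0\le t\le T<\infty$, and let $(\Omega,\mathcal{F},\mathbb{P})$ be a complete probability space carrying a $d$-dimensional Brownian motion $(W_s)_{t\le s\le T}$ with $W_t=0$, with $(\mathcal{F}_s)_{t\le s\le T}$ its natural filtration augmented by the $\mathbb{P}$-null sets. ''Adapted'' means progressively measurable. $L^2_{\mathcal{F}_T}$: $\mathcal{F}_T$-measurable random variables with finite second moment. $\mathbb{S}^2$: adapted processes $Y$ with $\mathbb{E}[\sup_{t\le s\le T}|Y_s|^2]<\infty$. $\mathbb{H}^2$: adapted processes $Z$ with $\mathbb{E}\int_t^T\|Z_s\|^2ds<\infty$. *)

(* Defs.v *)
From mathcomp Require Import all_boot all_order all_algebra.
From mathcomp Require Import all_classical all_reals all_analysis.

Set Implicit Arguments.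
Unset Strict Implicit.
Unset Printing Implicit Defensive.

Import Order.TTheory GRing.Theory Num.Theory.
Import numFieldNormedType.Exports.

Local Open Scope classical_set_scope.
Local Open Scope ring_scope.

Definition dotv (R : realType) (m : nat) (x y : 'rV[R]_m) : R :=
  \sum_(i < m) x ord0 i * y ord0 i.

(* The library norm on ['rV_m] is the sup norm, hence this definition of the
   squared Euclidean norm. *)
Definition sqnorm (R : realType) (m : nat) (x : 'rV[R]_m) : R := dotv x x.

Section brownian.
Context (d : measure_display) (Omega : measurableType d) (R : realType).
Context (P : probability Omega R) (m : nat).
Implicit Types (X : R -> Omega -> 'rV[R]_m) (D : set R).

(* The events {X_u^i in B} for u in D, i < m and B Borel; they generate the
   sigma-algebra sigma(X_u, u in D). *)
Definition coord_events X D : set (set Omega) :=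
  [set A | exists u i (B : set R),
    [/\ D u, measurable B & A = [set w | B (X u w ord0 i)]]].

(* The paths of W matter only on [t, T].  The law of W_s - W_r is
   N(0, (s - r) I_m), that is, the product of m copies of N(0, s - r);
   [normal_prob] takes the standard deviation as parameter. *)
Record brownian_motion (t T : R) (W : R -> Omega -> 'rV[R]_m) : Prop := {
  bm_measurable : forall s (i : 'I_m), s \in `[t, T] ->
    measurable_fun setT (fun w => W s w ord0 i) ;
  bm_start : {ae P, forall w, W t w = 0} ;
  bm_continuous : {ae P, forall w, {within `[t, T], continuous (W ^~ w)}} ;
  bm_independent : forall r s, t <= r -> r <= s -> s <= T ->
    forall A B : set Omega,
    <<s coord_events W `[t, r] >> A ->
    <<s coord_events (fun u w => W u w - W r w) [set s] >> B ->
    P (A `&` B) = (P A * P B)%E ;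
  bm_gaussian : forall r s, t <= r -> r < s -> s <= T ->
    forall B : 'I_m -> set R, (forall i, measurable (B i)) ->
    P [set w | forall i, B i (W s w ord0 i - W r w ord0 i)] =
      (\prod_(i < m) normal_prob 0 (Num.sqrt (s - r)) (B i))%E }.

(* Generators of F_s, the natural filtration of W on [t, s] augmented by the
   null sets. *)
Definition filtration_gen (t : R) (W : R -> Omega -> 'rV[R]_m) (s : R) :
    set (set Omega) :=
  coord_events W `[t, s] `|` P.-negligible.

End brownian.

Section processes.
Context (d : measure_display) (Omega : measurableType d) (R : realType).
Context (P : probability Omega R) (m : nat).
Context (t T : R) (W : R -> Omega -> 'rV[R]_m).

Local Notation leb := (@lebesgue_measure R).

Definition F_measurable (s : R) (eta : Omega -> R) : Prop :=
  measurable_fun [set: g_sigma_algebraType (filtration_gen P t W s)] eta.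

Definition L2_F (s : R) (xi : Omega -> R) : Prop :=
  F_measurable s xi /\ (\int[P]_w ((xi w) ^+ 2)%:E < +oo)%E.

(* For every s, the restriction of (u, w) |-> X_u(w) to [t, s] x Omega is
   B([t, s]) (x) F_s-measurable. *)
Definition progressive (X : R -> Omega -> R) : Prop :=
  forall s, s \in `[t, T] ->
    measurable_fun (`[t, s] `*` setT)
      (fun p : R * g_sigma_algebraType (filtration_gen P t W s) =>
         X p.1 p.2).

Definition progressive_vec (k : nat) (Z : R -> Omega -> 'rV[R]_k) : Prop :=
  forall i, progressive (fun s w => Z s w ord0 i).

Definition S2 (Y : R -> Omega -> R) : Prop :=
  progressive Y /\
  (\int[P]_w ereal_sup [set ((Y s w) ^+ 2)%:E | s in `[t, T]] < +oo)%E.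

Definition H2_normsq (k : nat) (Z : R -> Omega -> 'rV[R]_k) : \bar R :=
  (\int[P]_w \int[leb]_(s in `[t, T]) (sqnorm (Z s w))%:E)%E.

Definition H2_vec (k : nat) (Z : R -> Omega -> 'rV[R]_k) : Prop :=
  progressive_vec Z /\ (H2_normsq Z < +oo)%E.

Definition H2 (f : R -> Omega -> R) : Prop :=
  progressive f /\
  (\int[P]_w \int[leb]_(s in `[t, T]) ((f s w) ^+ 2)%:E < +oo)%E.

(* The simple process sum_(j < sp_size) sp_val_j 1_(]sp_time_j, sp_time_(j+1)]]
   with sp_val_j bounded and F_(sp_time_j)-measurable. *)
Record simple_process := SimpleProcess {
  sp_size : nat ;
  sp_time : nat -> R ;
  sp_val : nat -> Omega -> 'rV[R]_m ;
  sp_time_in : forall j, (j <= sp_size)%N -> sp_time j \in `[t, T] ;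
  sp_time_mono : forall j, (j < sp_size)%N -> sp_time j <= sp_time j.+1 ;
  sp_val_measurable : forall j (i : 'I_m), (j < sp_size)%N ->
    F_measurable (sp_time j) (fun w => sp_val j w ord0 i) ;
  sp_val_bounded : exists M : R, forall j w (i : 'I_m), (j < sp_size)%N ->
    `|sp_val j w ord0 i| <= M }.

Definition sp_process (h : simple_process) (s : R) (w : Omega) : 'rV[R]_m :=
  \sum_(j < sp_size h)
    (if s \in `]sp_time h j, sp_time h j.+1] then sp_val h j w else 0).

Definition sp_integral (h : simple_process) (s : R) (w : Omega) : R :=
  \sum_(j < sp_size h)
    dotv (sp_val h j w)
      (W (Num.min s (sp_time h j.+1)) w - W (Num.min s (sp_time h j)) w).

(* I is the Ito integral process (int_t^s <Z_u, dW_u>)_(t <= s <= T): the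
   adapted continuous process that is the L^2-limit of the integrals of simple
   processes converging to Z in H^2. *)
Definition is_ito_integral (Z : R -> Omega -> 'rV[R]_m)
    (I : R -> Omega -> R) : Prop :=
  [/\ progressive I,
      {ae P, forall w, {within `[t, T], continuous (I ^~ w)}} &
      exists h : nat -> simple_process,
        (fun n => H2_normsq (fun s w => sp_process (h n) s w - Z s w))
          @ \oo --> 0%E /\
        forall s, s \in `[t, T] ->
          (fun n => \int[P]_w ((sp_integral (h n) s w - I s w) ^+ 2)%:E)%E
            @ \oo --> 0%E].

(* A choice of version of the Ito integral (it is unique up to
   indistinguishability); the value is meaningful when Z is in H^2. *)
Definition ito_integral (Z : R -> Omega -> 'rV[R]_m) : R -> Omega -> R :=
  xget (fun _ _ => 0) [set I | is_ito_integral Z I].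

(* xi + int_s^T f_u du - int_s^T <Z_u, dW_u> *)
Definition bsde_rhs (xi : Omega -> R) (f : R -> Omega -> R)
    (Z : R -> Omega -> 'rV[R]_m) (s : R) (w : Omega) : R :=
  xi w + Rintegral leb `[s, T] (f ^~ w)
       - (ito_integral Z T w - ito_integral Z s w).

Definition bsde_solution (xi : Omega -> R) (f : R -> Omega -> R)
    (Y : R -> Omega -> R) (Z : R -> Omega -> 'rV[R]_m) : Prop :=
  [/\ S2 Y, H2_vec Z &
      {ae P, forall w, forall s, s \in `[t, T] ->
         Y s w = bsde_rhs xi f Z s w}].

(* Uniqueness in S^2 x H^2 is up to indistinguishability for Y and up to
   equality ds (x) dP-almost everywhere on [t, T] x Omega for Z. *)
Definition same_solution (Y Y' : R -> Omega -> R)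
    (Z Z' : R -> Omega -> 'rV[R]_m) : Prop :=
  {ae P, forall w, forall s, s \in `[t, T] -> Y s w = Y' s w} /\
  {ae (leb \x P)%E, forall p, p.1 \in `[t, T] -> Z p.1 p.2 = Z' p.1 p.2}.

End processes.

(* Main.v *)
(* With A = int_t^T f, the variable xi + A is in L2(F_T), so by martingale
   representation it equals c + int_t^T <Z, dW> with c = E(xi + A); then
   Y_s = c + int_t^s <Z, dW> - int_t^s f solves the equation.  Since
   Ytilde^z_t = c + int_t^T <Z - z, dW>, Ito's isometry gives the identity.
   For uniqueness, int_t^T <Z - Z', dW> = Y'_t - Y_t is F_t-measurable and
   orthogonal to L2(F_t), hence 0.

   The representation is proved by density.  For a phase Theta measurable at
   time a, cos(Theta + lambda.(W_b - W_a)) is expanded along a fine grid of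
   [a, b] into a multiple of cos Theta, an elementary stochastic integral and a
   small error, so trigonometric polynomials in the values of W are
   representable up to L2-limits.  They form an algebra in which indicators of
   {W_u^i > c} can be approximated, and Dynkin's theorem concludes. *)
From HB Require Import structures.
Require Import Defs.
From mathcomp Require Import all_boot all_order all_algebra.
From mathcomp Require Import all_classical all_reals all_analysis.
From mathcomp Require Import measurable_realfun ring lra.
Import Order.TTheory GRing.Theory Num.Theory.
Import numFieldNormedType.Exports.
Set Implicit Arguments.
Unset Strict Implicit.
Unset Printing Implicit Defensive.
Local Open Scope classical_set_scope.
Local Open Scope ring_scope.

(** * Square-integrable functions *)

(** No conditional expectation, stopping time or Ito formula enters: every martingale fact is an
    orthogonality relation drawn from independence, oddness and the second and fourth moments of
    Brownian increments. The fourth moment, of order (b - a)^2, is what makes the grid expansion of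
    the cosine work: each new error is orthogonal to the accumulated one and has second moment of
    order 1/n^2, so n of them add up to 1/n, where the triangle inequality would leave a total that
    does not vanish. Two obstacles shape the rest. The filtration is augmented and [W] is continuous
    only almost surely, so independence, measurability and continuity must be carried across null
    sets; the corrected process [Wt] keeps this local. And [ito_integral] is an arbitrary version,
    known only as an L2 limit, so identities are proved for elementary integrands and passed to the
    limit with the constants 1 + e and 1 + 1/e of Young's inequality: a fixed factor 2 would destroy
    the isometry. *)

Section L2theory.
Context d (T : measurableType d) (R : realType).
Variables (mu : {measure set T -> \bar R}) (D : set T) (mD : measurable D).
Implicit Types f g : T -> R.

Definition sqn f : \bar R := (\int[mu]_(x in D) ((f x) ^+ 2)%:E)%E.

Arguments sqn f%_R.

Definition L2 f := measurable_fun D f /\ (sqn f < +oo)%E.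

Lemma msq f : measurable_fun D f -> measurable_fun D (EFin \o (fun x => f x ^+ 2)).
Proof. by move=> mf; apply/measurable_EFinP; exact: measurable_funX. Qed.

Lemma sqn_ge0 f : (0 <= sqn f)%E.
Proof. by apply: integral_ge0 => x _; rewrite lee_fin sqr_ge0. Qed.

Lemma sqn_eq f g : {in D, f =1 g} -> sqn f = sqn g.
Proof. by move=> fg; apply: eq_integral => x xD; rewrite fg. Qed.

Lemma sqnZ (c : R) f : measurable_fun D f ->
  sqn (fun x => c * f x) = ((c ^+ 2)%:E * sqn f)%E.
Proof.
move=> mf; rewrite /sqn -ge0_integralZl_EFin//; last 2 first.
- exact: msq.
- exact: sqr_ge0.
- by apply: eq_integral => x _; rewrite exprMn EFinM.
- by move=> x _; rewrite lee_fin sqr_ge0.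
Qed.

(** Pointwise, the right side minus the left is (e f - g)^2 / e. Letting e tend to 0 keeps the
    leading constant at 1, which is what lets an isometry survive an L2 limit. *)
Lemma sqn_young (e : R) f g : 0 < e -> measurable_fun D f -> measurable_fun D g ->
  (sqn (fun x => (f x + g x)%R) <= (1 + e)%:E * sqn f + (1 + e^-1)%:E * sqn g)%E.
Proof.
move=> e0 mf mg; have e1 : 0 <= 1 + e by lra.
have e2 : 0 <= 1 + e^-1 by rewrite addr_ge0// invr_ge0 ltW.
have sf : forall x, D x -> (0 <= ((f x) ^+ 2)%:E)%E by move=> x _; rewrite lee_fin sqr_ge0.
have sg : forall x, D x -> (0 <= ((g x) ^+ 2)%:E)%E by move=> x _; rewrite lee_fin sqr_ge0.
rewrite /sqn -!ge0_integralZl_EFin//; try exact: msq.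
rewrite -ge0_integralD//; first last.
- by apply: measurable_funeM; exact: msq.
- by move=> x Dx; rewrite mule_ge0 ?lee_fin ?sqr_ge0.
- by apply: measurable_funeM; exact: msq.
- by move=> x Dx; rewrite mule_ge0 ?lee_fin ?sqr_ge0.
apply: ge0_le_integral => //.
- by move=> x _; rewrite lee_fin sqr_ge0.
- by apply: msq; exact: measurable_funD.
- by apply: emeasurable_funD; apply: measurable_funeM; exact: msq.
- move=> x _; rewrite -!EFinM -EFinD lee_fin.
  rewrite -subr_ge0.
  have -> : (1 + e) * f x ^+ 2 + (1 + e^-1) * g x ^+ 2 - (f x + g x) ^+ 2 =
    e^-1 * (e * f x - g x) ^+ 2.
    by field; rewrite gt_eqF.
  by rewrite mulr_ge0 ?sqr_ge0// invr_ge0 ltW.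
Qed.

Lemma sqnD f g : measurable_fun D f -> measurable_fun D g ->
  (sqn (fun x => (f x + g x)%R) <= 2%:E * sqn f + 2%:E * sqn g)%E.
Proof.
by move=> mf mg; have := @sqn_young 1 f g ltr01 mf mg; rewrite invr1.
Qed.

Lemma sqnN f : sqn (fun x => - f x) = sqn f.
Proof. by apply: eq_integral => x _; rewrite sqrrN. Qed.

Lemma sqnB f g : measurable_fun D f -> measurable_fun D g ->
  (sqn (fun x => (f x - g x)%R) <= 2%:E * sqn f + 2%:E * sqn g)%E.
Proof.
by move=> mf mg; rewrite -(sqnN g); apply: sqnD => //; exact: measurable_funN.
Qed.

Lemma L2_meas f : L2 f -> measurable_fun D f. Proof. by case. Qed.

Lemma L2D f g : L2 f -> L2 g -> L2 (fun x => f x + g x).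
Proof.
move=> [mf lf] [mg lg]; split; first exact: measurable_funD.
apply: (le_lt_trans (sqnD mf mg)); apply: lte_add_pinfty.
  by rewrite lte_mul_pinfty// ?lee_fin.
by rewrite lte_mul_pinfty// ?lee_fin.
Qed.

Lemma L2Z (c : R) f : L2 f -> L2 (fun x => c * f x).
Proof.
move=> [mf lf]; split; first by apply: measurable_funM => //; exact: measurable_cst.
by rewrite sqnZ// lte_mul_pinfty// lee_fin sqr_ge0.
Qed.

Lemma L2N f : L2 f -> L2 (fun x => - f x).
Proof. by move=> [mf lf]; split; [exact: measurable_funN|rewrite sqnN]. Qed.

Lemma L2B f g : L2 f -> L2 g -> L2 (fun x => f x - g x).
Proof. by move=> lf lg; apply: L2D => //; exact: L2N. Qed.

Lemma L2_le f g : measurable_fun D f -> (forall x, D x -> `|f x| <= `|g x|) ->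
  L2 g -> L2 f.
Proof.
move=> mf fg [mg lg]; split => //; apply: le_lt_trans lg.
apply: ge0_le_integral => //.
- by move=> x _; rewrite lee_fin sqr_ge0.
- exact: msq.
- exact: msq.
- move=> x Dx; rewrite lee_fin -[f x ^+ 2]ger0_norm ?sqr_ge0//.
  rewrite -[g x ^+ 2]ger0_norm ?sqr_ge0// !normrX.
  by rewrite lerXn2r ?nnegrE ?normr_ge0 ?fg.
Qed.

Lemma L2_int_sq f : L2 f -> mu.-integrable D (EFin \o (fun x => (f x) ^+ 2)).
Proof.
move=> [mf lf]; apply/integrableP; split; first exact: msq.
under eq_integral do rewrite /= ger0_norm ?sqr_ge0//.
exact: lf.
Qed.

Lemma L2_int_mul f g : L2 f -> L2 g -> mu.-integrable D (EFin \o (fun x => f x * g x)).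
Proof.
move=> lf lg.
apply: (@le_integrable _ _ _ mu D mD _ (fun x => (EFin \o (fun x => (f x ^+ 2)%R)) x + (EFin \o (fun x => (g x ^+ 2)%R)) x)%E).
- apply/measurable_EFinP; apply: measurable_funM; exact: L2_meas.
- move=> x Dx; rewrite /= lee_fin [leRHS]ger0_norm ?addr_ge0 ?sqr_ge0// ler_norml.
  by apply/andP; split; rewrite -subr_ge0; nra.
- by apply: integrableD => //; exact: L2_int_sq.
Qed.

Lemma sqnE f : L2 f -> sqn f = (\int[mu]_(x in D) (f x ^+ 2))%:E.
Proof.
by move=> lf; rewrite /Rintegral fineK//; apply: integrable_fin_num => //; exact: L2_int_sq.
Qed.

Lemma sqn0_ae f : measurable_fun D f -> sqn f = 0%E -> {ae mu, forall x, D x -> f x = 0}.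
Proof.
move=> mf f0.
have := @ae_eq_integral_abs _ _ _ mu D mD (fun x => (f x ^+ 2)%:E) (msq mf).
move=> [+ _]; under eq_integral do rewrite /= ger0_norm ?sqr_ge0//.
move=> /(_ f0); apply: filterS => x /= h Dx.
by have /eqP := h Dx; rewrite eqe sqrf_eq0 => /eqP.
Qed.

Lemma sqn_ae f g : measurable_fun D f -> measurable_fun D g ->
  {ae mu, forall x, D x -> f x = g x} -> sqn f = sqn g.
Proof.
move=> mf mg fg; apply: ge0_ae_eq_integral => //; try exact: msq.
- by move=> x _; rewrite lee_fin sqr_ge0.
- by move=> x _; rewrite lee_fin sqr_ge0.
- by apply: filterS fg => x fg Dx; rewrite fg.
Qed.

Lemma integral_fatou_le (f : nat -> T -> R) (g : T -> R) (C : \bar R) :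
  (forall n, measurable_fun D (f n)) -> (forall n x, D x -> 0 <= f n x) ->
  measurable_fun D g ->
  {ae mu, forall x, D x -> f ^~ x @ \oo --> g x} ->
  (\forall n \near \oo, (\int[mu]_(x in D) (f n x)%:E <= C)%E) ->
  (\int[mu]_(x in D) (g x)%:E <= C)%E.
Proof.
move=> mf f0 mg fg [N _ fC].
have mf' n : measurable_fun D (fun x => (f n x)%:E) by exact/measurable_EFinP.
have f0' n x : D x -> (0 <= (f n x)%:E)%E by move=> Dx; rewrite lee_fin f0.
have := fatou mu mD mf' f0'.
have -> : (\int[mu]_(x in D) limn_einf (fun n => (f n x)%:E) =
  \int[mu]_(x in D) (g x)%:E)%E.
  apply: ae_eq_integral => //.
  - rewrite (_ : (fun x => _) = (fun x => - limn_esup (fun n => - (f n x)%:E))%E).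
      apply: measurableT_comp => //; apply: measurable_fun_limn_esup => n.
      by apply: measurableT_comp => //; exact: mf'.
    by apply/funext => x; rewrite limn_esupN oppeK.
  - exact/measurable_EFinP.
  - apply: filterS fg => x fg Dx.
    have : (f n x)%:E @[n --> \oo] --> (g x)%:E by apply: cvg_EFin; [exact: nearW|exact: fg].
    by move=> /cvg_limn_einf_sup[].
move=> h; apply: (le_trans h).
rewrite limn_einf_lim; apply: lime_le; first exact: is_cvg_einfs.
(* The bound holds only from rank [N] on, so the infimum over the tail from [n] is bounded by the
   term of rank max(n, N). *)
near=> n; apply: (@le_trans _ _ (\int[mu]_(x in D) (f (maxn n N) x)%:E)%E).
  apply: ereal_inf_lbound; exists (maxn n N) => //=; exact: leq_maxl.
by apply: fC => /=; exact: leq_maxr.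
Unshelve. all: by end_near. Qed.

Lemma sqn_fatou (f : nat -> T -> R) (g : T -> R) (C : \bar R) :
  (forall n, measurable_fun D (f n)) -> measurable_fun D g ->
  {ae mu, forall x, D x -> f ^~ x @ \oo --> g x} ->
  (\forall n \near \oo, (sqn (f n) <= C)%E) -> (sqn g <= C)%E.
Proof.
move=> mf mg fg fC.
apply: (@integral_fatou_le (fun n x => f n x ^+ 2)) => //.
- by move=> n; exact: measurable_funX.
- by move=> n x _; exact: sqr_ge0.
- exact: measurable_funX.
- by apply: filterS fg => x h Dx; rewrite expr2; apply: cvgM; exact: h.
Qed.

Lemma sqn_dct (f : nat -> T -> R) (h g : T -> R) :
  (forall n, measurable_fun D (f n)) -> measurable_fun D h -> L2 g ->
  {ae mu, forall x, D x -> f ^~ x @ \oo --> h x} ->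
  (forall n x, D x -> `|f n x| <= g x) ->
  (fun n => sqn (fun x => f n x - h x)) @ \oo --> 0%E.
Proof.
move=> mf mh lg fh fg.
have := @dominated_convergence _ _ _ mu D mD
  (fun n x => ((f n x - h x) ^+ 2)%:E) (cst 0%E) (fun x => ((2 * g x) ^+ 2)%:E).
case.
- by move=> n; apply: msq; exact: measurable_funB.
- exact: measurable_cst.
- apply: filterS fh => x fhx Dx; apply: cvg_EFin; first exact: nearW.
  have : (f n x - h x) @[n --> \oo] --> (h x - h x).
    by apply: cvgB; [exact: fhx|exact: cvg_cst].
  by rewrite subrr => c; have := cvgM c c; rewrite mul0r; exact.
- exact: L2_int_sq (L2Z 2 lg).
- apply: filterS fh => x fhx n Dx; rewrite lee_fin ger0_norm ?sqr_ge0//.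
  (* The limit inherits the bound [g], so f_n - h is dominated by 2 g. *)
  have hg : `|h x| <= g x.
    have : `|f n x| @[n --> \oo] --> `|h x| by apply: cvg_norm; exact: fhx.
    move=> c; rewrite -(cvg_lim _ c)//; apply: limr_le; first by apply/cvg_ex; exists `|h x|.
    by near=> m; exact: fg.
  rewrite -[X in X <= _]ger0_norm ?sqr_ge0// normrX lerXn2r ?nnegrE ?normr_ge0//.
    by rewrite mulr_ge0// (le_trans _ hg).
  by rewrite (le_trans (ler_normB _ _))// mulr_natl mulr2n lerD// fg.
move=> _ _; rewrite integral0_eq//; exact.
Unshelve. all: by end_near. Qed.

(** The integrals of 4^n f_n^2 are bounded by a geometric series of ratio 1/2, so the sum of the 4^n
    f_n^2 is finite almost everywhere and bounds each of its terms. The speed 8^n leaves a spare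
    factor 2^n after the square of 2^n. *)
Lemma ae_fast_decay (f : nat -> T -> R) (C : R) :
  (forall n, measurable_fun D (f n)) ->
  (forall n, (sqn (f n) <= (C / 8 ^+ n)%:E)%E) ->
  {ae mu, forall x, D x -> exists K, forall n, `|f n x| <= K / 2 ^+ n}.
Proof.
move=> mf fC.
have C0 : 0 <= C.
  by have := le_trans (sqn_ge0 _) (fC 0%N); rewrite expr0 divr1 lee_fin.
pose g n x := ((2 ^+ n * f n x) ^+ 2)%:E.
have mg n : measurable_fun D (g n).
  by apply: msq; apply: measurable_funM => //; exact: measurable_cst.
have g0 n x : D x -> (0 <= g n x)%E by move=> _; rewrite lee_fin sqr_ge0.
have G : (\int[mu]_(x in D) (\sum_(n <oo) g n x) < +oo)%E.
  rewrite integral_nneseries//.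
  apply: (@le_lt_trans _ _ (\sum_(n <oo) ((C * 2) / (2 ^ (n + 1))%:R)%:E)%E).
    apply: lee_nneseries => [n _ _|n _]; first by apply: integral_ge0 => x; exact: g0.
    rewrite -[leLHS]/(sqn (fun x => 2 ^+ n * f n x)) sqnZ//.
    apply: (@le_trans _ _ (((2 ^+ n) ^+ 2)%:E * (C / 8 ^+ n)%:E)%E).
      by rewrite lee_wpmul2l// lee_fin sqr_ge0.
    rewrite -EFinM lee_fin.
    have -> : 8 = (2 ^+ 3 : R) by rewrite !exprS expr0; ring.
    rewrite -!exprM natrX exprD expr1.
    have E : 2 ^+ (n * 2) = (2 : R) ^+ (3 * n) / 2 ^+ n.
      rewrite (_ : (3 * n = n * 2 + n)%N); last by rewrite mulSn addnC mulnC.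
      by rewrite exprD mulfK// expf_neq0.
    rewrite E le_eqVlt; apply/orP; left; apply/eqP; field.
    by rewrite !expf_neq0.
  by rewrite (cvg_lim _ (@cvg_geometric_eseries_half _ (C*2) 0%N))//= ltry.
have mG : measurable_fun D (fun x => (\sum_(n <oo) g n x)%E).
  by apply: ge0_emeasurable_sum => // n x Dx _; exact: g0.
have iG : mu.-integrable D (fun x => (\sum_(n <oo) g n x)%E).
  apply/integrableP; split => //.
  rewrite (eq_integral (fun x => (\sum_(n <oo) g n x)%E)) => // x; rewrite inE => Dx.
  by rewrite gee0_abs// nneseries_ge0// => n _ _; exact: g0.
have := integrable_ae mD iG; apply: filterS => x Gx Dx.
have {}Gx := Gx Dx.
(* A bound K on the square of a number bounds its absolute value by 1 + K, which avoids a square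
   root. *)
exists (1 + fine (\sum_(n <oo) g n x)%E) => n.
set K := fine _.
have gK : (2 ^+ n * f n x) ^+ 2 <= K.
  rewrite -lee_fin /K fineK//.
  have := @nneseries_lim_ge R (fun n => g n x) xpredT 0%N n.+1 (fun m _ _ => g0 m x Dx).
  apply: le_trans; rewrite big_nat_recr//= -[leLHS]add0e leeD//.
  by apply: sume_ge0 => m _; exact: g0.
have K0 : 0 <= K by apply: le_trans gK; exact: sqr_ge0.
rewrite ler_pdivlMr ?exprn_gt0// mulrC -[X in X * _](@ger0_norm _ (2 ^+ n)) ?exprn_ge0//.
rewrite -normrM; set a := 2 ^+ n * f n x in gK *.
rewrite ler_norml; apply/andP; split; nra.
Qed.

End L2theory.

Lemma fast_decay_cvg (R : realType) (u : nat -> R) (K : R) :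
  (forall n, `|u n.+1 - u n| <= K / 2 ^+ n) ->
  cvgn u /\ forall n, `|u n - limn u| <= 2 * K / 2 ^+ n.
Proof.
move=> uK.
have K0 : 0 <= K by have := le_trans (normr_ge0 _) (uK 0%N); rewrite expr0 divr1.
(* The subtracted term makes the telescoping induction close: one more step costs exactly the
   decrease of 2 K / 2^(n + m). *)
have aux n m : `|u (n + m)%N - u n| <= 2 * K / 2 ^+ n - 2 * K / 2 ^+ (n + m).
  elim: m => [|m IH]; first by rewrite addn0 !subrr normr0.
  rewrite addnS; have -> : u (n + m).+1 - u n = (u (n + m).+1 - u (n + m)%N) + (u (n + m)%N - u n).
    by ring.
  rewrite (le_trans (ler_normD _ _))//.
  have := uK (n + m)%N; move: IH; rewrite exprS invfM.
  set a := `|_|; set b := `|_|; set c := (2 ^+ (n + m))^-1.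
  move=> h1 h2.
  have -> : 2 * K * (2^-1 * c) = K * c by field.
  by rewrite -mulrA in h1; lra.
have aux2 n m : (n <= m)%N -> `|u m - u n| <= 2 * K / 2 ^+ n.
  move=> nm; have := aux n (m - n)%N; rewrite subnKC// => h.
  by rewrite (le_trans h)// lerBlDr lerDl divr_ge0// mulr_ge0.
have c0 : (2 * K) / 2 ^+ n @[n --> \oo] --> (0 : R).
  have := @cvg_geometric R (2 * K) (2^-1); rewrite ger0_norm// invf_lt1 ?ltr1n// => /(_ isT).
  by rewrite /geometric/=; under eq_fun do rewrite exprVn.
have cu : cvgn u.
  apply: cauchy_cvg; apply/cauchy_exP => e e0.
  have [N _ hN] : \forall n \near \oo, 2 * K / 2 ^+ n < e.
    by move/cvgrPdist_lt : c0 => /(_ e e0); apply: filterS => n; rewrite sub0r normrN; exact: le_lt_trans (ler_norm _).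
  exists (u N); exists N => // n /= Nn.
  by rewrite /ball/= distrC (le_lt_trans (aux2 _ _ Nn))// hN//=.
split=> // n.
rewrite -[u n - _]opprB normrN.
have : `|u m - u n| @[m --> \oo] --> `|limn u - u n|.
  by apply: cvg_norm; apply: cvgB => //; exact: cvg_cst.
move=> c; rewrite -(cvg_lim _ c)//; apply: limr_le; first by apply/cvg_ex; exists `|limn u - u n|.
by exists n => // m /= nm; exact: aux2.
Qed.

(** The integral of a nonnegative function is a supremum over the simple functions below it, hence
    monotone even for nonmeasurable functions. This handles the supremum over uncountably many times
    in [S2]. *)
Lemma le_integral_nonmeas d (T : measurableType d) (R : realType)
    (mu : {measure set T -> \bar R}) (f g : T -> \bar R) :
  (forall x, 0 <= f x)%E -> (forall x, f x <= g x)%E ->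
  (\int[mu]_x f x <= \int[mu]_x g x)%E.
Proof.
move=> f0 fg.
have g0 x : (0 <= g x)%E by exact: le_trans (fg x).
rewrite !ge0_integralTE//.
apply: ge_ereal_sup => _ [h hf <-]; apply: ereal_sup_ubound; exists h => //= x.
by rewrite (le_trans (hf x)).
Qed.


(** * Independence and laws of random vectors *)

(** Independence identifies the joint law of the pair with the product of the marginal laws; Tonelli
    then gives integrability and Fubini the value. *)
Lemma indep_mul d (Om : measurableType d) (R : realType) (P : probability Om R)
    (X Y : Om -> R) :
  (forall A B : set R, measurable A -> measurable B ->
    P (X @^-1` A `&` Y @^-1` B) = (P (X @^-1` A) * P (Y @^-1` B))%E) ->
  P.-integrable setT (EFin \o X) -> P.-integrable setT (EFin \o Y) ->
  P.-integrable setT (EFin \o (fun w => X w * Y w)) /\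
  \int[P]_w (X w * Y w) = (\int[P]_w X w) * (\int[P]_w Y w).
Proof.
move=> ind iX iY.
have mX : measurable_fun setT X by apply/measurable_EFinP; exact: measurable_int iX.
have mY : measurable_fun setT Y by apply/measurable_EFinP; exact: measurable_int iY.
pose X' : {mfun Om >-> R} := HB.pack X (isMeasurableFun.Build _ _ _ _ _ mX).
pose Y' : {mfun Om >-> R} := HB.pack Y (isMeasurableFun.Build _ _ _ _ _ mY).
have mXY : measurable_fun setT (fun w => (X w, Y w)) by exact: measurable_fun_pair.
pose XY' : {mfun Om >-> (R * R)%type} := HB.pack (fun w => (X w, Y w)) (isMeasurableFun.Build _ _ _ _ _ mXY).
pose PX : probability R R := distribution P X'; pose PY : probability R R := distribution P Y'.
have E S : measurable S -> (PX \x PY)%E S = distribution P XY' S.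
  move=> mS; exact: product_measure_unique.
have I (f : R * R -> \bar R) : measurable_fun setT f -> (forall x, 0 <= f x)%E ->
   (\int[P]_w f (X w, Y w) = \int[PX]_x \int[PY]_y f (x, y))%E.
  move=> mf f0; rewrite -[RHS]/(\int[PX]_x fubini_F PY f x)%E.
  rewrite -fubini_tonelli1//.
  rewrite (eq_measure_integral (distribution P XY')); last first.
    by move=> A mA _; exact: E.
  by rewrite ge0_integral_distribution.
have mpxy : measurable_fun setT (fun p : R * R => (p.1 * p.2)).
  by apply: measurable_funM; [exact: measurable_fst|exact: measurable_snd].
have mI : measurable_fun setT (fun w => X w * Y w) by exact: measurable_funM.
have iPX : PX.-integrable setT (EFin \o id).
  apply/integrableP; split; first exact/measurable_EFinP.
  rewrite ge0_integral_distribution//; first by case/integrableP: iX.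
  by apply/measurableT_comp => //; exact/measurable_EFinP.
have iPY : PY.-integrable setT (EFin \o id).
  apply/integrableP; split; first exact/measurable_EFinP.
  rewrite ge0_integral_distribution//; first by case/integrableP: iY.
  by apply/measurableT_comp => //; exact/measurable_EFinP.
have EX : (\int[PX]_x (x%:E) = \int[P]_w (X w)%:E)%E.
  by rewrite integral_distribution//; exact/measurable_EFinP.
have EY : (\int[PY]_x (x%:E) = \int[P]_w (Y w)%:E)%E.
  by rewrite integral_distribution//; exact/measurable_EFinP.
have fY : (\int[PY]_y (`|y|%:E) \is a fin_num)%E.
  exact: (integrable_fin_num _ (integrable_norm iPY)).
have fX : (\int[PX]_y (`|y|%:E) \is a fin_num)%E.
  exact: (integrable_fin_num _ (integrable_norm iPX)).
have iXY : P.-integrable setT (EFin \o (fun w => X w * Y w)).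
  apply/integrableP; split; first exact/measurable_EFinP.
  rewrite (eq_integral (fun w => (`| (X w, Y w).1 * (X w, Y w).2|%:E))%E); last by [].
  rewrite (I (fun p => (`|p.1 * p.2|)%:E)); last 2 first.
  - by apply/measurable_EFinP; exact: measurableT_comp.
  - by move=> x; rewrite lee_fin.
  under eq_integral => x _.
    rewrite /=.
    under eq_integral do rewrite normrM EFinM.
    rewrite ge0_integralZl_EFin//; last first.
      by apply/measurable_EFinP; exact: normr_measurable.
    over.
  rewrite -(fineK fY) ge0_integralZr//.
  - by rewrite -(fineK fX) -EFinM ltry.
  - by apply/measurable_EFinP; exact: normr_measurable.
  - by rewrite lee_fin fine_ge0// integral_ge0.
split => //.
have iPXY : (PX \x PY)%E.-integrable setT (EFin \o (fun p : R * R => p.1 * p.2)).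
  apply/integrableP; split; first exact/measurable_EFinP.
  rewrite fubini_tonelli1//; last first.
    by apply/measurableT_comp => //; exact/measurable_EFinP.
  case/integrableP: iXY => _.
  rewrite (eq_integral (fun w => (`| (X w, Y w).1 * (X w, Y w).2|%:E))%E); last by [].
  rewrite (I (fun p => (`|p.1 * p.2|)%:E))//.
  by apply/measurable_EFinP; exact: measurableT_comp.
have F := integral12_prod_meas1 iPXY.
rewrite /Rintegral -EX -EY.
transitivity (fine (\int[distribution P XY']_p ((p.1 * p.2)%R%:E))%E).
  by rewrite integral_distribution//; exact/measurable_EFinP.
rewrite (eq_measure_integral (PX \x PY)%E); last first.
  by move=> A mA _; exact/esym/E.
rewrite -[X in fine X]F.
rewrite (eq_integral (fun x : R => (x%:E * \int[PY]_y (y%:E))%E)); last first.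
  move=> x _; rewrite /fubini_F/=; under eq_integral do rewrite EFinM.
  by rewrite integralZl.
have fY' : (\int[PY]_y (y%:E) \is a fin_num)%E by exact: (integrable_fin_num _ iPY).
by rewrite -(fineK fY') integralZr//= fineM//; exact: (integrable_fin_num _ iPX).
Qed.

Section rv_sigma.
Context (R : realType) (m : nat).
(* Row vectors with the sigma-algebra generated by the coordinates, which is the
   one [bm_independent] and [bm_gaussian] speak about. *)
Definition cgen : set (set 'rV[R]_m) :=
  [set A | exists (i : 'I_m) (B : set R), measurable B /\ A = [set x : 'rV[R]_m | B (x ord0 i)]].
Definition RV := g_sigma_algebraType cgen.

Lemma coord_meas (i : 'I_m) : measurable_fun [set: RV] (fun x : 'rV[R]_m => x ord0 i).
Proof.
move=> _ B mB; rewrite setTI; apply: sub_sigma_algebra; by exists i, B.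
Qed.

(** The pi-system on which [bm_gaussian] prescribes the law of an increment. *)
Definition boxes : set (set RV) :=
  [set A | exists B : 'I_m -> set R, (forall i, measurable (B i)) /\ A = [set x : 'rV[R]_m | forall i, B i (x ord0 i)]].

Lemma RV_measurable_boxes : (@measurable _ RV) = <<s boxes >>.
Proof.
apply/seteqP; split; apply: smallest_sub.
- exact: smallest_sigma_algebra.
- move=> _ [i [B [mB ->]]]; apply: sub_sigma_algebra.
  exists (fun j => if j == i then B else setT); split.
    by move=> j; case: eqP.
  apply/seteqP; split => x /=; first by move=> Bx j; case: eqP => // ->.
  by move=> /(_ i); rewrite eqxx.
- exact: smallest_sigma_algebra.
- move=> _ [B [mB ->]].
  have -> : [set x : 'rV[R]_m | forall i, B i (x ord0 i)] =
     \bigcap_(i in [set: 'I_m]) [set x : 'rV[R]_m | B i (x ord0 i)].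
    by apply/seteqP; split => x /= h i; [move=> _|]; exact: h.
  have : forall i, measurable ([set x : 'rV[R]_m | B i (x ord0 i)] : set RV).
    by move=> i; rewrite -[X in measurable X]setTI; exact: coord_meas.
  move=> h; apply: (@fin_bigcap_measurable _ RV) => //; exact: finite_finset.
Qed.

Lemma boxes_setI : setI_closed boxes.
Proof.
move=> _ _ [B [mB ->]] [C [mC ->]]; exists (fun i => B i `&` C i); split.
  by move=> i; exact: measurableI.
apply/seteqP; split => x /=; first by move=> [h1 h2] i; split.
by move=> h; split=> i; case: (h i).
Qed.

Lemma RV_measure_unique (m1 m2 : {measure set RV -> \bar R}) :
  (m1 setT < +oo)%E ->
  (forall A, boxes A -> m1 A = m2 A) -> forall A, measurable A -> m1 A = m2 A.
Proof.
move=> m1oo h A mA; apply: (@measure_unique _ R RV boxes (fun=> setT)) => //.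
- exact: RV_measurable_boxes.
- exact: boxes_setI.
- move=> _; exists (fun=> setT); split => //; by apply/seteqP; split.
- by rewrite bigcup_const.
Qed.
End rv_sigma.

(** * Moments of the normal law *)

Lemma cvg_le_harmonic (R : realType) (u : nat -> R) (l C : R) N :
  (forall n, (N <= n)%N -> `|u n - l| <= C / n.+1%:R) -> u @ \oo --> l.
Proof.
move=> h; apply/cvgrPdist_le => e e0.
have c0 : C / n.+1%:R @[n --> \oo] --> (0 : R).
  rewrite -[X in _ --> X](mulr0 C); apply: cvgM; first exact: cvg_cst.
  exact: cvg_harmonic.
move/cvgrPdist_le : c0 => /(_ e e0) [M _ hM]; exists (maxn M N) => // n /=.
rewrite geq_max => /andP[Mn Nn].
rewrite distrC (le_trans (h n Nn))//.
by have := hM n Mn; rewrite sub0r normrN => /(le_trans (ler_norm _)).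
Qed.

(** The upper bound comes from expR h * (1 - h) <= expR h * expR (- h) = 1 together with (1 + h + 2
    h^2)(1 - h) = 1 + h^2 (1 - 2 h) >= 1. *)
Lemma expR_taylor1 (R : realType) (h : R) : `|h| <= 2^-1 -> `|expR h - 1 - h| <= 2 * h ^+ 2.
Proof.
rewrite ler_norml => /andP[h1 h2].
have a := expR_ge1Dx h; have b := expR_ge1Dx (- h).
rewrite ger0_norm; last by lra.
have e0 := expR_gt0 h; have := expRxMexpNx_1 h => E.
have d1 : expR h * (1 - h) <= 1 by rewrite -[leRHS]E ler_wpM2l// ltW.
suff : expR h <= 1 + h + 2 * h ^+ 2 by lra.
have k : 0 <= h ^+ 2 * (1 - 2 * h) by rewrite mulr_ge0 ?sqr_ge0//; lra.
have k2 : 1 <= (1 + h + 2 * h ^+ 2) * (1 - h).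
  have -> : (1 + h + 2 * h ^+ 2) * (1 - h) = 1 + h ^+ 2 * (1 - 2 * h) by ring.
  by rewrite lerDl.
have h3 : 0 < 1 - h by lra.
by rewrite -(ler_pM2r h3) (le_trans d1).
Qed.

(** For u >= 0 the factor expR u is pulled out, leaving 1 - expR (- 2 u), which lies between 0 and 2
    u. The symmetric right side serves as domination for the second moment of the normal law. *)
Lemma expR_sub_le (R : realType) (u : R) :
  (expR u - expR (- u)) ^+ 2 <= 4 * u ^+ 2 * (expR (2 * u) + expR (- (2 * u))).
Proof.
wlog u0 : u / 0 <= u.
  move=> h; have [|u0] := leP 0 u; first exact: h.
  have := h (- u); rewrite oppr_ge0 (ltW u0) => /(_ isT).
  rewrite !mulrN !opprK sqrrN [expR (- (2 * u)) + _]addrC => h'.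
  by apply: le_trans h'; rewrite -opprB sqrrN.
have E : expR u - expR (- u) = expR u * (1 - expR (- (2 * u))).
  by rewrite mulrBr mulr1 -expRD; congr (_ - expR _); ring.
have a := expR_ge1Dx (- (2 * u)); have b : expR (- (2 * u)) <= 1.
  by rewrite expR_le1; lra.
rewrite E exprMn -expRM_natl.
have p1 := expR_ge0 (2 * u); have p2 := expR_ge0 (- (2 * u)).
have : (1 - expR (- (2 * u))) ^+ 2 <= 4 * u ^+ 2.
  have -> : 4 * u ^+ 2 = (2 * u) ^+ 2 by ring.
  by rewrite lerXn2r ?nnegrE//; lra.
move=> h; rewrite (le_trans (ler_wpM2l p1 h))// mulrC.
by rewrite ler_wpM2l ?lerDl// mulr_ge0// sqr_ge0.
Qed.

Section normal_moments.
Context (R : realType) (s : R) (s0 : 0 < s).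
Let nu := normal_prob 0 s.
Let s1 : s != 0. Proof. by rewrite gt_eqF. Qed.

(** The Radon-Nikodym derivative of the normal law and its density integrate to the same measure, so
    they agree almost everywhere. *)
Lemma ge0_integral_normal_prob (f : R -> \bar R) : (forall x, 0 <= f x)%E ->
  measurable_fun setT f ->
  (\int[nu]_x f x = \int[lebesgue_measure]_x (f x * (normal_pdf 0 s x)%:E))%E.
Proof.
move=> f0 mf.
rewrite -(Radon_Nikodym_SigmaFinite.change_of_variables (normal_prob_dominates 0 s))//.
have mpdf : measurable_fun setT (fun x => (normal_pdf 0 s x)%:E).
  by apply/measurable_EFinP; exact: measurable_normal_pdf.
have iRN := Radon_Nikodym_SigmaFinite.f_integrable (normal_prob_dominates 0 s).
apply: ae_eq_integral => //.
- apply: emeasurable_funM => //; exact: measurable_int iRN.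
- exact: emeasurable_funM.
- apply: ae_eqe_mul2l; apply: integral_ae_eq => // E _ mE.
  rewrite -Radon_Nikodym_SigmaFinite.f_integral//.
  exact: normal_prob_dominates.
Qed.

(** Completing the square turns expR (l x) times the density into a constant times the density
    centred at l s^2. *)
Lemma normal_mgf (l : R) :
  (\int[nu]_x (expR (l * x))%:E = (expR (l ^+ 2 * s ^+ 2 / 2))%:E)%E.
Proof.
rewrite ge0_integral_normal_prob; last 2 first.
- by move=> x; rewrite lee_fin expR_ge0.
- by apply/measurable_EFinP; apply: measurableT_comp => //; exact: mulrl_measurable.
transitivity (\int[lebesgue_measure]_x ((expR (l ^+ 2 * s ^+ 2 / 2))%:E * (normal_pdf (l * s ^+ 2) s x)%:E))%E.
  apply: eq_integral => x _; rewrite -!EFinM; congr (_%:E).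
  rewrite !normal_pdfE// /normal_fun mulrCA [in RHS]mulrCA; congr (_ * _).
  by rewrite -!expRD; congr expR; field.
rewrite ge0_integralZl_EFin//.
- by rewrite integral_normal_pdf mule1.
- by move=> x _; rewrite lee_fin normal_pdf_ge0.
- by apply/measurable_EFinP; exact: measurable_normal_pdf.
Qed.

Lemma mexp (l : R) : measurable_fun setT (fun x : R => expR (l * x)).
Proof. by apply: measurableT_comp => //; exact: mulrl_measurable. Qed.

Lemma normal_expR_integrable (l : R) : nu.-integrable setT (EFin \o (fun x => expR (l * x))).
Proof.
apply/integrableP; split; first by apply/measurable_EFinP; exact: mexp.
under eq_integral do rewrite /= ger0_norm ?expR_ge0//.
by rewrite normal_mgf ltry.
Qed.

Lemma normal_cosh (l : R) :
  (\int[nu]_x (expR (l * x) + expR (- l * x))%:E = (2 * expR (l ^+ 2 * s ^+ 2 / 2))%:E)%E.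
Proof.
under eq_integral do rewrite EFinD.
rewrite ge0_integralD//.
- by rewrite !normal_mgf sqrrN -EFinD; congr (_%:E); ring.
- by apply/measurable_EFinP; exact: mexp.
- by apply/measurable_EFinP; exact: mexp.
Qed.

Lemma pow_le_cosh (k : nat) (x : R) : ~~ odd k.+1 -> x ^+ k.+1 / k.+1`!%:R <= expR x + expR (- x).
Proof.
move=> ek; wlog x0 : x / 0 <= x.
  move=> h; have [|x0] := leP 0 x; first exact: h.
  have := h (- x); rewrite oppr_ge0 (ltW x0) opprK exprNn => /(_ isT).
  by rewrite -signr_odd (negbTE ek) expr0 mul1r addrC.
have := @expR_ge1Dxn R x k x0; have := expR_ge0 (- x); lra.
Qed.

(** Only the order s^4 matters. The constant is 2 * 4!: the fourth power of x / s is at most 4!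
    times the sum of expR (x / s) and expR (- x / s), whose mean is 2 expR (1/2). *)
Lemma normal_fourth : (\int[nu]_x (x ^+ 4)%:E <= (48 * expR (2^-1) * s ^+ 4)%:E)%E.
Proof.
have mg : measurable_fun setT (fun x : R => (expR (s^-1 * x) + expR (- s^-1 * x))%:E).
  by apply/measurable_EFinP; apply: measurable_funD; exact: mexp.
apply: (@le_trans _ _ (\int[nu]_x ((24 * s ^+ 4)%:E * (expR (s^-1 * x) + expR (- s^-1 * x))%:E)%E)%E).
  apply: ge0_le_integral => //.
  - by move=> x _; rewrite lee_fin exprn_even_ge0.
  - by apply/measurable_EFinP; exact: exprn_measurable.
  - exact: measurable_funeM.
  - move=> x _; rewrite -EFinM lee_fin.
    have := @pow_le_cosh 3 (s^-1 * x) isT.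
    rewrite mulNr exprMn -[4`!]/24%N; set e := _ + _; move=> h.
    rewrite -mulrA -ler_pdivrMl// mulrC -ler_pdivrMl ?exprn_gt0// mulrA -exprVn//.
rewrite ge0_integralZl_EFin//; last by rewrite mulr_ge0// exprn_ge0// ltW.
rewrite normal_cosh -EFinM lee_fin exprVn mulVf ?expf_neq0// mul1r.
by rewrite le_eqVlt; apply/orP; left; apply/eqP; ring.
Qed.

(** With N = n + 1 and h = x / N this is N^2 (expR h + expR (- h) - 2), a second difference quotient
    that tends to x^2 and whose integral is explicit by [normal_cosh]. *)
Let g n (x : R) := (n.+1%:R * (expR (x / (2 * n.+1%:R)) - expR (- (x / (2 * n.+1%:R))))) ^+ 2.

(** The second moment is the second derivative of the moment generating function at 0. It is
    obtained as the limit of 2 N^2 (expR (s^2 / (2 N^2)) - 1), with dominated convergence in place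
    of differentiation under the integral. *)
Lemma normal_second : (\int[nu]_x (x ^+ 2)%:E = (s ^+ 2)%:E)%E.
Proof.
have gE n x : g n x = n.+1%:R ^+ 2 * (expR (n.+1%:R^-1 * x) + expR (- n.+1%:R^-1 * x)) - 2 * n.+1%:R ^+ 2.
  rewrite /g exprMn; set u := x / _.
  have -> : n.+1%:R^-1 * x = u + u by rewrite /u; field.
  have -> : - n.+1%:R^-1 * x = - u - u by rewrite /u; field.
  by rewrite !expRD; have := expRxMexpNx_1 u; set a := expR u; set b := expR _ => E; ring: E.
have mg n : measurable_fun setT (fun x => (g n x)%:E).
  apply/measurable_EFinP; rewrite (_ : g n = fun x => n.+1%:R ^+ 2 * (expR (n.+1%:R^-1 * x) + expR (- n.+1%:R^-1 * x)) - 2 * n.+1%:R ^+ 2); last by apply/funext => x; exact: gE.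
  apply: measurable_funB => //; apply: measurable_funM => //.
  by apply: measurable_funD; exact: mexp.
have gx x : g ^~ x @ \oo --> x ^+ 2.
  suff h : (n.+1%:R * (expR (x / (2 * n.+1%:R)) - expR (- (x / (2 * n.+1%:R))))) @[n --> \oo] --> x.
    by rewrite expr2; have := cvgM h h; exact.
  have [N hN] : exists N : nat, `|x| <= N%:R.
    by exists (Num.bound `|x|); rewrite ltW// archi_boundP.
  apply: (@cvg_le_harmonic R _ _ (x ^+ 2) N) => n Nn.
  set u := x / _.
  have xu : x = 2 * n.+1%:R * u by rewrite /u; field.
  have u12 : `|u| <= 2^-1.
    rewrite /u normrM normfV (@ger0_norm _ (2 * _))// ler_pdivrMr// mulrA mulVf// mul1r.
    by rewrite (le_trans hN)// ler_nat ltnW.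
  have h1 := expR_taylor1 u12; have := @expR_taylor1 R (- u); rewrite normrN => /(_ u12) h2.
  have -> : n.+1%:R * (expR u - expR (- u)) - x = n.+1%:R * ((expR u - 1 - u) - (expR (- u) - 1 - - u)).
    by rewrite {1}xu; ring.
  rewrite normrM ger0_norm//.
  have -> : x ^+ 2 / n.+1%:R = n.+1%:R * (4 * u ^+ 2) by rewrite xu; field.
  rewrite ler_wpM2l// (le_trans (ler_normB _ _))//.
  by move: h1 h2; rewrite sqrrN; set a := `|_|; set b := `|_|; lra.
have sg n : (\int[nu]_x (g n x)%:E = (2 * n.+1%:R ^+ 2 * (expR (n.+1%:R^-1 ^+ 2 * s ^+ 2 / 2) - 1))%:E)%E.
  transitivity (\int[nu]_x ((n.+1%:R ^+ 2 * (expR (n.+1%:R^-1 * x) + expR (- n.+1%:R^-1 * x)))%:E - (2 * n.+1%:R ^+ 2)%:E))%E.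
    by apply: eq_integral => x _; rewrite gE EFinB.
  have I : nu.-integrable setT (EFin \o (fun x => (expR (n.+1%:R^-1 * x) + expR (- n.+1%:R^-1 * x)))).
    have := integrableD measurableT (normal_expR_integrable (n.+1%:R^-1)) (normal_expR_integrable (- n.+1%:R^-1)).
    by apply: eq_integrable.
  have I2 := integrableZl measurableT (n.+1%:R ^+ 2) I.
  rewrite integralB_EFin//; last exact: finite_measure_integrable_cst.
  rewrite integral_cst//= probability_setT mule1.
  under eq_integral do rewrite EFinM.
  rewrite integralZl// normal_cosh -EFinM -EFinB; congr (_%:E); ring.
have lim2 : (2 * n.+1%:R ^+ 2 * (expR (n.+1%:R^-1 ^+ 2 * s ^+ 2 / 2) - 1)) @[n --> \oo] --> s ^+ 2.
  have [N hN] : exists N : nat, s ^+ 2 <= N%:R.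
    by exists (Num.bound (s ^+ 2)); rewrite ltW// archi_boundP// sqr_ge0.
  apply: (@cvg_le_harmonic R _ _ (s ^+ 4) N) => n Nn.
  set h := _ / 2.
  have hE : s ^+ 2 = 2 * n.+1%:R ^+ 2 * h by rewrite /h; field.
  have h0 : 0 <= h by rewrite /h divr_ge0// mulr_ge0// ?sqr_ge0// exprn_ge0.
  have n1 : 1 <= n.+1%:R :> R by rewrite ler1n.
  have h12 : `|h| <= 2^-1.
    rewrite ger0_norm// /h ler_pdivrMr// mulVf// exprVn mulrC ler_pdivrMr ?exprn_gt0// mul1r.
    rewrite (le_trans hN)// (@le_trans _ _ n.+1%:R) ?ler_nat//; first exact: ltnW.
    by rewrite expr2 ler_peMr.
  have := expR_taylor1 h12 => t.
  have -> : 2 * n.+1%:R ^+ 2 * (expR h - 1) - s ^+ 2 = 2 * n.+1%:R ^+ 2 * (expR h - 1 - h).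
    by rewrite hE; ring.
  rewrite normrM ger0_norm ?mulr_ge0 ?sqr_ge0//.
  rewrite (@le_trans _ _ (2 * n.+1%:R ^+ 2 * (2 * h ^+ 2)))//.
    by rewrite ler_wpM2l// mulr_ge0// sqr_ge0.
  have -> : 2 * n.+1%:R ^+ 2 * (2 * h ^+ 2) = s ^+ 4 / n.+1%:R ^+ 2.
    have -> : s ^+ 4 = (s ^+ 2) ^+ 2 by rewrite -exprM.
    by rewrite hE; field.
  rewrite ler_wpM2l ?exprn_ge0 ?(ltW s0)// lef_pV2 ?posrE ?exprn_gt0// expr2 ler_peMr//.
have := @dominated_convergence _ _ _ nu setT measurableT (fun n x => (g n x)%:E) (fun x => (x ^+ 2)%:E)
  (fun x => (8 * (expR (2 * x) + expR (- 2 * x)))%:E).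
case.
- exact: mg.
- by apply/measurable_EFinP; exact: exprn_measurable.
- by apply: aeW => x _; apply: cvg_EFin; [exact: nearW|exact: gx].
- have := integrableZl measurableT 8 (integrableD measurableT (normal_expR_integrable 2) (normal_expR_integrable (- 2))).
  by apply: eq_integrable.
- apply: aeW => x n _; rewrite lee_fin ger0_norm ?sqr_ge0// /g exprMn.
  set u := x / _.
  have xu : x = 2 * n.+1%:R * u by rewrite /u; field.
  have h := expR_sub_le u.
  apply: (@le_trans _ _ (n.+1%:R ^+ 2 * (4 * u ^+ 2 * (expR (2 * u) + expR (- (2 * u)))))).
    by rewrite ler_wpM2l ?sqr_ge0.
  have -> : n.+1%:R ^+ 2 * (4 * u ^+ 2 * (expR (2 * u) + expR (- (2 * u)))) = x ^+ 2 * (expR (2 * u) + expR (- (2 * u))).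
    by rewrite xu; ring.
  have ux : expR (2 * u) + expR (- (2 * u)) <= expR x + expR (- x) + expR x + expR (- x).
    have ux' : `|2 * u| <= `|x|.
      rewrite xu -mulrA !normrM ler_wpM2l// ler_peMl// ger0_norm// ler1n//.
    have e1 : expR (2 * u) <= expR `|x| by rewrite ler_expR (le_trans (ler_norm _)).
    have e2 : expR (- (2 * u)) <= expR `|x| by rewrite ler_expR (le_trans (ler_norm _))// normrN.
    have e3 : expR `|x| <= expR x + expR (- x).
      case: (ler0P x) => x0; [rewrite lerDr|rewrite lerDl]; exact: expR_ge0.
    by rewrite -addrA; apply: lerD; [exact: le_trans e3|exact: le_trans e3].
  have := @pow_le_cosh 1 x isT; rewrite -[2`!]/2%N => x2.
  have p : 0 <= x ^+ 2 by exact: sqr_ge0.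
  have E1 : expR (2 * x) = expR x ^+ 2 by rewrite -expRM_natl.
  have E2 : expR (- 2 * x) = expR (- x) ^+ 2 by rewrite -expRM_natl; congr expR; ring.
  rewrite E1 E2; have a0 := expR_ge0 x; have b0 := expR_ge0 (- x).
  have ab := expRxMexpNx_1 x.
  move: a0 b0 ux x2 ab; set a := expR x; set b := expR (- x); move=> a0 b0 + x2 ab.
  set c := _ + expR (- _); move=> ux.
  have ab0 : 0 <= a + b by exact: addr_ge0.
  (* Both factors, x^2 and expR (2 u) + expR (- 2 u), are at most 2 (a + b), and (a + b)^2 <= 2 (a^2
     + b^2) gives the constant 8. *)
  apply: (@le_trans _ _ ((2 * (a + b)) * (2 * (a + b)))).
    apply: (@le_trans _ _ (x ^+ 2 * (2 * (a + b)))); first by rewrite ler_wpM2l//; lra.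
    by rewrite ler_wpM2r ?mulr_ge0//; lra.
  by rewrite -subr_ge0; have := sqr_ge0 (a - b); nra.
move=> _ _; under eq_fun do rewrite sg.
move=> c; rewrite -(cvg_lim _ c)//; apply/cvg_lim => //.
by apply: cvg_EFin; [exact: nearW|exact: lim2].
Qed.
End normal_moments.

(** * Null sets, bounded multipliers and product integrals *)

Lemma negligible_ae d (Om : measurableType d) (R : realType) (P : {measure set Om -> \bar R})
  (A : set Om) : P.-negligible A -> {ae P, forall w, ~ A w}.
Proof.
by move=> [N [mN N0 AN]]; exists N; split => // w /= h; apply: AN; exact: contrapT.
Qed.

Lemma ae_iff_measure d (Om : measurableType d) (R : realType) (P : {measure set Om -> \bar R})
  (A B : set Om) : measurable A -> measurable B -> {ae P, forall w, A w <-> B w} -> P A = P B.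
Proof.
move=> mA mB [N [mN N0 h]].
have E C : measurable C -> P C = P (C `\` N).
  move=> mC; have -> : P C = (P (C `\` N) + P (C `&` N))%E by exact: measureDI.
  rewrite (_ : P (C `&` N) = 0%E) ?adde0//.
  apply/eqP; rewrite eq_le measure_ge0 andbT -N0 le_measure ?inE//.
  exact: measurableI.
rewrite (E A)// (E B)//; congr (P _); apply/seteqP; split => w [Cw Nw]; split => //.
- have : A w <-> B w by apply: contrapT => k; apply: Nw; exact: h.
  by move=> [+ _]; exact.
- have : A w <-> B w by apply: contrapT => k; apply: Nw; exact: h.
  by move=> [_]; exact.
Qed.

Lemma g_sigma_sub (T : Type) (G X : set (set T)) : sigma_algebra setT X ->
  G `<=` X -> forall A, <<s G >> A -> X A.
Proof. by move=> sX GX A; apply; split. Qed.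

Lemma normal_prob_sym (R : realType) (s : R) (B : set R) : s != 0 -> measurable B ->
  normal_prob 0 s (-%R @^-1` B) = normal_prob 0 s B.
Proof.
move=> s0 mB; have mN : measurable_fun [set: measurableTypeR R] (-%R : _ -> measurableTypeR R).
  exact: oppr_measurable.
pose N : {mfun measurableTypeR R >-> measurableTypeR R} :=
  HB.pack (-%R : measurableTypeR R -> measurableTypeR R) (isMeasurableFun.Build _ _ _ _ _ mN).
have E x : normal_pdf 0 s (- x) = normal_pdf 0 s x.
  by rewrite normal_pdfE// /normal_fun !subr0 sqrrN.
rewrite /normal_prob.
rewrite [RHS](eq_measure_integral (pushforward (@lebesgue_measure R) N)); last first.
  by move=> A mA _; apply/esym; exact: lebesgue_measureN.
rewrite ge0_integral_pushforward; first last.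
- by move=> y _; rewrite lee_fin normal_pdf_ge0.
- by apply: measurable_funTS; apply/measurable_EFinP; exact: measurable_normal_pdf.
- exact: mB.
- exact: mN.
by apply: eq_integral => x _ /=; rewrite E.
Qed.


(** Strips the null sets from an augmented sigma-algebra: it then suffices to treat the generators,
    and a negligible generator is almost surely empty. *)
Lemma ae_sigma_algebra d (T : measurableType d) (R : realType) (P : {measure set T -> \bar R})
    (G : set (set T)) :
  sigma_algebra setT [set A | exists A', <<s G >> A' /\ {ae P, forall w, A w <-> A' w}].
Proof.
split.
- by exists set0; split; [exact: sigma_algebra0|exact: aeW].
- move=> A [A' [sA' h]]; exists (setT `\` A'); split.
    exact: sigma_algebraCD.
  by apply: filterS h => w h; split => -[_ k]; split => // k'; apply: k; apply/h.
- move=> F hF; have [F' hF'] := choice hF.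
  exists (\bigcup_k F' k); split.
    by apply: sigma_algebra_bigcup => k; case: (hF' k).
  have : {ae P, forall w, forall k, F k w <-> F' k w}.
    by apply: ae_foralln => k; case: (hF' k).
  by apply: filterS => w h; split => -[k _ Fk]; exists k => //; apply/h.
Qed.

Section more_L2.
Context d (T : measurableType d) (R : realType).
Variables (mu : {measure set T -> \bar R}) (D : set T) (mD : measurable D).

Lemma L2_bdd_mul (a f : T -> R) (M : R) : measurable_fun D a ->
  (forall x, `|a x| <= M) -> L2 mu D f -> L2 mu D (fun x => a x * f x).
Proof.
move=> ma aM lf; apply: (@L2_le _ _ _ mu D mD _ (fun x => M * f x)).
- by apply: measurable_funM => //; exact: L2_meas lf.
- move=> x _; rewrite !normrM ler_wpM2r// (le_trans (aM x))//; exact: ler_norm.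
- exact: L2Z.
Qed.

Lemma L2_bdd (f : T -> R) (M : R) : (mu D < +oo)%E -> measurable_fun D f ->
  (forall x, `|f x| <= M) -> L2 mu D f.
Proof.
move=> muD mf fM; apply: (@L2_le _ _ _ mu D mD _ (cst M)) => //.
  by move=> x _; rewrite (le_trans (fM x))// ler_norm.
split; first exact: measurable_cst.
rewrite /sqn (eq_integral (cst (M ^+ 2)%:E))// integral_cst//.
by rewrite lte_mul_pinfty ?lee_fin ?sqr_ge0.
Qed.

End more_L2.

Lemma integral_prod_mul d1 d2 (T1 : measurableType d1) (T2 : measurableType d2) (R : realType)
  (m1 : {sigma_finite_measure set T1 -> \bar R}) (m2 : {sigma_finite_measure set T2 -> \bar R})
  (f : T1 -> R) (g : T2 -> R) :
  m1.-integrable setT (EFin \o f) -> m2.-integrable setT (EFin \o g) ->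
  (m1 \x m2)%E.-integrable setT (EFin \o (fun p => f p.1 * g p.2)) /\
  \int[(m1 \x m2)%E]_p (f p.1 * g p.2) = (\int[m1]_x f x) * (\int[m2]_y g y).
Proof.
move=> If Ig.
have mf : measurable_fun setT f by apply/measurable_EFinP; exact: measurable_int If.
have mg : measurable_fun setT g by apply/measurable_EFinP; exact: measurable_int Ig.
have fF := integrable_fin_num measurableT If.
have fG := integrable_fin_num measurableT Ig.
have fF' := integrable_fin_num measurableT (integrable_norm If).
have fG' := integrable_fin_num measurableT (integrable_norm Ig).
have mfg : measurable_fun setT (fun p : T1 * T2 => f p.1 * g p.2).
  by apply: measurable_funM; exact: measurableT_comp.
have I : (m1 \x m2)%E.-integrable setT (EFin \o (fun p => f p.1 * g p.2)).
  apply/integrableP; split; first exact/measurable_EFinP.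
  rewrite fubini_tonelli1//; last first.
    by apply/measurableT_comp => //; exact/measurable_EFinP.
  rewrite /fubini_F/=.
  rewrite (eq_integral (fun x => (`|f x|%:E * \int[m2]_y `|g y|%:E)%E)); last first.
    move=> x _; under eq_integral do rewrite normrM EFinM.
    rewrite ge0_integralZl_EFin//.
    by apply/measurable_EFinP; exact: measurableT_comp.
  rewrite /= in fF' fG'; rewrite -(fineK fG') ge0_integralZr//.
  - by rewrite -(fineK fF') -EFinM ltry.
  - by apply/measurable_EFinP; exact: measurableT_comp.
  - by rewrite lee_fin fine_ge0// integral_ge0.
split => //.
rewrite /Rintegral -(integral12_prod_meas1 I) /fubini_F/=.
rewrite (eq_integral (fun x => ((f x)%:E * \int[m2]_y (g y)%:E)%E)); last first.
  move=> x _; under eq_integral do rewrite EFinM.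
  by rewrite integralZl.
by rewrite /= in fF fG; rewrite -(fineK fG) integralZr//= fineM.
Qed.

(** * Continuity on a compact interval *)

Section clamp.
Context (R : realType) (t T : R) (tT : t <= T).
(** The retraction of the line onto [t, T]. Composing with it turns continuity within the interval
    into plain continuity; with symmetric bounds it also serves as truncation. *)
Definition clamp (s : R) := Num.max t (Num.min s T).

Lemma clamp_in s : t <= clamp s <= T.
Proof. by rewrite le_max lexx/= ge_max tT ge_min lexx orbT. Qed.

Lemma clamp_id s : t <= s <= T -> clamp s = s.
Proof. by move=> /andP[ts sT]; rewrite /clamp min_l// max_r. Qed.

Lemma clamp_cont : continuous clamp.
Proof.
move=> s; rewrite /clamp.
have c1 : (fun s => Num.min s T) @ s --> Num.min s T.
  by apply: continuous_min; [exact: cvg_id|exact: cvg_cst].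
exact: (@continuous_max _ _ (fun=> t) (fun s => Num.min s T) s (@cvg_cst _ _ _ _ _) c1).
Qed.

Lemma within_clamp (f : R -> R) : {within `[t, T], continuous f} -> continuous (f \o clamp).
Proof.
move=> /subspace_continuousP cf s.
have h : `[t, T]%classic (clamp s) by rewrite /= in_itv/= clamp_in.
move=> A /(cf _ h); rewrite /within/= => nA.
have := clamp_cont nA.
by apply: (@filterS _ (nbhs s)) => u /= h'; apply: h'; rewrite in_itv/= clamp_in.
Qed.

Lemma clamp_within (f : R -> R) : continuous (f \o clamp) -> {within `[t, T], continuous f}.
Proof.
move=> cf; apply/subspace_continuousP => s; rewrite /= in_itv/= => h A.
have := cf s A; rewrite /= (clamp_id h) => cA /cA; rewrite /within/=.
by apply: (@filterS _ (nbhs s)) => u /= Au; rewrite in_itv/= => hu; move: Au; rewrite /= clamp_id.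
Qed.
End clamp.

(** * Uniform grids and Doob's inequality along a path *)

Section grid.
Context (R : realType) (a b : R).
(* The points [a + k / (n+1)], stopped at [b]. *)
Definition gp (n k : nat) : R := Num.min b (a + k%:R / n.+1%:R).
Definition gidx (n : nat) (s : R) : nat := Num.truncn ((s - a) * n.+1%:R).
(** The extra step guarantees that the grid has reached [b]; when the step divides b - a, the last
    interval is empty. *)
Definition gnum (n : nat) : nat := (gidx n b).+1.

Lemma gp0 n : a <= b -> gp n 0 = a.
Proof. by move=> ab; rewrite /gp mul0r addr0 min_r. Qed.

Lemma gidx_itv n s : a <= s -> a + (gidx n s)%:R / n.+1%:R <= s < a + (gidx n s).+1%:R / n.+1%:R.
Proof.
move=> as_; have n0 : 0 < n.+1%:R :> R by [].
have : 0 <= (s - a) * n.+1%:R by rewrite mulr_ge0// subr_ge0.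
move=> /truncn_itv /andP[h1 h2]; rewrite -/(gidx n s) in h1 h2.
rewrite -lerBrDl -ltrBlDl ler_pdivrMr// h1/= ltr_pdivlMr//.
Qed.

Lemma gp_last n : a <= b -> gp n (gnum n) = b.
Proof. by move=> ab; rewrite /gp min_l//; case/andP: (gidx_itv n ab) => _ /ltW. Qed.

Lemma gp_le n k : gp n k <= b. Proof. by rewrite /gp ge_min lexx. Qed.

Lemma gp_ge n k : a <= b -> a <= gp n k.
Proof. by move=> ab; rewrite /gp le_min ab lerDl divr_ge0. Qed.

Lemma gp_mono n k : gp n k <= gp n k.+1.
Proof.
rewrite /gp le_min ge_min lexx/= ge_min; apply/orP; right.
by rewrite lerD2l ler_wpM2r ?invr_ge0// ler_nat.
Qed.

Lemma gp_step n k : gp n k.+1 - gp n k <= n.+1%:R^-1.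
Proof.
have e0 : 0 <= n.+1%:R^-1 :> R by rewrite invr_ge0.
rewrite /gp -natr1 mulrDl mul1r; set x := _ / _; move: e0; set e := _^-1 => e0.
by case: (leP b (a + x)) => h1; case: (leP b (a + (x + e))) => h2; lra.
Qed.

Lemma gidx_le n s : a <= s -> s <= b -> (gidx n s < gnum n)%N.
Proof.
move=> as_ sb; rewrite /gnum ltnS -(@ler_nat R).
have /andP[h1 _] := gidx_itv n as_; have /andP[_ h2] := gidx_itv n (le_trans as_ sb).
have := le_lt_trans h1 (le_lt_trans sb h2).
by rewrite ltrD2l ltr_pM2r ?invr_gt0// ltr_nat ltnS ler_nat.
Qed.

Lemma gp_gidx n s : a <= s -> s <= b -> gp n (gidx n s) <= s < gp n (gidx n s) + n.+1%:R^-1.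
Proof.
move=> as_ sb; have /andP[h1 h2] := gidx_itv n as_.
have -> : gp n (gidx n s) = a + (gidx n s)%:R / n.+1%:R by rewrite /gp min_r// (le_trans h1).
by rewrite h1/= -addrA -[X in _ + (_ + X)]mul1r -mulrDl natr1.
Qed.

Lemma gp_cvg s : a <= s -> s <= b -> (fun n => gp n (gidx n s)) @ \oo --> s.
Proof.
move=> as_ sb; apply: (@cvg_le_harmonic R _ _ 1 0) => n _.
have /andP[h1 h2] := gp_gidx n as_ sb.
by rewrite ler0_norm ?subr_le0// mul1r opprB lerBlDl ltW.
Qed.

Lemma gp_cvg_fun (f : R -> R) s : a <= b -> a <= s -> s <= b -> continuous (f \o clamp a b) ->
  (fun n => f (gp n (gidx n s))) @ \oo --> f s.
Proof.
move=> ab as_ sb cf.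
have -> : f s = (f \o clamp a b) s by rewrite /= clamp_id// as_.
rewrite (_ : (fun n => _) = (f \o clamp a b) \o (fun n => gp n (gidx n s))); last first.
  by apply/funext => n; rewrite /= clamp_id// gp_ge// gp_le.
by apply: continuous_cvg; [exact: cf|exact: gp_cvg].
Qed.
End grid.

Fixpoint rmax (R : realType) (x : nat -> R) n : R :=
  if n is n'.+1 then Num.max (rmax x n') (x n) else x 0%N.

Lemma rmax_ge (R : realType) (x : nat -> R) n k : (k <= n)%N -> x k <= rmax x n.
Proof.
elim: n => [|n IH]; first by rewrite leqn0 => /eqP ->.
by rewrite leq_eqVlt => /predU1P[->|/IH h] /=; rewrite le_max ?lexx ?orbT// h.
Qed.

Lemma rmax_le (R : realType) (x : nat -> R) n c : (forall k, x k <= c) -> rmax x n <= c.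
Proof. by move=> h; elim: n => [|n IH] //=; rewrite ge_max IH h. Qed.

Lemma rmax_ge0 (R : realType) (x : nat -> R) n : (forall k, 0 <= x k) -> 0 <= rmax x n.
Proof. by move=> h; apply: le_trans (h 0%N) (rmax_ge _ _). Qed.

(* Summation by parts: the running maximum S only moves where it equals x. *)
Lemma doob_pathwise (R : realType) (x : nat -> R) n : (forall k, 0 <= x k) ->
  rmax x n ^+ 2 + 4 * \sum_(k < n) rmax x k * (x k.+1 - x k) <= 4 * x n ^+ 2.
Proof.
move=> x0.
(* With y the running maximum and z the last value, four times this bound leaves 4 y z - y^2 <= 4
   z^2, which is (2 z - y)^2 >= 0. *)
suff h : \sum_(k < n) rmax x k * (x k.+1 - x k) <= rmax x n * x n - rmax x n ^+ 2 / 2.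
  have := sqr_ge0 (2 * x n - rmax x n); move: h; set S := \sum_(_ < _) _.
  by set y := rmax x n; set z := x n; move=> h1 h2; nra.
elim: n => [|n IH] /=; first by rewrite big_ord0; have := sqr_ge0 (x 0%N); nra.
rewrite big_ord_recr/=; set S := \sum_(_ < _) _ in IH *.
have r0 := rmax_ge0 n x0; have xn := x0 n.+1.
have h1 := sqr_ge0 (rmax x n - x n.+1).
move: IH r0 xn h1; move: (rmax x n) (x n) (x n.+1) S => r y z S IH r0 z0 h1.
have [h|h] := leP r z; last by nra.
by move: h1; rewrite sqrrB; nra.
Qed.

(** * Fubini on a strip and approximation by step functions *)

Section strip.
Context d2 (T2 : measurableType d2) (R : realType).
Local Notation leb := (@lebesgue_measure R).
Variables (D : set (measurableTypeR R)) (mD : measurable D).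

Lemma strip_patch (F : measurableTypeR R * T2 -> \bar R) w :
  (\int[leb]_(x in D) F (x, w) = \int[leb]_x (F \_ (D `*` setT)) (x, w))%E.
Proof.
rewrite integral_mkcond; apply: eq_integral => x _; rewrite !patchE.
congr (if _ then _ else _); apply/idP/idP; rewrite !inE /=; first by move=> ?; split.
by case.
Qed.

Lemma strip_patch_meas (F : measurableTypeR R * T2 -> \bar R) :
  measurable_fun (D `*` setT) F -> measurable_fun setT (F \_ (D `*` setT)).
Proof. by move=> mF; apply/(measurable_restrictT _ _).1 => //; exact: measurableX. Qed.

Lemma strip_patch_ge0 (F : measurableTypeR R * T2 -> \bar R) :
  (forall p, (D `*` setT) p -> 0 <= F p)%E -> forall p, (0 <= (F \_ (D `*` setT)) p)%E.
Proof. by move=> F0 p; rewrite patchE; case: ifPn => //; rewrite inE; exact: F0. Qed.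

Lemma strip_meas (F : measurableTypeR R * T2 -> \bar R) :
  measurable_fun (D `*` setT) F -> (forall p, (D `*` setT) p -> 0 <= F p)%E ->
  measurable_fun setT (fun w => \int[leb]_(x in D) F (x, w))%E.
Proof.
move=> mF F0; under eq_fun do rewrite strip_patch.
apply: (@measurable_fun_fubini_tonelli_G _ _ (measurableTypeR R) T2 R leb).
  exact: strip_patch_meas.
exact: strip_patch_ge0.
Qed.

Lemma strip_fubini (P : {sigma_finite_measure set T2 -> \bar R}) (F : measurableTypeR R * T2 -> \bar R) :
  measurable_fun (D `*` setT) F -> (forall p, (D `*` setT) p -> 0 <= F p)%E ->
  (\int[leb \x P]_(p in D `*` setT) F p = \int[P]_w \int[leb]_(x in D) F (x, w))%E.
Proof.
move=> mF F0; under [RHS]eq_integral do rewrite strip_patch.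
rewrite [LHS]integral_mkcond.
rewrite (@fubini_tonelli2 _ _ (measurableTypeR R) T2 R leb P)//.
  exact: strip_patch_meas.
exact: strip_patch_ge0.
Qed.

Lemma strip_section (F : measurableTypeR R * T2 -> R) w :
  measurable_fun (D `*` setT) F -> measurable_fun D (fun x => F (x, w)).
Proof.
move=> mF _ B mB.
have mA : measurable (D `*` setT `&` F @^-1` B) by apply: mF => //; exact: measurableX.
have := @pair2_measurable _ _ (measurableTypeR R) T2 w measurableT _ mA; rewrite setTI.
congr (measurable _); apply/seteqP; split => x /=; first by move=> [[]].
by move=> [].
Qed.

Lemma strip_Rint_meas (F : measurableTypeR R * T2 -> R) :
  measurable_fun (D `*` setT) F ->
  measurable_fun setT (fun w => Rintegral leb D (fun x => F (x, w))).
Proof.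
move=> mF; have mE : measurable_fun (D `*` setT) (EFin \o F) by exact/measurable_EFinP.
(* Splitting into positive and negative parts is how the integral is defined, so the identity also
   holds on sections that are not integrable. *)
rewrite (_ : (fun w => _) = fine \o (fun w => \int[leb]_(x in D) ((EFin \o F)^\+)%E (x, w) - \int[leb]_(x in D) ((EFin \o F)^\-)%E (x, w)))%E; last first.
  apply/funext => w; rewrite /comp /Rintegral [in LHS]integralE; by congr (fine (_ - _)%E); apply: eq_integral => x _; rewrite !(funepos.unlock, funeneg.unlock).
apply: measurableT_comp; first exact: fine_measurable.
apply: emeasurable_funB; apply: strip_meas.
- exact: measurable_funepos.
- by [].
- exact: measurable_funeneg.
- by [].
Qed.
End strip.

Section step.
Context (R : realType) (a b : R) (ab : a <= b).
Local Notation leb := (@lebesgue_measure R).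

(* On ]g_k, g_(k+1)] the step function takes the average over the preceding
   interval, so that it is adapted when [g] is. *)
Definition step_avg (g : R -> R) (n k : nat) : R :=
  if k is k'.+1 then n.+1%:R * Rintegral leb `[gp a b n k', gp a b n k] g else 0.

(* The last grid point strictly before [x]. *)
Definition lgp (n : nat) (x : R) : R := a + ((Num.ceil ((x - a) * n.+1%:R))%:~R - 1) / n.+1%:R.

Lemma lgp_itv n x : lgp n x < x <= lgp n x + n.+1%:R^-1.
Proof.
rewrite /lgp; have := ceil_itv ((x - a) * n.+1%:R); set c := Num.ceil _; rewrite intrD => /andP[h1 h2].
have n0 : 0 < n.+1%:R :> R by [].
rewrite -ltrBrDl ltr_pdivrMr// h1/= -addrA -[X in _ <= _ + (_ + X)]mul1r -mulrDl subrK.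
by rewrite -lerBlDl ler_pdivlMr.
Qed.

Lemma lgp_gp n x : a < x -> x <= b -> exists k, [/\ (k < gnum a b n)%N,
  lgp n x = a + k%:R / n.+1%:R & gp a b n k = lgp n x].
Proof.
move=> ax xb; have /andP[h1 h2] := lgp_itv n x.
have n0 : 0 < n.+1%:R :> R by [].
have c0 : 0 < Num.ceil ((x - a) * n.+1%:R) by rewrite ceil_gt0 mulr_gt0// subr_gt0.
have [k ck] : exists k : nat, Num.ceil ((x - a) * n.+1%:R) = k.+1%:Z.
  by case: (Num.ceil _) c0 => [[|k]|k]// _; exists k.
have E : lgp n x = a + k%:R / n.+1%:R by rewrite /lgp ck -pmulrn (mulrSr _ k) addrK.
exists k; split => //; last by rewrite /gp min_r -?E// ltW// (lt_le_trans h1).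
have /andP[_ h3] := gidx_itv n ab.
have := lt_trans h1 (le_lt_trans xb h3).
by rewrite E ltrD2l ltr_pM2r ?invr_gt0// ltr_nat.
Qed.

(** The interval over which the step function averages at x. It lies strictly to the left of x,
    which keeps the step function adapted; differentiation along nicely shrinking sets still
    applies. *)
Definition lwin (x : R) (n : nat) : set R := `[lgp n x - n.+1%:R^-1, lgp n x]%classic.

Lemma lwin_nice x : nicely_shrinking x (lwin x).
Proof.
split; first by move=> n; exact: measurable_itv.
have e0 n : 0 < 3 * n.+1%:R^-1 :> R by rewrite mulr_gt0// invr_gt0.
(* The window lies within 2 / (n + 1) of x, hence in the ball of radius 3 / (n + 1), whose length is
   6 times that of the window. *)
exists (6, fun n => PosNum (e0 n)); split => //=.
- rewrite -[X in _ --> X](mulr0 3); apply: cvgMr; exact: cvg_harmonic.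
- move=> n y; rewrite /lwin /ball/= in_itv/= => /andP[h1 h2].
  have /andP[h3 h4] := lgp_itv n x.
  have i0 : 0 < n.+1%:R^-1 :> R by rewrite invr_gt0.
  rewrite ltr_norml; move: h1 h2 h3 h4 i0; set i := n.+1%:R^-1; set l := lgp _ _; lra.
- move=> n; have i0 : 0 < n.+1%:R^-1 :> R by rewrite invr_gt0.
  rewrite lebesgue_measure_ball; last exact: ltW.
  rewrite /lwin lebesgue_measure_itv/= lte_fin ltrBlDr ltrDl i0.
  rewrite -EFinD -EFinM lee_fin mulr2n; move: i0; set i := n.+1%:R^-1; set l := lgp _ _; lra.
Qed.

(** Exactly one grid interval contains x. The lower bound on n excludes the first interval, where
    the step function is 0. *)
Lemma step_eval g n x (v := step_avg g n) : a < x -> x <= b -> 2 < (x - a) * n.+1%:R ->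
  \sum_(k < gnum a b n) (if x \in `]gp a b n k, gp a b n k.+1] then v k else 0) =
  n.+1%:R * Rintegral leb (lwin x n) g.
Proof.
move=> ax xb hx; have [k [kn E1 E2]] := lgp_gp n ax xb.
have /andP[h1 h2] := lgp_itv n x.
have n0 : 0 < n.+1%:R :> R by [].
have i0 : 0 < n.+1%:R^-1 :> R by rewrite invr_gt0.
rewrite (bigD1 (Ordinal kn))//= big1 ?addr0; last first.
  move=> i /eqP ik; case: ifPn => //; rewrite in_itv/= => /andP[g1 g2]; exfalso; apply: ik.
  apply: val_inj => /=; apply/eqP.
  have g1' : a + i%:R / n.+1%:R < x.
    by move: g1; rewrite /gp; have [?|?] := leP b (a + i%:R / n.+1%:R) => // /lt_le_trans /(_ xb); rewrite ltxx.
  have g2' : x <= a + i.+1%:R / n.+1%:R by apply: (le_trans g2); rewrite /gp ge_min lexx orbT.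
  rewrite E1 in h1 h2; rewrite -addrA -[X in _ <= _ + (_ + X)]mul1r -mulrDl natr1 in h2.
  rewrite eqn_leq; apply/andP; split; rewrite -ltnS -(@ltr_nat R).
    by have := lt_le_trans g1' h2; rewrite ltrD2l ltr_pM2r// invr_gt0.
  by have := lt_le_trans h1 g2'; rewrite ltrD2l ltr_pM2r// invr_gt0.
have -> : x \in `]gp a b n k, gp a b n k.+1].
  rewrite in_itv/= E2 h1/= /gp le_min xb/= (le_trans h2)// E1 -addrA -[X in _ + (_ + X)]mul1r -mulrDl natr1//.
case: k kn E1 E2 => [|k] kn E1 E2.
  exfalso; rewrite mul0r addr0 in E1; move: h2; rewrite E1 -lerBlDl -[X in _ <= X]mul1r ler_pdivlMr// => h2.
  by have := lt_le_trans hx h2; lra.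
rewrite /v /step_avg; congr (_ * Rintegral _ _ _); rewrite E2 /lwin.
suff -> : gp a b n k = lgp n x - n.+1%:R^-1 by [].
have E3 : lgp n x - n.+1%:R^-1 = a + k%:R / n.+1%:R by rewrite E1 -[in LHS](natr1 k) mulrDl mul1r addrA addrK.
by rewrite E3 /gp min_r// -E3 (le_trans _ xb)// (le_trans _ (ltW h1))// lerBlDr lerDl ltW.
Qed.

(** At a Lebesgue point of the extension by 0, the averages over [lwin] converge; for large n the
    window lies inside [a, b], where the extension and [f] coincide. *)
Lemma step_cvg (f : R -> R) : leb.-integrable `[a, b] (EFin \o f) ->
  {ae leb, forall x, a < x -> x <= b ->
    (fun n => \sum_(k < gnum a b n) (if x \in `]gp a b n k, gp a b n k.+1] then step_avg f n k else 0)) @ \oo --> f x}.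
Proof.
move=> fi; have loc := integrable_locally_restrict (measurable_itv _) fi.
apply: (@filterS _ _ (ae_filter_ringOfSetsType leb)) (lebesgue_differentiation loc) => x px ax xb.
have := nice_lebesgue_differentiation lwin_nice loc px.
have -> : (f \_ `[a, b]) x = f x by rewrite patchE mem_set//= in_itv/= xb ltW.
move=> /fine_cvg /= h; apply: cvg_trans h; apply: near_eq_cvg.
have h2 : \forall n \near \oo, 2 / (x - a) < n.+1%:R.
  apply: filterS (nbhs_infty_gtr (2 / (x - a))) => n /lt_le_trans; apply.
  by rewrite ler_nat.
near=> n.
have hn : 2 < (x - a) * n.+1%:R by rewrite mulrC -ltr_pdivrMr ?subr_gt0//; near: n.
have i0 : 0 < n.+1%:R^-1 :> R by rewrite invr_gt0.
rewrite (step_eval f ax xb hn) /lwin /= lebesgue_measure_itv/= lte_fin ltrBlDr ltrDl i0.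
rewrite -EFinB opprB addrC subrK inver gt_eqF// invrK.
have sub : lwin x n `<=` `[a, b]%classic.
  move=> y; rewrite /lwin /= !in_itv/= => /andP[y1 y2].
  have /andP[l1 l2] := lgp_itv n x.
  rewrite (le_trans y2 (le_trans (ltW l1) xb)) andbT (le_trans _ y1)//.
  have : 2 * n.+1%:R^-1 < x - a by rewrite -ltr_pdivlMr ?invr_gt0// invrK.
  by move: l1 l2 i0; set i := n.+1%:R^-1; set l := lgp _ _; lra.
rewrite (@eq_integral _ _ _ leb (lwin x n) (EFin \o f)); last first.
  by move=> y yD; rewrite /= patchE mem_set//; apply: sub; exact: set_mem.
rewrite -(@fineK _ (\int[leb]_(y in lwin x n) (EFin \o f) y)%E).
  by rewrite -EFinM.
apply: integrable_fin_num; first exact: measurable_itv.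
exact: (@integrableS _ _ R leb `[a, b]%classic (lwin x n) (EFin \o f) (measurable_itv _) (measurable_itv _) sub fi).
Unshelve. all: by end_near.
Qed.
End step.

(** * Limits of errors and integrals over a compact interval *)

Lemma sqn_le d (T : measurableType d) (R : realType) (mu : {measure set T -> \bar R}) (D : set T)
  (f g : T -> R) : measurable D -> measurable_fun D f -> measurable_fun D g ->
  (forall x, D x -> `|f x| <= `|g x|) -> (sqn mu D f <= sqn mu D g)%E.
Proof.
move=> mD mf mg fg; apply: ge0_le_integral => //.
- by move=> x _; rewrite lee_fin sqr_ge0.
- exact: msq.
- exact: msq.
- by move=> x Dx; rewrite lee_fin -(ger0_norm (sqr_ge0 (f x))) -(ger0_norm (sqr_ge0 (g x))) !normrX lerXn2r ?nnegrE ?normr_ge0// fg.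
Qed.

Lemma cvg0_le (R : realType) (u : nat -> \bar R) (e : R) : u @ \oo --> 0%E -> 0 < e ->
  \forall n \near \oo, (u n <= e%:E)%E.
Proof.
move=> c0 e0; apply: (c0 [set x | (x <= e%:E)%E]).
exists e => //= y; rewrite /= sub0r normrN => /ltW h; rewrite lee_fin.
exact: le_trans (ler_norm _) h.
Qed.

(** The intervals are disjoint, so at most one term survives: when the last one is active,
    monotonicity of the grid silences all earlier ones. *)
Lemma disj_sum_le (R : realType) (tau v : nat -> R) (s M : R) N : (forall k, tau k <= tau k.+1) ->
  0 <= M -> (forall k, `|v k| <= M) ->
  `|\sum_(k < N) (if s \in `]tau k, tau k.+1] then v k else 0)| <= M.
Proof.
move=> /nondecreasing_seqP mono M0 vM; elim: N => [|N IH]; first by rewrite big_ord0 normr0.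
rewrite big_ord_recr/=; case: ifPn; last by rewrite addr0.
rewrite in_itv/= => /andP[h1 _]; rewrite big1 ?add0r// => i _; rewrite ifF//.
apply/negbTE; rewrite in_itv/= negb_and; apply/orP; right; rewrite -ltNge (le_lt_trans _ h1)//.
exact: mono.
Qed.

Section bounded_interval.
Context (R : realType).
Local Notation leb := (@lebesgue_measure R).
Local Notation Ib r s := (`[r, s]%classic : set (measurableTypeR R)).

Lemma mIb (r s : R) : measurable (Ib r s). Proof. exact: measurable_itv. Qed.

Lemma leb_Ib (r s : R) : r <= s -> leb (Ib r s) = (s - r)%:E.
Proof.
rewrite [leb _]lebesgue_measure_itv/= lte_fin le_eqVlt => /predU1P[->|->]; last by rewrite -EFinD.
by rewrite ltxx subrr.
Qed.

Lemma leb_Ib_fin (r s : R) : (leb (Ib r s) < +oo)%E.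
Proof.
rewrite [X in (X < _)%E]lebesgue_measure_itv/=; case: ifP => // _.
by rewrite -EFinD ltry.
Qed.

Lemma L2_Ib_bdd (g : R -> R) r s M : measurable_fun (Ib r s) g -> (forall x, `|g x| <= M) -> L2 leb (Ib r s) g.
Proof. by move=> mg gM; exact: (@L2_bdd _ _ R leb _ (mIb r s) g M (leb_Ib_fin r s) mg gM). Qed.

Lemma L2_Ib_integrable (g : R -> R) r s : L2 leb (Ib r s) g -> leb.-integrable (Ib r s) (EFin \o g).
Proof.
move=> l1; have l2 : L2 leb (Ib r s) (cst 1) by apply: (@L2_Ib_bdd _ _ _ 1) => // x; rewrite normr1.
have := L2_int_mul (mIb r s) l1 l2; apply: eq_integrable => // x _; by rewrite /= mulr1.
Qed.

Lemma bdd_Rint_le (g : R -> R) r s M : r <= s -> measurable_fun (Ib r s) g -> (forall x, `|g x| <= M) ->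
  `|Rintegral leb (Ib r s) g| <= M * (s - r).
Proof.
move=> rs mg gM; have gi := L2_Ib_integrable (L2_Ib_bdd mg gM).
have M0 : 0 <= M := le_trans (normr_ge0 _) (gM 0).
apply: (le_trans (le_normr_Rintegral (mIb r s) gi)).
have -> : M * (s - r) = Rintegral leb (Ib r s) (cst M).
  by rewrite (@Rintegral_cst _ _ R leb (Ib r s) (mIb r s)) [X in fine X](leb_Ib rs).
apply: le_Rintegral => //.
- apply: L2_Ib_integrable; apply: (@L2_Ib_bdd _ _ _ M) => [|x]; last by rewrite normr_id.
  by apply: measurableT_comp mg; exact: normr_measurable.
- by apply: L2_Ib_integrable; apply: (@L2_Ib_bdd _ _ _ M) => // x; rewrite ger0_norm.
Qed.
End bounded_interval.

Lemma cvg0_harmonic (R : realType) (u : nat -> \bar R) (K : R) :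
  (forall n, 0 <= u n)%E -> (forall n, (u n <= (K / n.+1%:R)%:E)%E) -> u @ \oo --> 0%E.
Proof.
move=> u0 uK.
have c0 : (fun n => (K / n.+1%:R)%:E) @ \oo --> 0%E.
  apply: cvg_EFin; first exact: nearW.
  by rewrite -[X in _ --> X](mulr0 K); apply: cvgMr; exact: cvg_harmonic.
apply: (@squeeze_cvge _ _ _ _ (cst 0%E)) c0; last exact: cvg_cst.
by apply: nearW => n; rewrite u0 uK.
Qed.

(** The shape in which approximate isometries appear: e is the parameter of two successive Young
    inequalities and x a squared approximation error, chosen after e. *)
Lemma young_limit_le (R : realType) (a : \bar R) (b : R) : 0 <= b ->
  (forall e x : R, 0 < e -> 0 < x ->
    (a <= (1 + e)%:E * ((1 + e)%:E * b%:E + (1 + e^-1)%:E * x%:E) + (1 + e^-1)%:E * x%:E)%E) ->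
  (a <= b%:E)%E.
Proof.
move=> b0 h; apply/lee_addgt0Pr => d d0.
(* The choices of [e] and [x] make the excess over b equal to 2 e b + e^2 b plus two terms d / 6
   plus e d / 6, at most six times d / 6. *)
pose e := Num.min 1 (d / (6 * (b + 1))).
have e0 : 0 < e by rewrite lt_min ltr01/= divr_gt0// mulr_gt0//; lra.
have e1 : e <= 1 by rewrite ge_min lexx.
have e2 : e * (6 * (b + 1)) <= d.
  by rewrite -ler_pdivlMr ?mulr_gt0 ?ltr_wpDl// ge_min lexx orbT.
have i0 : 0 < 1 + e^-1 by rewrite addr_gt0// invr_gt0.
pose x := d / (6 * (1 + e^-1)).
have x0 : 0 < x by rewrite divr_gt0// mulr_gt0.
have xE : (1 + e^-1) * x = d / 6.
  by rewrite /x; field; rewrite !gt_eqF//=; lra.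
apply: (le_trans (h e x e0 x0)).
rewrite -[leRHS]/((b + d)%:E).
rewrite -[leLHS]/(((1 + e) * ((1 + e) * b + (1 + e^-1) * x) + (1 + e^-1) * x)%:E) lee_fin xE.
have eb : e * b <= d / 6 by nra.
have ed : e * d <= d by nra.
nra.
Qed.

(** * Trigonometric bounds and smooth approximation of the sign *)

Section trig_bounds.
Context (R : realType).

Lemma derive_ge0_ge0 (f f' : R -> R) : (forall x : R, is_derive x 1 f (f' x)) ->
  (forall x, 0 < x -> 0 <= f' x) -> f 0 = 0 -> forall x, 0 <= x -> 0 <= f x.
Proof.
move=> df f'0 f0 x x0; rewrite -f0; apply: (@ger0_derive1_ndecry R f 0) => //.
- move=> y; rewrite in_itv/= andbT => y0; rewrite derive1E (@derive_val _ _ _ _ _ _ _ (df y)).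
  exact: f'0.
- by apply: derivable_within_continuous => y _; have [] := df y.
Qed.

Lemma abs_sin_le (x : R) : `|sin x| <= `|x|.
Proof.
wlog x0 : x / 0 <= x.
  move=> h; have [|/ltW x0] := leP 0 x; first exact: h.
  by rewrite -normrN -sinN -(normrN x); apply: h; rewrite oppr_ge0.
have h1 : 0 <= x - sin x.
  apply: (@derive_ge0_ge0 (fun x => x - sin x) (fun x => 1 - cos x)) => [y _||//].
  - by rewrite subr_ge0 cos_le1.
  - by rewrite sin0 subr0.
have h2 : 0 <= x + sin x.
  apply: (@derive_ge0_ge0 (fun x => x + sin x) (fun x => 1 + cos x)) => [y _||//].
  - by have := cos_geN1 y; lra.
  - by rewrite sin0 addr0.
by rewrite (ger0_norm x0) ler_norml; lra.
Qed.

Lemma cos_sub1_le (x : R) : 0 <= 1 - cos x <= x ^+ 2 / 2.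
Proof.
rewrite subr_ge0 cos_le1/=.
have -> : 1 - cos x = 2 * sin (x / 2) ^+ 2.
  have := cos_mulr2n (x / 2); have := cos2Dsin2 (x / 2).
  rewrite (_ : (x / 2) *+ 2 = x); last by rewrite -mulr_natr divfK.
  by move=> h ->; lra.
have : sin (x / 2) ^+ 2 <= (x / 2) ^+ 2.
  by rewrite -[leLHS]ger0_norm ?sqr_ge0// -[leRHS]ger0_norm ?sqr_ge0// !normrX lerXn2r ?nnegrE ?normr_ge0// abs_sin_le.
lra.
Qed.

Lemma sin_sub_le (x : R) : `|sin x - x| <= x ^+ 2 / 2.
Proof.
wlog x0 : x / 0 <= x.
  move=> h; have [|/ltW x0] := leP 0 x; first exact: h.
  have := h (- x); rewrite oppr_ge0 => /(_ x0).
  by rewrite sinN -opprD normrN sqrrN.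
have h1 : 0 <= x - sin x.
  by have := abs_sin_le x; rewrite (ger0_norm x0) => /(le_trans (ler_norm _)); lra.
have h2 : 0 <= x ^+ 2 / 2 - (x - sin x).
  apply: (@derive_ge0_ge0 (fun x => x ^+ 2 / 2 - (x - sin x)) (fun x => x - (1 - cos x))) => [y|||//].
  - by apply: is_derive_eq; rewrite /GRing.scale/=; field.
  (* The derivative y - (1 - cos y) is nonnegative: by the quadratic bound up to 2, and because 1 -
     cos y <= 2 afterwards. *)
  - move=> y y0; have /andP[c1 c2] := cos_sub1_le y; have c3 := cos_geN1 y.
    have [y1|y1] := leP y 2; last by lra.
    have : y ^+ 2 / 2 <= y by nra.
    lra.
  - by rewrite sin0 expr0n/=; lra.
by rewrite ler0_norm; lra.
Qed.

(* Odd, with attracting fixed points -1 and 1: its iterates on [-1, 1] converge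
   to the sign. *)
Definition smoothstep (y : R) : R := (3 * y - y ^+ 3) / 2.

Lemma smoothstep_odd y : smoothstep (- y) = - smoothstep y.
Proof. by rewrite /smoothstep; field. Qed.

Lemma smoothstep_iter_odd n y : iter n smoothstep (- y) = - iter n smoothstep y.
Proof. by elim: n => //= n ->; rewrite smoothstep_odd. Qed.

Lemma smoothstep_itv y : 0 <= y <= 1 -> y <= smoothstep y <= 1.
Proof. move=> /andP[y0 y1]; rewrite /smoothstep.
have h1 : 0 <= y * ((1 - y) * (1 + y)) by rewrite !mulr_ge0//; lra.
have h2 : 0 <= (1 - y) ^+ 2 * (2 + y) by rewrite mulr_ge0 ?sqr_ge0//; lra.
by apply/andP; split; lra. Qed.

(** Each step multiplies the distance to 1 by 1 - (u + u^2) / 2, which is at most 1 - y / 2 because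
    the iterates stay above y. *)
Lemma smoothstep_iter_geo n (y : R) : 0 < y <= 1 ->
  y <= iter n smoothstep y <= 1 /\ 1 - iter n smoothstep y <= (1 - y / 2) ^+ n.
Proof.
move=> /andP[y0 y1]; elim: n => [|n [/andP[h1 h2] h3]] /=; first by rewrite lexx y1 expr0; split => //; lra.
set u := iter n _ _ in h1 h2 h3 *.
have u0 : 0 <= u <= 1 by apply/andP; split; lra.
have /andP[k1 k2] := smoothstep_itv u0; split; first by rewrite (le_trans h1 k1) k2.
have -> : 1 - smoothstep u = (1 - (u + u ^+ 2) / 2) * (1 - u) by rewrite /smoothstep; field.
have e0 : 0 <= (1 - y / 2) ^+ n by rewrite exprn_ge0//; lra.
rewrite [leRHS]exprS ler_pM//; nra.
Qed.

Lemma smoothstep_iter_le n (y : R) : `|y| <= 1 -> `|iter n smoothstep y| <= 1.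
Proof.
wlog y0 : y / 0 <= y.
  move=> h y1; have [y0|/ltW y0] := leP 0 y; first exact: h.
  by rewrite -normrN -smoothstep_iter_odd; apply: h; rewrite ?oppr_ge0 ?normrN.
rewrite (ger0_norm y0) => y1.
move: y0; rewrite le_eqVlt => /predU1P[<-|y0].
  have -> : iter n smoothstep 0 = 0 by elim: n => //= n ->; rewrite /smoothstep mulr0 expr0n subrr mul0r.
  by rewrite normr0.
have [/andP[h1 h2] _] := @smoothstep_iter_geo n y (introT andP (conj y0 y1)).
by rewrite ger0_norm//; lra.
Qed.

Lemma smoothstep_iter_cvg (y : R) : `|y| <= 1 -> (fun n => iter n smoothstep y) @ \oo --> Num.sg y.
Proof.
wlog y0 : y / 0 <= y.
  move=> h y1; have [y0|/ltW y0] := leP 0 y; first exact: h.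
  have := h (- y); rewrite oppr_ge0 normrN => /(_ y0 y1) c.
  have c' := cvgN c; rewrite sgrN opprK in c'.
  have {}c' := c' _.
  rewrite (_ : (fun n => _) = - (fun n => iter n smoothstep (- y))); first exact: c'.
  by apply/funext => n; rewrite fctE smoothstep_iter_odd opprK.
rewrite (ger0_norm y0) => y1.
move: y0; rewrite le_eqVlt => /predU1P[<-|y0].
  rewrite sgr0; apply: cvg_near_cst; apply: nearW => n.
  by elim: n => //= n ->; rewrite /smoothstep mulr0 expr0n subrr mul0r.
rewrite gtr0_sg//.
have hg : (fun n => (1 - y / 2) ^+ n) @ \oo --> (0 : R).
  by apply: cvg_expr; rewrite ger0_norm; lra.
apply/cvgrPdist_le => e e0; move/cvgrPdist_le : hg => /(_ e e0); apply: filterS => n.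
rewrite sub0r normrN => h.
have [/andP[h1 h2] h3] := @smoothstep_iter_geo n y (introT andP (conj y0 y1)).
rewrite ger0_norm ?subr_ge0//; apply: (le_trans h3); apply: le_trans h; exact: ler_norm.
Qed.
End trig_bounds.

(** The shift by 1 / (k + 1) puts y = 0 on the negative side, so the limit is the strict inequality;
    dividing by k + 1 eventually brings the argument between - pi and pi, where the sine has the
    sign of its argument. *)
Lemma sg_sin_cvg (R : realType) (y : R) :
  (fun k => (1 + Num.sg (sin ((y - k.+1%:R^-1) / k.+1%:R))) / 2) @ \oo --> ((0 < y)%R%:R : R).
Proof.
apply: cvg_near_cst.
have pi0 := @pi_gt0 R.
have i0 k : 0 < k.+1%:R^-1 :> R by rewrite invr_gt0.
have i1 k : k.+1%:R^-1 <= 1 :> R by rewrite invf_le1// ler1n.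
have big (x : R) : \forall k \near \oo, x < k.+1%:R.
  by apply: filterS (nbhs_infty_gtr x) => n /lt_le_trans; apply; rewrite ler_nat.
have [y0|y0] := ltP 0 y.
  near=> k.
  have h1 : k.+1%:R^-1 < y by rewrite invf_plt ?posrE//; near: k; exact: big.
  rewrite gtr0_sg; first by rewrite /= mulr1n; field.
  apply: sin_gt0_pi; rewrite divr_gt0 ?subr_gt0//= ltr_pdivrMr// (@lt_trans _ _ y)//.
    by rewrite ltrBlDr ltrDl.
  by rewrite mulrC -ltr_pdivrMr//; near: k; exact: big.
near=> k.
rewrite ltr0_sg; first by rewrite subrr mul0r.
rewrite -oppr_gt0 -sinN -mulNr opprB; apply: sin_gt0_pi.
have h2 : 0 < k.+1%:R^-1 - y by rewrite subr_gt0 (le_lt_trans y0).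
rewrite divr_gt0//= ltr_pdivrMr// (@le_lt_trans _ _ (1 - y))//; first by rewrite lerD2r.
by rewrite mulrC -ltr_pdivrMr//; near: k; exact: big.
Unshelve. all: by end_near.
Qed.

Lemma cvg_prod_seq (R : realType) (I : Type) (r : seq I) (u : I -> nat -> R) (l : I -> R) :
  (forall i, u i @ \oo --> l i) -> (fun n => \prod_(i <- r) u i n) @ \oo --> \prod_(i <- r) l i.
Proof.
move=> h; elim: r => [|i r IH].
  by rewrite big_nil; apply: cvg_near_cst; apply: nearW => n; rewrite big_nil.
rewrite big_cons; under eq_fun do rewrite big_cons.
by apply: cvgM => //; exact: h.
Qed.

Lemma prod_seq_le1 (R : realType) (I : Type) (r : seq I) (u : I -> R) :
  (forall i, `|u i| <= 1) -> `|\prod_(i <- r) u i| <= 1.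
Proof.
move=> h; elim: r => [|i r IH]; first by rewrite big_nil normr1.
by rewrite big_cons normrM mulr_ile1.
Qed.

(** * The augmented Brownian filtration *)

Section filtration.
Context d (Om : measurableType d) (R : realType) (P : probability Om R) (m : nat).
Variables (t T : R) (W : R -> Om -> 'rV[R]_m).
Hypotheses (complete : measure_is_complete P) (tT : t <= T).
Hypothesis bmW : brownian_motion P t T W.
Local Notation Fgen s := (filtration_gen P t W s).
Local Notation Fs s := (g_sigma_algebraType (Fgen s)).
Local Notation FM := (F_measurable P t W).

Lemma coord_meas_Om s A : s <= T -> <<s coord_events W `[t, s] >> A -> measurable A.
Proof.
move=> sT; apply: (@g_sigma_sub Om _ measurable); first exact: sigma_algebra_measurable.
move=> _ [u [i [B [Du mB ->]]]].
have := bm_measurable bmW (s := u) i; rewrite in_itv => /(_ _ measurableT _ mB).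
rewrite setTI; apply; move: Du; rewrite /= !in_itv/= => /andP[-> us].
exact: le_trans us sT.
Qed.

Lemma Fs_sub s (A : set Om) : s <= T -> measurable (A : set (Fs s)) -> measurable A.
Proof.
move=> sT; apply: (@g_sigma_sub Om _ measurable); first exact: sigma_algebra_measurable.
move=> B [Bc|Bn]; last exact: complete.
by apply: (@coord_meas_Om s) => //; exact: sub_sigma_algebra.
Qed.

Lemma coord_events_mono r s : r <= s -> coord_events W `[t, r] `<=` coord_events W `[t, s].
Proof.
move=> rs A [u [i [B [Du mB ->]]]]; exists u, i, B; split => //.
by move: Du; rewrite /= !in_itv/= => /andP[-> /le_trans ->].
Qed.

Lemma Fs_mono r s (A : set Om) : r <= s -> measurable (A : set (Fs r)) -> measurable (A : set (Fs s)).
Proof.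
move=> rs; apply: (@g_sigma_sub Om); first exact: smallest_sigma_algebra.
move=> B [Bc|Bn]; apply: sub_sigma_algebra; last by right.
by left; exact: coord_events_mono Bc.
Qed.

Lemma Fs_negl s A : P.-negligible A -> measurable (A : set (Fs s)).
Proof. by move=> nA; apply: sub_sigma_algebra; right. Qed.

(** Independence is prescribed for the raw filtration only; this supplies a raw event almost surely
    equal to an augmented one. *)
Lemma Fs_ae s (A : set Om) : measurable (A : set (Fs s)) ->
  exists A', <<s coord_events W `[t, s] >> A' /\ {ae P, forall w, A w <-> A' w}.
Proof.
move: A; apply: (g_sigma_sub (ae_sigma_algebra P (coord_events W `[t, s]))).
move=> A [cA|nA].
  by exists A; split; [exact: sub_sigma_algebra|exact: aeW].
exists set0; split; first exact: sigma_algebra0.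
by apply: filterS (negligible_ae nA) => w nw; split.
Qed.

Lemma FM_meas s eta : s <= T -> FM s eta -> measurable_fun setT eta.
Proof.
move=> sT h _ B mB; rewrite setTI; apply: (@Fs_sub s) => //.
by rewrite -[X in measurable X]setTI; exact: h.
Qed.

Lemma FM_mono r s eta : r <= s -> FM r eta -> FM s eta.
Proof.
move=> rs h _ B mB; rewrite setTI; apply: (Fs_mono rs).
by rewrite -[X in measurable X]setTI; exact: h.
Qed.

(** Outside the null set the preimages coincide, and the part inside it is negligible, hence one of
    the generators. *)
Lemma FM_ae s eta eta' : FM s eta -> {ae P, forall w, eta w = eta' w} -> FM s eta'.
Proof.
move=> h [N [mN N0 hN]] _ B mB; rewrite setTI.
have nN : P.-negligible N by exists N; split.
have -> : eta' @^-1` B = (eta @^-1` B `\` N) `|` (eta' @^-1` B `&` N).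
  have k w : ~ N w -> eta w = eta' w.
    by move=> Nw; apply: contrapT => k; apply: Nw; exact: hN.
  apply/seteqP; split => w /=.
    move=> Bw; have [Nw|Nw] := pselect (N w); [by right|left].
    by split => //; rewrite /= k.
  by move=> [[Bw Nw]|[]//]; rewrite -k.
apply: measurableU.
  apply: measurableD; last exact: Fs_negl.
  by rewrite -[X in measurable X]setTI; exact: h.
apply: Fs_negl; apply: negligibleS nN; exact: subIsetr.
Qed.

(* [Wt] is W with the paths that are discontinuous or do not start at 0 replaced
   by 0; completeness keeps it adapted. *)
Definition bad_paths : set Om :=
  [set w | ~ (W t w = 0 /\ {within `[t, T], continuous (W ^~ w)})].

Lemma bad_paths_negl : P.-negligible bad_paths.
Proof.
have h1 := bm_start bmW; have h2 := bm_continuous bmW.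
have : {ae P, forall w, W t w = 0 /\ {within `[t, T], continuous (W ^~ w)}}.
  by apply: filterS2 h1 h2 => w.
by [].
Qed.

Definition Wt (s : R) (w : Om) : 'rV[R]_m := if `[< bad_paths w >] then 0 else W s w.

Lemma Wt_ae : {ae P, forall w s, Wt s w = W s w}.
Proof.
apply: filterS (negligible_ae bad_paths_negl) => w nw s.
by rewrite /Wt; case: asboolP.
Qed.

Lemma Wt_start w : Wt t w = 0.
Proof. by rewrite /Wt; case: asboolP => // /contrapT[]. Qed.

Lemma Wt_cont w i : {within `[t, T], continuous (fun s => Wt s w ord0 i)}.
Proof.
rewrite /Wt; case: asboolP => [_|/contrapT[_ c]]; first exact: cst_continuous.
move=> x; apply: (@continuous_comp _ _ _ (W ^~ w : subspace `[t, T] -> _) (fun M : 'rV[R]_m => M ord0 i)).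
  exact: c.
exact: coord_continuous.
Qed.

Lemma Wt_FM r s i : t <= r -> r <= s -> FM s (fun w => Wt r w ord0 i).
Proof.
move=> tr rs.
have h : FM s (fun w => W r w ord0 i).
  move=> _ B mB; rewrite setTI; apply: sub_sigma_algebra; left.
  by exists r, i, B; split => //=; rewrite in_itv/= tr.
by apply: (FM_ae h); apply: filterS Wt_ae => w ->.
Qed.

(** * Independence, law and moments of the increments *)

Definition incr r s w : 'rV[R]_m := Wt s w - Wt r w.

Lemma incr_meas r s : t <= r -> r <= s -> s <= T ->
  measurable_fun setT (incr r s : Om -> RV R m).
Proof.
move=> tr rs sT _ C mC; rewrite setTI; move: C mC.
apply: (@g_sigma_sub 'rV[R]_m (@cgen R m) (fun C => measurable (incr r s @^-1` C))).
  split.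
  - by rewrite preimage_set0.
  - by move=> C h; exact: (measurableD measurableT h).
  - by move=> F h; rewrite preimage_bigcup; exact: bigcup_measurable.
move=> _ [i [B [mB ->]]].
rewrite [X in measurable X](_ : _ = (fun w => Wt s w ord0 i - Wt r w ord0 i) @^-1` B); last first.
  by apply/seteqP; split => w /=; rewrite /incr !mxE.
rewrite -[X in measurable X]setTI.
suff : measurable_fun setT (fun w => Wt s w ord0 i - Wt r w ord0 i) by apply.
apply: measurable_funB; apply: (@FM_meas s) => //; apply: Wt_FM => //.
exact: le_trans rs.
Qed.

(** Both events are replaced by almost surely equal events of the raw sigma-algebras, to which
    [bm_independent] applies. *)
Lemma incr_indep r s (A : set Om) (C : set (RV R m)) : t <= r -> r <= s -> s <= T ->
  measurable (A : set (Fs r)) -> measurable C ->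
  P (A `&` incr r s @^-1` C) = (P A * P (incr r s @^-1` C))%E.
Proof.
move=> tr rs sT mA mC.
have [A' [sA' AA']] := Fs_ae mA.
pose B' := (fun w => W s w - W r w) @^-1` C.
have sB' : <<s coord_events (fun u w => W u w - W r w) [set s] >> B'.
  rewrite /B'; move: {B'} C mC; apply: (@g_sigma_sub 'rV[R]_m (@cgen R m) (fun C => <<s coord_events (fun u w => W u w - W r w) [set s] >> ((fun w => W s w - W r w) @^-1` C))).
    split.
    - by rewrite preimage_set0; exact: sigma_algebra0.
    - by move=> C h; exact: (sigma_algebraCD h).
    - by move=> F h; rewrite preimage_bigcup; exact: sigma_algebra_bigcup.
  move=> _ [i [B [mB ->]]]; apply: sub_sigma_algebra.
  by exists s, i, B; split.
have mB : measurable (incr r s @^-1` C).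
  by rewrite -[X in measurable X]setTI; exact: incr_meas.
have mB' : measurable B'.
  move: B' sB'; apply: (@g_sigma_sub Om); first exact: sigma_algebra_measurable.
  move=> _ [u [i [B [-> mB1 ->]]]].
  have mm : measurable_fun setT (fun w => W s w ord0 i - W r w ord0 i).
    by apply: measurable_funB; apply: (bm_measurable bmW); rewrite in_itv/= ?tr ?sT ?(le_trans tr)// (le_trans rs).
  have := mm measurableT _ mB1; rewrite setTI; congr (measurable _).
  by apply/seteqP; split => w /=; rewrite !mxE.
have BB' : {ae P, forall w, (incr r s @^-1` C) w <-> B' w}.
  by apply: filterS Wt_ae => w h; rewrite /B' /= /incr !h.
have rT := le_trans rs sT.
have mA1 := Fs_sub rT mA; have mA1' := coord_meas_Om rT sA'.
rewrite (ae_iff_measure (B := A') _ _ AA')// (ae_iff_measure (B := B') _ _ BB')//.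
rewrite -(bm_independent bmW tr rs sT sA' sB').
apply: ae_iff_measure.
- exact: measurableI.
- exact: measurableI.
- by apply: filterS2 AA' BB' => w h1 h2; split => -[a b]; split; by [apply/h1|apply/h2].
Qed.

Lemma FM_indep r s eta (phi : 'rV[R]_m -> R) : t <= r -> r <= s -> s <= T ->
  FM r eta -> measurable_fun [set: RV R m] phi ->
  P.-integrable setT (EFin \o eta) ->
  P.-integrable setT (EFin \o (fun w => phi (incr r s w))) ->
  P.-integrable setT (EFin \o (fun w => eta w * phi (incr r s w))) /\
  \int[P]_w (eta w * phi (incr r s w)) =
    (\int[P]_w eta w) * \int[P]_w phi (incr r s w).
Proof.
move=> tr rs sT feta mphi ieta iphi; apply: indep_mul => // A B mA mB.
apply: (@incr_indep r s _ (phi @^-1` B)) => //.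
  by rewrite -[X in measurable X]setTI; exact: feta.
by rewrite -[X in measurable X]setTI; exact: mphi.
Qed.

Lemma incr_law r s (B : 'I_m -> set R) : t <= r -> r < s -> s <= T ->
  (forall i, measurable (B i)) ->
  P (incr r s @^-1` [set x : 'rV[R]_m | forall i, B i (x ord0 i)]) =
    (\prod_(i < m) normal_prob 0 (Num.sqrt (s - r)) (B i))%E.
Proof.
move=> tr rs sT mB; rewrite -(bm_gaussian bmW tr rs sT mB).
have rT := le_trans (ltW rs) sT.
apply: ae_iff_measure.
- rewrite -[X in measurable X]setTI; apply: incr_meas => //; first exact: ltW.
  by rewrite RV_measurable_boxes; apply: sub_sigma_algebra; exists B.
- have -> : [set w | forall i, B i (W s w ord0 i - W r w ord0 i)] =
     \bigcap_(i in [set: 'I_m]) [set w | B i (W s w ord0 i - W r w ord0 i)].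
    by apply/seteqP; split => x /= h i; [move=> _|]; exact: h.
  apply: fin_bigcap_measurable; first exact: finite_finset.
  move=> i _.
  have mm : measurable_fun setT (fun w => W s w ord0 i - W r w ord0 i).
    by apply: measurable_funB; apply: (bm_measurable bmW); rewrite in_itv/= ?tr ?sT ?(le_trans tr (ltW rs))// (le_trans (ltW rs)).
  by have := mm measurableT _ (mB i); rewrite setTI.
- apply: filterS Wt_ae => w h /=; rewrite /incr !h; split => k i; have := k i; by rewrite !mxE.
Qed.


Lemma incr_coord_meas r s i : t <= r -> r <= s -> s <= T ->
  measurable_fun setT (fun w => incr r s w ord0 i).
Proof.
move=> tr rs sT.
exact: (@measurableT_comp _ _ _ _ _ _ _ _ (incr r s : Om -> RV R m) (coord_meas i) (incr_meas tr rs sT)).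
Qed.

Lemma incr_self r w : incr r r w = 0. Proof. by rewrite /incr subrr. Qed.

Lemma incr_coord_law r s i (f : R -> \bar R) : t <= r -> r < s -> s <= T ->
  (forall x, 0 <= f x)%E -> measurable_fun setT f ->
  (\int[P]_w f (incr r s w ord0 i) = \int[normal_prob 0 (Num.sqrt (s - r))]_x f x)%E.
Proof.
move=> tr rs sT f0 mf; have mi := incr_coord_meas i tr (ltW rs) sT.
have mi' : measurable_fun setT (fun w => incr r s w ord0 i : measurableTypeR R) by exact: mi.
pose X : {mfun Om >-> measurableTypeR R} := HB.pack (fun w => incr r s w ord0 i : measurableTypeR R)
  (isMeasurableFun.Build _ _ _ _ _ mi').
rewrite [RHS](eq_measure_integral (distribution P X)).
  by rewrite ge0_integral_distribution.
move=> B mB _; rewrite /= /distribution /pushforward.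
(* A box whose other sides are the whole line isolates coordinate i; the remaining factors of the
   product are 1. *)
have := incr_law (B := fun j => if j == i then B else setT) tr rs sT.
have -> : [set x : 'rV[R]_m | forall j, (if j == i then B else setT) (x ord0 j)] = [set x | B (x ord0 i)].
  apply/seteqP; split => x /=; first by move=> /(_ i); rewrite eqxx.
  by move=> Bx j; case: eqP => // ->.
rewrite /preimage/= => ->; last by move=> j; case: eqP.
rewrite (bigD1 i)//= eqxx big1 ?mule1// => j ji.
by rewrite (negbTE ji); exact: probability_setT.
Qed.

Lemma incr_sq r s i : t <= r -> r <= s -> s <= T ->
  (\int[P]_w ((incr r s w ord0 i) ^+ 2)%:E = (s - r)%:E)%E.
Proof.
(* The law is prescribed only for r < s; over an empty interval the increment is 0. *)
move=> tr; rewrite le_eqVlt => /predU1P[<- sT|rs sT].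
  under eq_integral do rewrite incr_self mxE expr0n.
  by rewrite integral0 subrr.
rewrite (@incr_coord_law r s i (fun x => (x ^+ 2)%:E))//.
- by rewrite normal_second ?sqrtr_gt0 ?subr_gt0// sqr_sqrtr// subr_ge0 ltW.
- by move=> x; rewrite lee_fin sqr_ge0.
- by apply/measurable_EFinP; exact: exprn_measurable.
Qed.

Lemma incr_pow4 r s i : t <= r -> r <= s -> s <= T ->
  (\int[P]_w ((incr r s w ord0 i) ^+ 4)%:E <= (48 * expR (2^-1) * (s - r) ^+ 2)%:E)%E.
Proof.
move=> tr; rewrite le_eqVlt => /predU1P[<- sT|rs sT].
  under eq_integral do rewrite incr_self mxE expr0n.
  by rewrite integral0 lee_fin mulr_ge0 ?sqr_ge0// mulr_ge0// expR_ge0.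
rewrite (@incr_coord_law r s i (fun x => (x ^+ 4)%:E))//.
- have -> : (s - r) ^+ 2 = Num.sqrt (s - r) ^+ 4.
    by rewrite (_ : 4 = 2 * 2)%N// exprM sqr_sqrtr// subr_ge0 ltW.
  by apply: normal_fourth; rewrite sqrtr_gt0 subr_gt0.
- by move=> x; rewrite lee_fin exprn_even_ge0.
- by apply/measurable_EFinP; exact: exprn_measurable.
Qed.

Lemma incr_L2 r s i : t <= r -> r <= s -> s <= T -> L2 P setT (fun w => incr r s w ord0 i).
Proof.
move=> tr rs sT; split; first exact: incr_coord_meas.
by rewrite /sqn incr_sq// ltry.
Qed.

Lemma L2_cst (c : R) : L2 P setT (cst c).
Proof.
split; first exact: measurable_cst.
rewrite /sqn (eq_integral (cst (c ^+ 2)%:E))// integral_cst//.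
by rewrite lte_mul_pinfty ?lee_fin ?sqr_ge0// (le_lt_trans (probability_le1 _ _)) ?ltry.
Qed.

Lemma Rintegral_prob_cst (c : R) : \int[P]_w cst c w = c.
Proof.
have e1 : P [set: Om] = 1%E := probability_setT P.
by rewrite Rintegral_cst// [X in fine X]e1 mulr1.
Qed.

Lemma prob_fin : (P [set: Om] < +oo)%E.
Proof. by rewrite (le_lt_trans (probability_le1 _ _)) ?ltry. Qed.

Lemma L2_int (f : Om -> R) : L2 P setT f -> P.-integrable setT (EFin \o f).
Proof.
move=> lf; have := L2_int_mul measurableT lf (L2_cst 1).
by apply: eq_integrable => // w _; rewrite /= mulr1.
Qed.

Lemma variance (f : Om -> R) (c := \int[P]_w f w) : L2 P setT f ->
  \int[P]_w (f w - c) ^+ 2 = \int[P]_w f w ^+ 2 - c ^+ 2.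
Proof.
move=> Lf; have i1 := L2_int Lf; have i2 := L2_int_sq Lf.
rewrite (@eq_Rintegral _ _ _ P setT (fun w => (f w ^+ 2 - (2 * c) * f w) + cst (c ^+ 2) w)); last first.
  by move=> w _ /=; ring.
have i3 : P.-integrable setT (EFin \o cst (c ^+ 2)) by apply: L2_int; exact: L2_cst.
have i4 : P.-integrable setT (EFin \o (fun w => (2 * c) * f w)) by exact: (integrableZl measurableT (2 * c) i1).
rewrite RintegralD//; last exact: (integrableB measurableT i2 i4).
by rewrite RintegralB// RintegralZl// Rintegral_prob_cst -/c; ring.
Qed.

Lemma variance_le (f : Om -> R) : L2 P setT f ->
  (sqn P setT (fun w => f w - \int[P]_x f x)%R <= sqn P setT f)%E.
Proof.
move=> Lf; rewrite !sqnE//; last by apply: L2B => //; exact: L2_cst.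
by rewrite lee_fin variance// gerBl sqr_ge0.
Qed.

Lemma Rintegral_sq_le (f : Om -> R) : L2 P setT f -> (((\int[P]_w f w) ^+ 2)%:E <= sqn P setT f)%E.
Proof.
move=> Lf; rewrite sqnE// lee_fin -subr_ge0 -variance//.
by apply: Rintegral_ge0 => w _; exact: sqr_ge0.
Qed.

(** Sign changes on an arbitrary set of coordinates: all of them for odd functions, a single one for
    off-diagonal covariances. *)
Definition flip (S : pred 'I_m) (x : 'rV[R]_m) : 'rV[R]_m :=
  \row_i (if S i then - x ord0 i else x ord0 i).

Lemma flipE S x i : flip S x ord0 i = if S i then - x ord0 i else x ord0 i.
Proof. by rewrite mxE. Qed.

Lemma flip_meas S : measurable_fun [set: RV R m] (flip S : RV R m -> RV R m).
Proof.
move=> _ C mC; rewrite setTI; move: C mC.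
apply: (@g_sigma_sub 'rV[R]_m (@cgen R m) (fun C => measurable (flip S @^-1` C : set (RV R m)))).
  split.
  - by rewrite preimage_set0.
  - by move=> C h; exact: (measurableD measurableT h).
  - by move=> F h; rewrite preimage_bigcup; exact: bigcup_measurable.
move=> _ [i [B [mB ->]]].
have h : measurable_fun [set: RV R m] (fun x : 'rV[R]_m => if S i then - x ord0 i else x ord0 i).
  by case: (S i); [apply: measurable_funN|]; exact: coord_meas.
have := h measurableT _ mB; rewrite setTI; congr measurable.
by apply/seteqP; split => x /=; rewrite mxE.
Qed.

(** Reflecting a centred normal law does not change it, so the two laws agree on boxes and hence on
    [RV]. *)
Lemma incr_flip r s S (C : set (RV R m)) : t <= r -> r <= s -> s <= T -> measurable C ->
  P ((flip S \o incr r s) @^-1` C) = P (incr r s @^-1` C).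
Proof.
move=> tr; rewrite le_eqVlt => /predU1P[<- sT mC|rs sT mC].
  congr (P _); apply/seteqP; split => w /=; rewrite incr_self;
  (have -> : flip S 0 = 0 by apply/rowP => i; rewrite !mxE oppr0 if_same); by [].
have mi := incr_meas tr (ltW rs) sT.
have mfi : measurable_fun setT (flip S \o incr r s : Om -> RV R m).
  exact: (@measurableT_comp _ _ _ _ _ _ _ _ (incr r s : Om -> RV R m) (flip_meas S) mi).
pose X : {mfun Om >-> RV R m} := HB.pack (incr r s : Om -> RV R m) (isMeasurableFun.Build _ _ _ _ _ mi).
pose Y : {mfun Om >-> RV R m} := HB.pack (flip S \o incr r s : Om -> RV R m) (isMeasurableFun.Build _ _ _ _ _ mfi).
apply: (@RV_measure_unique R m (distribution P Y) (distribution P X)) => //.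
  by rewrite (le_lt_trans (probability_le1 _ measurableT))// ltry.
move=> _ [B [mB ->]]; rewrite /= /distribution /pushforward [RHS]incr_law//.
have := incr_law (B := fun i => if S i then -%R @^-1` (B i) else B i) tr rs sT.
have mB' i : measurable (if S i then -%R @^-1` (B i) else B i).
  case: (S i) => //; rewrite -[X in measurable X]setTI; exact: oppr_measurable.
move=> /(_ mB').
have -> : Y @^-1` [set x : 'rV[R]_m | forall i, B i (x ord0 i)] =
  incr r s @^-1` [set x : 'rV[R]_m | forall i, (if S i then -%R @^-1` (B i) else B i) (x ord0 i)].
  apply/seteqP; split => w h i; have := h i; rewrite /= flipE; case: (S i) => k; exact: k.
move=> ->; apply: eq_bigr => i _; case: (S i) => //.
by rewrite normal_prob_sym// gt_eqF// sqrtr_gt0 subr_gt0.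
Qed.

(* The normal law is symmetric in each coordinate. *)
Lemma incr_odd0 r s S (phi : 'rV[R]_m -> R) : t <= r -> r <= s -> s <= T ->
  measurable_fun [set: RV R m] phi ->
  P.-integrable setT (EFin \o (fun w => phi (incr r s w))) ->
  (forall x, phi (flip S x) = - phi x) -> \int[P]_w phi (incr r s w) = 0.
Proof.
move=> tr rs sT mphi iphi odd.
have mi := incr_meas tr rs sT.
have mfi : measurable_fun setT (flip S \o incr r s : Om -> RV R m).
  exact: (@measurableT_comp _ _ _ _ _ _ _ _ (incr r s : Om -> RV R m) (flip_meas S) mi).
pose X : {mfun Om >-> RV R m} := HB.pack (incr r s : Om -> RV R m) (isMeasurableFun.Build _ _ _ _ _ mi).
pose Y : {mfun Om >-> RV R m} := HB.pack (flip S \o incr r s : Om -> RV R m) (isMeasurableFun.Build _ _ _ _ _ mfi).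
have me : measurable_fun [set: RV R m] (EFin \o phi) by exact/measurable_EFinP.
have EX : (\int[distribution P X]_x (phi x)%:E = \int[P]_w (phi (incr r s w))%:E)%E.
  by rewrite integral_distribution.
have EY : (\int[distribution P Y]_x (phi x)%:E = \int[P]_w (- phi (incr r s w))%:E)%E.
  rewrite integral_distribution//.
    by apply: eq_integral => w _ /=; rewrite odd.
  apply: (eq_integrable measurableT (-%E \o (EFin \o (fun w => phi (incr r s w))))) => //.
    by move=> w _ /=; rewrite odd.
  exact: integrableN.
have : \int[P]_w phi (incr r s w) = \int[P]_w (- phi (incr r s w)).
  rewrite /Rintegral -EX -EY; congr fine; apply: eq_measure_integral => C mC _.
  by apply/esym; exact: incr_flip.
have -> : \int[P]_w - phi (incr r s w) = - \int[P]_w phi (incr r s w).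
  rewrite -[RHS]mulN1r -RintegralZl//; apply: eq_Rintegral => w _; by rewrite mulN1r.
lra.
Qed.

Lemma incr_mean r s i : t <= r -> r <= s -> s <= T ->
  \int[P]_w incr r s w ord0 i = 0.
Proof.
move=> tr rs sT; apply: (@incr_odd0 r s predT (fun x => x ord0 i)) => //.
- exact: coord_meas.
- by apply: L2_int; exact: incr_L2.
- by move=> x; rewrite mxE.
Qed.

Lemma incr_cov r s i j : t <= r -> r <= s -> s <= T ->
  \int[P]_w (incr r s w ord0 i * incr r s w ord0 j) = (i == j)%:R * (s - r).
Proof.
move=> tr rs sT; have [->|ij] := eqVneq i j.
  by rewrite mul1r; apply: EFin_inj; rewrite -(incr_sq j tr rs sT) -/(sqn _ _ _) sqnE//; exact: incr_L2.
(* Flipping coordinate i alone changes the sign of a product of two distinct coordinates. *)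
rewrite mul0r; apply: (@incr_odd0 r s (pred1 i) (fun x => x ord0 i * x ord0 j)) => //.
- by apply: measurable_funM; exact: coord_meas.
- by apply: L2_int_mul => //; exact: incr_L2.
- by move=> x; rewrite !mxE/= eqxx eq_sym (negbTE ij) mulNr.
Qed.

(** Independence factors the mean and the increment is centred: this is the martingale property of
    the Brownian motion in the form used below. *)
Lemma FM_incr r s i (X : Om -> R) : t <= r -> r <= s -> s <= T -> FM r X ->
  P.-integrable setT (EFin \o X) ->
  P.-integrable setT (EFin \o (fun w => X w * incr r s w ord0 i)) /\
  \int[P]_w (X w * incr r s w ord0 i) = 0.
Proof.
move=> tr rs sT fX iX.
have [] := @FM_indep r s X (fun x => x ord0 i) tr rs sT fX (coord_meas i) iX.
  by apply: L2_int; exact: incr_L2.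
by move=> h1 ->; split => //; rewrite incr_mean// mulr0.
Qed.

Lemma FM_incr2 r s i j (X : Om -> R) : t <= r -> r <= s -> s <= T -> FM r X ->
  P.-integrable setT (EFin \o X) ->
  P.-integrable setT (EFin \o (fun w => X w * (incr r s w ord0 i * incr r s w ord0 j))) /\
  \int[P]_w (X w * (incr r s w ord0 i * incr r s w ord0 j)) =
    (\int[P]_w X w) * ((i == j)%:R * (s - r)).
Proof.
move=> tr rs sT fX iX.
have mp : measurable_fun [set: RV R m] (fun x : 'rV[R]_m => x ord0 i * x ord0 j).
  by apply: measurable_funM; exact: coord_meas.
have [] := @FM_indep r s X (fun x => x ord0 i * x ord0 j) tr rs sT fX mp iX.
  by apply: L2_int_mul => //; exact: incr_L2.
by move=> h1 ->; split => //; rewrite incr_cov.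
Qed.


Lemma FM_cst s c : FM s (fun=> c).
Proof. exact: measurable_cst. Qed.

Lemma FM_M s f g : FM s f -> FM s g -> FM s (fun w => f w * g w).
Proof. by move=> mf mg; exact: (measurable_funM mf mg). Qed.

Lemma FM_D s f g : FM s f -> FM s g -> FM s (fun w => f w + g w).
Proof. by move=> mf mg; exact: (measurable_funD mf mg). Qed.

Lemma FM_B s f g : FM s f -> FM s g -> FM s (fun w => f w - g w).
Proof. by move=> mf mg; exact: (measurable_funB mf mg). Qed.

Lemma FM_incr_coord r s u i : t <= r -> r <= s -> s <= u -> FM u (fun w => incr r s w ord0 i).
Proof.
move=> tr rs su; rewrite [X in FM u X](_ : _ = fun w => Wt s w ord0 i - Wt r w ord0 i).
  by apply: FM_B; apply: Wt_FM => //; [exact: le_trans rs|exact: le_trans su].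
by apply/funext => w; rewrite !mxE.
Qed.

Lemma incrD r s u w i : incr r u w ord0 i = incr r s w ord0 i + incr s u w ord0 i.
Proof. by rewrite !mxE; ring. Qed.

(** * Elementary integrands, their integrals and Ito's isometry *)

Definition atomZ (p q : R) (i : 'I_m) (a : Om -> R) (s : R) (w : Om) : 'rV[R]_m :=
  ((s \in `]p, q])%:R * a w) *: delta_mx ord0 i.

(** The minima stop the increment at time s. Since [incr] is built on [Wt], every path of the
    integral is continuous and starts at 0. *)
Definition atomX (p q : R) (i : 'I_m) (a : Om -> R) (s : R) (w : Om) : R :=
  a w * incr (Num.min s p) (Num.min s q) w ord0 i.

(* [elem Z X]: Z is an elementary integrand and X its integral process. *)
Inductive elem : (R -> Om -> 'rV[R]_m) -> (R -> Om -> R) -> Prop :=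
| elem0 : elem (fun _ _ => 0) (fun _ _ => 0)
| elemS Z X p q i a M : elem Z X -> t <= p -> p <= q -> q <= T ->
    FM p a -> (forall w, `|a w| <= M) ->
    elem (fun s w => Z s w + atomZ p q i a s w) (fun s w => X s w + atomX p q i a s w).

Lemma elem_add Z X Z' X' : elem Z X -> elem Z' X' ->
  elem (fun s w => Z s w + Z' s w) (fun s w => X s w + X' s w).
Proof.
move=> e; elim => [|Z1 X1 p q i a M e1 IH tp pq qT fa aM].
  rewrite (_ : (fun s w => _) = Z); last by apply/funext => s; apply/funext => w; rewrite addr0.
  by rewrite (_ : (fun s w => X s w + 0) = X)//; apply/funext => s; apply/funext => w; rewrite addr0.
have := elemS i IH tp pq qT fa aM; congr elem;
  by apply/funext => s; apply/funext => w; rewrite addrA.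
Qed.

Lemma elem_atom p q i a M : t <= p -> p <= q -> q <= T -> FM p a -> (forall w, `|a w| <= M) ->
  elem (atomZ p q i a) (atomX p q i a).
Proof.
move=> tp pq qT fa aM; have := elemS i elem0 tp pq qT fa aM; congr elem;
  by apply/funext => s; apply/funext => w; rewrite add0r.
Qed.

Lemma elem_scale c Z X : elem Z X -> elem (fun s w => c *: Z s w) (fun s w => c * X s w).
Proof.
elim => [|Z1 X1 p q i a M e1 IH tp pq qT fa aM].
  have := elem0; congr elem; apply/funext => s; apply/funext => w; by rewrite ?scaler0 ?mulr0.
have fa' : FM p (fun w => c * a w) by apply: FM_M => //; exact: FM_cst.
have aM' w : `|c * a w| <= `|c| * M by rewrite normrM ler_wpM2l.
have := elemS i IH tp pq qT fa' aM'; congr elem; apply/funext => s; apply/funext => w.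
  by rewrite scalerDr /atomZ scalerA mulrCA.
by rewrite mulrDr /atomX mulrA.
Qed.

Lemma elem_sub Z X Z' X' : elem Z X -> elem Z' X' ->
  elem (fun s w => Z s w - Z' s w) (fun s w => X s w - X' s w).
Proof.
move=> e /(elem_scale (-1)) /(elem_add e); congr elem; apply/funext => s; apply/funext => w.
  by rewrite scaleN1r.
by rewrite mulN1r.
Qed.

Lemma elem_sum (I : Type) (r : seq I) (Z : I -> R -> Om -> 'rV[R]_m) (X : I -> R -> Om -> R) :
  (forall i, elem (Z i) (X i)) ->
  elem (fun s w => \sum_(i <- r) Z i s w) (fun s w => \sum_(i <- r) X i s w).
Proof.
move=> e; elim: r => [|i r IH].
  have := elem0; congr elem; by apply/funext => s; apply/funext => w; rewrite big_nil.
have := elem_add (e i) IH; congr elem; by apply/funext => s; apply/funext => w; rewrite big_cons.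
Qed.

Lemma atomX_FM p q i a s : t <= p -> p <= q -> q <= T -> FM p a -> t <= s -> FM s (atomX p q i a s).
Proof.
move=> tp pq qT fa ts; have [ps|sp] := leP p s.
  apply: FM_M; first exact: FM_mono fa.
  by apply: FM_incr_coord; rewrite ?le_min ?ts ?tp ?ge_min ?lexx ?pq ?orbT.
rewrite (_ : atomX _ _ _ _ _ = fun=> 0); first exact: FM_cst.
apply/funext => w; rewrite /atomX min_l ?(ltW sp)// min_l ?(le_trans (ltW sp))//.
by rewrite incr_self mxE mulr0.
Qed.

Lemma elem_FM Z X s : elem Z X -> t <= s -> FM s (X s).
Proof.
move=> e ts; elim: e => [|Z1 X1 p q i a M e1 IH tp pq qT fa aM]; first exact: FM_cst.
by apply: FM_D => //; exact: atomX_FM.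
Qed.

Lemma Wt_clamp_cont i w : continuous (fun s => Wt (clamp t T s) w ord0 i).
Proof. exact: (within_clamp tT (@Wt_cont w i)). Qed.

Lemma elem_cont Z X w : elem Z X -> continuous (fun s => X (clamp t T s) w).
Proof.
elim => [|Z1 X1 p q i a M e1 IH tp pq qT fa aM]; first exact: cst_continuous.
move=> s; apply: cvgD; first exact: IH.
apply: cvgM; first exact: cvg_cst.
have h r : t <= r <= T -> continuous (fun s => Wt (Num.min (clamp t T s) r) w ord0 i).
  move=> /andP[tr rT] u.
  have E v : Num.min (clamp t T v) r = clamp t T (Num.min (clamp t T v) r).
    rewrite [RHS]clamp_id// le_min ge_min tr rT orbT !andbT.
    by case/andP: (clamp_in tT v).
  rewrite (_ : (fun s => _) = (fun s => Wt (clamp t T s) w ord0 i) \o (fun s => Num.min (clamp t T s) r)).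
    apply: continuous_comp; last exact: Wt_clamp_cont.
    by apply: continuous_min; [exact: clamp_cont|exact: cvg_cst].
  by apply/funext => v /=; rewrite -E.
rewrite (_ : (fun s => _) = (fun s => Wt (Num.min (clamp t T s) q) w ord0 i - Wt (Num.min (clamp t T s) p) w ord0 i)); last first.
  by apply/funext => v; rewrite !mxE.
rewrite !mxE; apply: cvgB; apply: h; first by rewrite qT (le_trans tp).
by rewrite tp (le_trans pq).
Qed.

Lemma atomX_L2 p q i a M s : t <= p -> p <= q -> q <= T -> FM p a -> (forall w, `|a w| <= M) ->
  t <= s -> L2 P setT (atomX p q i a s).
Proof.
move=> tp pq qT fa aM ts; apply: (L2_bdd_mul measurableT (M := M)) => //.
  by apply: (FM_meas _ fa); exact: le_trans qT.
by apply: incr_L2; rewrite ?le_min ?ts ?tp ?ge_min ?lexx ?pq ?qT ?orbT.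
Qed.

Lemma elem_L2 Z X s : elem Z X -> t <= s -> L2 P setT (X s).
Proof.
move=> e ts; elim: e => [|Z1 X1 p q i a M e1 IH tp pq qT fa aM]; first exact: L2_cst.
by apply: L2D => //; exact: atomX_L2 aM _.
Qed.

(** The increment of an atom between r and s is its coefficient times a Brownian increment over ]p,
    q] clipped to [r, s]; [eta] and the coefficient are both known at the left end, so the mean
    vanishes. *)
Lemma elem_mart Z X r s eta : elem Z X -> t <= r -> r <= s -> s <= T ->
  FM r eta -> L2 P setT eta -> \int[P]_w (eta w * (X s w - X r w)) = 0.
Proof.
move=> e tr rs sT feta leta; have ts := le_trans tr rs.
elim: e => [|Z1 X1 p q i a M e1 IH tp pq qT fa aM].
  under eq_Rintegral do rewrite subrr mulr0.
  by rewrite Rintegral_cst// mul0r.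
have ma : measurable_fun setT a by apply: (FM_meas _ fa); exact: le_trans qT.
have l1 : L2 P setT (fun w => X1 s w - X1 r w) by apply: L2B => //; apply: elem_L2 e1 _.
have l2 : L2 P setT (fun w => atomX p q i a s w - atomX p q i a r w).
  by apply: L2B => //; exact: atomX_L2 aM _.
rewrite (@eq_Rintegral _ _ _ P setT (fun w => eta w * (X1 s w - X1 r w) + eta w * (atomX p q i a s w - atomX p q i a r w))); last first.
  by move=> w _; ring.
rewrite RintegralD//; [|exact: L2_int_mul|exact: L2_int_mul].
rewrite IH add0r.
pose p' := Num.min s (Num.max r p); pose q' := Num.min s (Num.max r q).
have E w : atomX p q i a s w - atomX p q i a r w = a w * incr p' q' w ord0 i.
  rewrite /atomX -mulrBr; congr (_ * _); rewrite !mxE /p' /q'.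
  have [rp|pr] := leP r p; have [rq|qr] := leP r q.
  - by ring.
  - by have := lt_le_trans qr rp; rewrite ltNge pq.
  - rewrite (min_r rs) (min_r (le_trans (ltW pr) rs)); ring.
  - rewrite (min_r rs) (min_r (le_trans (ltW pr) rs)) (min_r (le_trans (ltW qr) rs)); ring.
rewrite (@eq_Rintegral _ _ _ P setT (fun w => (eta w * a w) * incr p' q' w ord0 i)); last first.
  by move=> w _; rewrite E mulrA.
have tp' : t <= p' by rewrite /p' le_min ts le_max tr.
have pq' : p' <= q'.
  by rewrite /p' /q' le_min !ge_min lexx/= ge_max !le_max lexx/= pq !orbT.
have qT' : q' <= T by rewrite /q' ge_min sT.
(* For p <= s the left end p' is after both r and p; otherwise p' = q' = s and the increment is
   0. *)
have [ps|sp] := leP p s.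
  have pp' : p <= p' by rewrite /p' le_min ps le_max lexx orbT.
  have rp' : r <= p' by rewrite /p' le_min rs le_max lexx.
  apply: (FM_incr i tp' pq' qT' _ _).2.
    by apply: FM_M; [exact: FM_mono feta|exact: FM_mono fa].
  apply: L2_int; rewrite (_ : (fun w => _) = fun w => a w * eta w); last first.
    by apply/funext => w; rewrite mulrC.
  exact: L2_bdd_mul aM _.
have -> : p' = s by rewrite /p' min_l// le_max (ltW sp) orbT.
have -> : q' = s by rewrite /q' min_l// le_max (le_trans (ltW sp) pq) orbT.
under eq_Rintegral do rewrite incr_self mxE mulr0.
by rewrite Rintegral_cst// mul0r.
Qed.

Lemma elem_start Z X w : elem Z X -> X t w = 0.
Proof.
elim => [//|Z1 X1 p q i a M e1 IH tp pq qT fa aM].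
by rewrite IH add0r /atomX !min_l ?(le_trans tp)// incr_self mxE mulr0.
Qed.

(** Orthogonality of X_s and X_T - X_s makes the second moment at s at most that at T. *)
Lemma elem_sq_le Z X s : elem Z X -> t <= s <= T -> (sqn P setT (X s) <= sqn P setT (X T))%E.
Proof.
move=> e /andP[ts sT]; have lT := elem_L2 e tT; have ls := elem_L2 e ts.
have lB := L2B measurableT lT ls.
rewrite !sqnE// lee_fin.
have -> : \int[P]_w (X T w ^+ 2) = \int[P]_w (X s w ^+ 2) + \int[P]_w ((X T w - X s w) ^+ 2).
  have z := elem_mart e ts sT (lexx T) (elem_FM e ts) ls.
  rewrite (@eq_Rintegral _ _ _ P setT (fun w => (X s w ^+ 2 + (X T w - X s w) ^+ 2) + 2 * (X s w * (X T w - X s w)))); last first.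
    by move=> w _; ring.
  rewrite RintegralD//; last 2 first.
  - by have := integrableD measurableT (L2_int_sq ls) (L2_int_sq lB); apply: eq_integrable.
  - by have := integrableZl measurableT 2 (L2_int_mul measurableT ls lB); apply: eq_integrable.
  rewrite RintegralZl//; last exact: L2_int_mul.
  rewrite z mulr0 addr0 RintegralD//; exact: L2_int_sq.
by rewrite lerDl Rintegral_ge0// => w _; exact: sqr_ge0.
Qed.

Lemma elem_mean0 Z X : elem Z X -> \int[P]_w (X T w) = 0.
Proof.
move=> eX; have o := elem_mart eX (lexx t) tT (lexx T) (@FM_cst t 1) (L2_cst 1).
by rewrite -[RHS]o; apply: eq_Rintegral => w _; rewrite (elem_start _ eX) subr0 mul1r.
Qed.


(** * Integrands on the time strip and Ito's isometry *)

Local Notation mu2 := (@lebesgue_measure R \x P)%E.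
Local Notation DT := (`[t, T]%classic `*` [set: Om] : set (measurableTypeR R * Om)).

Lemma mDT : measurable DT.
Proof. by apply: measurableX => //; exact: measurable_itv. Qed.

Lemma mu2DT : (mu2 DT < +oo)%E.
Proof.
have h := @product_measure1E _ _ (measurableTypeR R) Om R lebesgue_measure P `[t, T]%classic setT (measurable_itv _) measurableT.
apply: (@le_lt_trans _ _ (lebesgue_measure `[t, T]%classic * P setT)%E); first by rewrite -h.
rewrite lebesgue_measure_itv/= (@le_lt_trans _ _ ((T - t)%:E * P setT)%E)//.
  rewrite lee_wpmul2r//; case: ifPn => // _.
  by rewrite lee_fin subr_ge0.
by rewrite lte_mul_pinfty ?lee_fin ?subr_ge0// prob_fin.
Qed.

Lemma prod_Fs_sub s (A : set (R * Om)) : s <= T ->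
  measurable (A : set (measurableTypeR R * Fs s)) -> measurable (A : set (measurableTypeR R * Om)).
Proof.
move=> sT mA.
have mid : measurable_fun setT (id : Om -> Fs s).
  by move=> _ B mB; rewrite setTI; exact: Fs_sub mB.
have mp : measurable_fun setT (fun p : measurableTypeR R * Om => (p.1, p.2 : Fs s)).
  apply: measurable_fun_pair; first exact: measurable_fst.
  by apply: (measurableT_comp mid); exact: measurable_snd.
have := mp measurableT A mA; rewrite setTI; congr measurable.
by apply/seteqP; split => -[].
Qed.

Lemma prog_meas X : progressive P t T W X ->
  measurable_fun DT (fun p : measurableTypeR R * Om => X p.1 p.2).
Proof.
move=> pX _ B mB; apply: (@prod_Fs_sub T) => //.
have h : T \in `[t, T] by rewrite in_itv/= tT lexx.
have mD : measurable (`[t, T] `*` setT : set (R * Fs T)).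
  by apply: measurableX => //; exact: measurable_itv.
exact: (pX T h mD B mB).
Qed.

Lemma atomZE p q i a s w j : atomZ p q i a s w ord0 j = (i == j)%:R * (\1_(`]p, q]%classic) s * a w).
Proof.
rewrite !mxE eqxx/= eq_sym mulrC; congr (_ * (_ * _)).
by rewrite indicE mem_setE.
Qed.

Lemma atomZ_prog p q i a j : FM p a -> progressive P t T W (fun s w => atomZ p q i a s w ord0 j).
Proof.
move=> fa s; rewrite in_itv/= => /andP[ts sT].
have [sp|ps] := leP s p.
  apply: (@eq_measurable_fun _ _ (R * Fs s)%type R _ (fun=> 0)); last exact: measurable_cst.
  move=> [u w]; rewrite inE/= in_itv/= => -[/andP[_ us] _].
  rewrite atomZE indicE memNset ?mul0r ?mulr0// /= in_itv/= => /andP[pu _].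
  by have := lt_le_trans pu us; rewrite ltNge sp.
apply: measurable_funTS.
under eq_fun do rewrite atomZE.
apply: measurable_funM; first exact: measurable_cst.
have fa' := FM_mono (ltW ps) fa.
apply: measurable_funM.
  apply: (@measurableT_comp _ _ _ _ _ _ (\1_(`]p, q]%classic) : R -> R)).
    by apply: measurable_indic; exact: measurable_itv.
  exact: measurable_fst.
by apply: (@measurableT_comp _ _ _ _ _ _ (a : Fs s -> R)) => //; exact: measurable_snd.
Qed.

Lemma elem_prog Z X : elem Z X -> progressive_vec P t T W Z.
Proof.
elim => [|Z1 X1 p q i a M e1 IH tp pq qT fa aM] j s hs.
  exact: measurable_cst.
have -> : (fun x : R * Fs s => (Z1 x.1 x.2 + atomZ p q i a x.1 x.2) ord0 j) =
    (fun x : R * Fs s => Z1 x.1 x.2 ord0 j + atomZ p q i a x.1 x.2 ord0 j).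
  by apply/funext => x; rewrite mxE.
by apply: measurable_funD; [exact: IH|exact: atomZ_prog].
Qed.

Lemma atomZ_bdd p q i a M s w j : (forall w, `|a w| <= M) -> `|atomZ p q i a s w ord0 j| <= M.
Proof.
move=> aM; have M0 : 0 <= M := le_trans (normr_ge0 _) (aM w).
by rewrite atomZE indicE; case: (i == j); case: (s \in _); rewrite ?mul1r ?mul0r ?normr0 ?mulr0 ?normr0.
Qed.

Lemma elem_bdd Z X : elem Z X -> exists M, forall s w j, `|Z s w ord0 j| <= M.
Proof.
elim => [|Z1 X1 p q i a M e1 [N IH] tp pq qT fa aM].
  by exists 0 => s w j; rewrite mxE normr0.
exists (N + M) => s w j; rewrite mxE (le_trans (ler_normD _ _))// lerD//.
exact: atomZ_bdd.
Qed.

Definition cproc (Z : R -> Om -> 'rV[R]_m) (j : 'I_m) (p : measurableTypeR R * Om) : R := Z p.1 p.2 ord0 j.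

Lemma bdd_cproc_L2 Z j M : progressive_vec P t T W Z -> (forall s w j, `|Z s w ord0 j| <= M) ->
  L2 mu2 DT (cproc Z j).
Proof.
move=> pZ ZM; apply: (@L2_bdd _ _ _ mu2 DT mDT _ M mu2DT).
- exact: (prog_meas (pZ j)).
- by move=> p; exact: ZM.
Qed.

Lemma elem_ZL2 Z X j : elem Z X -> L2 mu2 DT (cproc Z j).
Proof. by move=> e; have [M] := elem_bdd e; apply: bdd_cproc_L2 (elem_prog e). Qed.

(** With p <= u, the interval ]p, q] is cut at min(u, q) and min(v, q): what lies before u or after
    v is orthogonal to the other atom, and only the overlap ]u, min(q, v)] contributes, through the
    covariance of the increments. *)
Lemma iso_atoms_le p q i a M u v k b N :
  t <= p -> p <= q -> q <= T -> FM p a -> (forall w, `|a w| <= M) ->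
  t <= u -> u <= v -> v <= T -> FM u b -> (forall w, `|b w| <= N) -> p <= u ->
  \int[P]_w (atomX p q i a T w * atomX u v k b T w) =
  (i == k)%:R * (Num.max 0 (Num.min q v - u) * \int[P]_w (a w * b w)).
Proof.
move=> tp pq qT fa aM tu uv vT fb bN pu.
have fau := FM_mono pu fa.
have ma : measurable_fun setT a by apply: (FM_meas _ fa); exact: le_trans qT.
have mb : measurable_fun setT b by apply: (FM_meas _ fb); exact: le_trans vT.
have mab : measurable_fun setT (fun w => a w * b w) by exact: measurable_funM.
have abM w : `|a w * b w| <= M * N by rewrite normrM ler_pM.
have M0 w : 0 <= M := le_trans (normr_ge0 _) (aM w).
have lab : L2 P setT (fun w => a w * b w).
  by apply: (L2_bdd measurableT) abM => //; exact: prob_fin.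
pose c1 := Num.min u q; pose c2 := Num.min v q.
have c12 : c1 <= c2 by rewrite /c1 /c2 le_min !ge_min uv lexx !orbT.
have pc1 : p <= c1 by rewrite /c1 le_min pu pq.
have c2q : c2 <= q by rewrite /c2 ge_min lexx orbT.
have tc1 := le_trans tp pc1; have tc2 := le_trans tc1 c12; have c2T := le_trans c2q qT.
have c1T := le_trans c12 c2T; have c1u : c1 <= u by rewrite /c1 ge_min lexx.
have mm s : Num.min T s = s \/ s > T by case: (leP T s) => [|]; [rewrite le_eqVlt => /predU1P[->|]; [left|right]|left].
have mT s : s <= T -> Num.min T s = s by move=> sT; rewrite min_r.
have I1 r s i' r' s' i'' : t <= r -> r <= s -> s <= T -> t <= r' -> r' <= s' -> s' <= T ->
   P.-integrable setT (EFin \o (fun w => (a w * b w * incr r s w ord0 i') * incr r' s' w ord0 i'')).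
  move=> h1 h2 h3 h4 h5 h6; apply: L2_int_mul => //; last exact: incr_L2.
  by apply: L2_bdd_mul abM _ => //; exact: incr_L2.
rewrite (@eq_Rintegral _ _ _ P setT (fun w =>
   (a w * b w * incr p c1 w ord0 i) * incr u v w ord0 k
   + ((a w * b w * incr c1 c2 w ord0 i) * incr u v w ord0 k
   + (a w * b w * incr c2 q w ord0 i) * incr u v w ord0 k))); last first.
  move=> w _; rewrite /atomX !mT ?(le_trans pq qT) ?(le_trans uv vT)//.
  by rewrite (incrD p c1 q) (incrD c1 c2 q); ring.
have J1 := I1 _ _ i u v k tp pc1 c1T tu uv vT.
have J2 := I1 _ _ i u v k tc1 c12 c2T tu uv vT.
have J3 := I1 _ _ i u v k tc2 c2q qT tu uv vT.
rewrite RintegralD//; last by have := integrableD measurableT J2 J3; apply: eq_integrable.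
rewrite RintegralD//.
have -> : \int[P]_w (a w * b w * incr p c1 w ord0 i * incr u v w ord0 k) = 0.
  apply: (FM_incr k tu uv vT _ _).2.
    by apply: FM_M; [exact: FM_M|exact: FM_incr_coord].
  by apply: L2_int; apply: L2_bdd_mul abM _ => //; exact: incr_L2.
have -> : \int[P]_w (a w * b w * incr c2 q w ord0 i * incr u v w ord0 k) = 0.
  have [vq|qv] := leP v q.
    have c2v : c2 = v by rewrite /c2 min_l.
    rewrite c2v (@eq_Rintegral _ _ _ P setT (fun w => a w * b w * incr u v w ord0 k * incr v q w ord0 i)); last first.
      by move=> w _; ring.
    apply: (FM_incr i (le_trans tu uv) vq qT _ _).2.
      apply: FM_M; last exact: FM_incr_coord.
      by apply: FM_mono uv _; exact: FM_M.
    by apply: L2_int; apply: L2_bdd_mul abM _ => //; exact: incr_L2.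
  have -> : c2 = q by rewrite /c2 min_r// ltW.
  under eq_Rintegral do rewrite incr_self mxE mulr0 mul0r.
  by rewrite Rintegral_cst// mul0r.
rewrite addr0 add0r.
have [qu|uq] := leP q u.
  have -> : c1 = q by rewrite /c1 min_r.
  have -> : c2 = q by rewrite /c2 min_r// (le_trans qu).
  under eq_Rintegral do rewrite incr_self mxE mulr0 mul0r.
  rewrite Rintegral_cst// mul0r max_l ?mul0r ?mulr0//.
  by rewrite subr_le0 ge_min qu.
have -> : c1 = u by rewrite /c1 min_l// ltW.
have uc2 : u <= c2 by rewrite /c2 le_min uv ltW.
have c2v : c2 <= v by rewrite /c2 ge_min lexx.
rewrite (@eq_Rintegral _ _ _ P setT (fun w => a w * b w * (incr u c2 w ord0 i * incr u c2 w ord0 k)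
   + a w * b w * incr u c2 w ord0 i * incr c2 v w ord0 k)); last first.
  by move=> w _; rewrite (incrD u c2 v); ring.
have iab : P.-integrable setT (EFin \o (fun w => a w * b w)) by exact: L2_int.
have fab : FM u (fun w => a w * b w) by exact: FM_M.
have [K1 K2] := FM_incr2 i k tu uc2 c2T fab iab.
rewrite RintegralD//; last exact: I1.
rewrite K2.
have -> : \int[P]_w (a w * b w * incr u c2 w ord0 i * incr c2 v w ord0 k) = 0.
  apply: (FM_incr k tc2 c2v vT _ _).2.
    by apply: FM_M; [exact: FM_mono fab|exact: FM_incr_coord].
  by apply: L2_int; apply: L2_bdd_mul abM _ => //; exact: incr_L2.
rewrite addr0 [Num.min q v]minC -/c2 max_r ?subr_ge0//; ring.
Qed.

(** The same value computed on the strip: since p <= u the indicators multiply to that of ]u, min(q,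
    v)], and the coordinate vectors pair to (i == k). *)
Lemma ip_atoms_le p q i a M u v k b N :
  t <= p -> p <= q -> q <= T -> FM p a -> (forall w, `|a w| <= M) ->
  t <= u -> u <= v -> v <= T -> FM u b -> (forall w, `|b w| <= N) -> p <= u ->
  \sum_j \int[mu2]_(x in DT) (cproc (atomZ p q i a) j x * cproc (atomZ u v k b) j x) =
  (i == k)%:R * (Num.max 0 (Num.min q v - u) * \int[P]_w (a w * b w)).
Proof.
move=> tp pq qT fa aM tu uv vT fb bN pu.
have ma : measurable_fun setT a by apply: (FM_meas _ fa); exact: le_trans qT.
have mb : measurable_fun setT b by apply: (FM_meas _ fb); exact: le_trans vT.
have mab : measurable_fun setT (fun w => a w * b w) by exact: measurable_funM.
have abM w : `|a w * b w| <= M * N by rewrite normrM ler_pM.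
have lab : L2 P setT (fun w => a w * b w).
  by apply: (L2_bdd measurableT) abM => //; exact: prob_fin.
have iab := L2_int lab.
pose A := `]u, Num.min q v]%classic : set (measurableTypeR R).
have mA : measurable A by exact: measurable_itv.
have iA : (@lebesgue_measure R).-integrable setT (EFin \o (\1_A : measurableTypeR R -> R)).
  exact: integrable_indic_itv.
have [I E] := integral_prod_mul iA iab.
have AE s : \1_(`]p, q]%classic) s * \1_(`]u, v]%classic) s = \1_A s :> R.
  rewrite !indicE -natrM mulnb -in_setI; congr ((s \in (_ : set _))%:R); apply/seteqP; split => x; rewrite /A /= !in_itv/= le_min.
    by move=> [/andP[_ ->] /andP[-> ->]].
  move=> /andP[ux /andP[-> ->]]; by rewrite ux (le_lt_trans pu).
have key j : \int[mu2]_(x in DT) (cproc (atomZ p q i a) j x * cproc (atomZ u v k b) j x) =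
   (i == j)%:R * (k == j)%:R * (\int[mu2]_x (\1_A x.1 * (a x.2 * b x.2))).
  rewrite Rintegral_mkcond -RintegralZl//; apply: eq_Rintegral => x _.
  rewrite patchE; case: ifPn => [_|].
    by rewrite /cproc !atomZE -AE; ring.
  rewrite notin_setE /= => h; rewrite [\1_A _]indicE memNset ?mul0r ?mulr0//.
  move=> Ax; apply: h; split => //; move: Ax; rewrite /A/= !in_itv/= => /andP[h1 h2].
  by rewrite (le_trans tu (ltW h1)) (le_trans h2)// ge_min qT.
under eq_bigr do rewrite key.
rewrite E -mulr_suml; congr (_ * _).
  rewrite (bigD1 i)//= eqxx mul1r big1 ?addr0 1?eq_sym// => j ji.
  by rewrite eq_sym (negbTE ji) mul0r.
congr (_ * _).
rewrite /Rintegral integral_indic// setIT.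
rewrite [X in fine X](_ : _ = lebesgue_measure `]u, Num.min q v]%classic)//.
rewrite lebesgue_measure_itv/= lte_fin.
by case: ltP => h; [rewrite max_r// subr_ge0 ltW|rewrite max_l// subr_le0].
Qed.

Lemma iso_atoms p q i a M u v k b N :
  t <= p -> p <= q -> q <= T -> FM p a -> (forall w, `|a w| <= M) ->
  t <= u -> u <= v -> v <= T -> FM u b -> (forall w, `|b w| <= N) ->
  \int[P]_w (atomX p q i a T w * atomX u v k b T w) =
  \sum_j \int[mu2]_(x in DT) (cproc (atomZ p q i a) j x * cproc (atomZ u v k b) j x).
Proof.
move=> tp pq qT fa aM tu uv vT fb bN; have [pu|up] := leP p u.
  by rewrite (iso_atoms_le i k tp pq qT fa aM tu uv vT fb bN pu) (ip_atoms_le i k tp pq qT fa aM tu uv vT fb bN pu).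
transitivity (\int[P]_w (atomX u v k b T w * atomX p q i a T w)).
  by apply: eq_Rintegral => w _; rewrite mulrC.
rewrite (iso_atoms_le k i tu uv vT fb bN tp pq qT fa aM (ltW up)) -(ip_atoms_le k i tu uv vT fb bN tp pq qT fa aM (ltW up)).
by apply: eq_bigr => j _; apply: eq_Rintegral => w _; rewrite mulrC.
Qed.

(** Both sides are bilinear, so one induction on each argument reduces the polarized isometry to
    pairs of atoms. *)
Lemma iso_bilin Z X Z' X' : elem Z X -> elem Z' X' ->
  \int[P]_w (X T w * X' T w) = \sum_j \int[mu2]_(x in DT) (cproc Z j x * cproc Z' j x).
Proof.
move=> e e'; elim: e => [|Z1 X1 p q i a M e1 IH tp pq qT fa aM].
  under eq_Rintegral do rewrite mul0r.
  rewrite Rintegral_cst// mul0r big1// => j _.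
  under eq_Rintegral do rewrite /cproc mxE mul0r.
  by rewrite Rintegral_cst ?mul0r//; exact: mDT.
have ea := elem_atom i tp pq qT fa aM.
rewrite (@eq_Rintegral _ _ _ P setT (fun w => X1 T w * X' T w + atomX p q i a T w * X' T w)); last first.
  by move=> w _; rewrite mulrDl.
rewrite RintegralD//; last 2 first.
- by apply: L2_int_mul => //; [exact: (elem_L2 e1)|exact: (elem_L2 e')].
- by apply: L2_int_mul => //; [exact: (elem_L2 ea)|exact: (elem_L2 e')].
rewrite IH; transitivity (\sum_j (\int[mu2]_(x in DT) (cproc Z1 j x * cproc Z' j x) +
    \int[mu2]_(x in DT) (cproc (atomZ p q i a) j x * cproc Z' j x))); last first.
  apply: eq_bigr => j _; rewrite -RintegralD; last 3 first.
  - exact: mDT.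
  - by apply: L2_int_mul; [exact: mDT|exact: elem_ZL2 e1|exact: elem_ZL2 e'].
  - by apply: L2_int_mul; [exact: mDT|exact: elem_ZL2 ea|exact: elem_ZL2 e'].
  by apply: eq_Rintegral => x _; rewrite /cproc !mxE mulrDl.
rewrite big_split/=; congr (_ + _).
elim: e' => [|Z2 X2 u v k b N e2 IH2 tu uv vT fb bN].
  under eq_Rintegral do rewrite mulr0.
  rewrite Rintegral_cst// mul0r big1// => j _.
  under eq_Rintegral do rewrite /cproc [X in _ * X]mxE mulr0.
  by rewrite Rintegral_cst ?mul0r//; exact: mDT.
have eb := elem_atom k tu uv vT fb bN.
rewrite (@eq_Rintegral _ _ _ P setT (fun w => atomX p q i a T w * X2 T w + atomX p q i a T w * atomX u v k b T w)); last first.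
  by move=> w _; rewrite mulrDr.
rewrite RintegralD//; last 2 first.
- by apply: L2_int_mul => //; [exact: (elem_L2 ea)|exact: (elem_L2 e2)].
- by apply: L2_int_mul => //; [exact: (elem_L2 ea)|exact: (elem_L2 eb)].
rewrite IH2 (iso_atoms i k tp pq qT fa aM tu uv vT fb bN) -big_split/=.
apply: eq_bigr => j _; rewrite -RintegralD; last 3 first.
- exact: mDT.
- by apply: L2_int_mul; [exact: mDT|exact: elem_ZL2 ea|exact: elem_ZL2 e2].
- by apply: L2_int_mul; [exact: mDT|exact: elem_ZL2 ea|exact: elem_ZL2 eb].
by apply: eq_Rintegral => x _; rewrite /cproc [X in _ = _ * X]mxE mulrDr.
Qed.

(* The squared H^2 norm, as an integral over [t, T] x Omega. *)
Definition nZ (Z : R -> Om -> 'rV[R]_m) : \bar R := (\sum_j sqn mu2 DT (cproc Z j))%E.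

Lemma isometry Z X : elem Z X -> sqn P setT (X T) = nZ Z.
Proof.
move=> e; rewrite sqnE//; last exact: elem_L2 e _.
rewrite (@eq_Rintegral _ _ _ P setT (fun w => X T w * X T w)); last by move=> w _; rewrite expr2.
rewrite (iso_bilin e e) /nZ -sumEFin; apply: eq_bigr => j _.
rewrite sqnE; [|exact: mDT|exact: elem_ZL2 e].
by congr (_%:E); apply: eq_Rintegral => x _; rewrite expr2.
Qed.


(** * Doob's maximal inequality and continuous adapted processes *)

Lemma FM_sg s f : FM s f -> FM s (fun w => Num.sg (f w)).
Proof.
move=> mf; have ms : measurable_fun setT (Num.sg : R -> R).
  apply: nondecreasing_measurable => // x y xy.
  by case: (sgrP x) => hx; case: (sgrP y) => hy //; move: xy; rewrite ?hx ?hy; lra.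
exact: (measurableT_comp ms mf).
Qed.

Lemma FM_norm s f : FM s f -> FM s (fun w => `|f w|).
Proof. by move=> mf; apply: (@measurableT_comp _ _ _ _ _ _ (Num.norm : R -> R)) => //; exact: normr_measurable. Qed.

Lemma FM_rmax s (N : nat -> Om -> R) n : (forall k, (k <= n)%N -> FM s (N k)) ->
  FM s (fun w => rmax (fun k => N k w) n).
Proof.
elim: n => [|n IH] h /=; first exact: h.
by apply: measurable_maxr; [apply: IH => k kn; exact: h (leqW kn)|exact: h].
Qed.

Lemma L2_norm (f : Om -> R) : L2 P setT f -> L2 P setT (fun w => `|f w|).
Proof.
move=> lf; apply: (@L2_le _ _ _ P setT measurableT _ f) => //.
- by apply: measurableT_comp => //; exact: L2_meas lf.
- by move=> w _; rewrite normr_id.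
Qed.

Lemma L2_rmax (N : nat -> Om -> R) n : (forall k, (k <= n)%N -> L2 P setT (N k)) ->
  L2 P setT (fun w => rmax (fun k => N k w) n).
Proof.
elim: n => [|n IH] h /=; first exact: h.
have l1 : L2 P setT (fun w => rmax (fun k => N k w) n) by apply: IH => k kn; exact: h (leqW kn).
have l2 := h n.+1 (leqnn _).
apply: (@L2_le _ _ _ P setT measurableT _ (fun w => `|rmax (fun k => N k w) n| + `|N n.+1 w|)).
- by apply: measurable_maxr; [exact: L2_meas l1|exact: L2_meas l2].
- move=> w _; rewrite [leRHS]ger0_norm ?addr_ge0//.
  by have [_|_] := leP (rmax (fun k => N k w) n) (N n.+1 w); rewrite ?lerDl ?lerDr.
- by apply: L2D => //; exact: L2_norm.
Qed.

(** [doob_pathwise] is integrated for the absolute values of a martingale on the grid: the sum that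
    it contains is bounded below by a discrete stochastic integral of mean 0. *)
Lemma doob_grid Z X n : elem Z X ->
  (sqn P setT (fun w => (rmax (fun k => `|X (gp t T n k) w|) (gnum t T n))%R) <= 4%:E * sqn P setT (X T))%E.
Proof.
move=> e; set K := gnum t T n.
pose N k w := X (gp t T n k) w.
pose S k w := rmax (fun k => `|N k w|) k.
have tg k : t <= gp t T n k by exact: gp_ge.
have gT k : gp t T n k <= T by exact: gp_le.
have lN k : L2 P setT (N k) by apply: elem_L2 e _.
have fN k : FM (gp t T n k) (N k) by apply: elem_FM e _.
have gm j k : (j <= k)%N -> gp t T n j <= gp t T n k.
  move=> jk; rewrite -(subnKC jk); elim: (k - j)%N => [|i IH]; first by rewrite addn0.
  by rewrite addnS (le_trans IH)// gp_mono.
have fS k : FM (gp t T n k) (S k).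
  apply: (FM_rmax (N := fun k w => `|N k w|)) => j jk; apply: FM_norm.
  exact: FM_mono (gm _ _ jk) (fN j).
have lS k : L2 P setT (S k) by apply: (L2_rmax (N := fun k w => `|N k w|)) => j _; exact: L2_norm.
(* Convexity of the absolute value gives |N_(k+1)| - |N_k| >= sg(N_k) (N_(k+1) - N_k); the resulting
   coefficient is known at the k-th grid time. *)
pose eta k w := Num.sg (N k w) * S k w.
have feta k : FM (gp t T n k) (eta k) by apply: FM_M => //; exact: FM_sg.
have leta k : L2 P setT (eta k).
  apply: (L2_bdd_mul measurableT (M := 1)) => //.
    exact: (FM_meas (gT k) (FM_sg (fN k))).
  by move=> w; rewrite normr_sg; case: (_ != 0).
have dN k : L2 P setT (fun w => N k.+1 w - N k w) by exact: L2B.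
have z k : \int[P]_w (eta k w * (N k.+1 w - N k w)) = 0.
  by apply: (elem_mart e (tg k)) => //; exact: gp_mono.
have pw w : S K w ^+ 2 <= 4 * N K w ^+ 2 - 4 * \sum_(k < K) eta k w * (N k.+1 w - N k w).
  have h := @doob_pathwise R (fun k => `|N k w|) K (fun k => normr_ge0 _).
  rewrite real_normK ?num_real// in h.
  suff : \sum_(k < K) eta k w * (N k.+1 w - N k w) <= \sum_(k < K) rmax (fun k => `|N k w|) k * (`|N k.+1 w| - `|N k w|).
    by rewrite /S; move: h; set a := rmax _ _; lra.
  apply: ler_sum => k _; rewrite /eta mulrC mulrA [leLHS]mulrC.
  apply: ler_wpM2l; first exact: rmax_ge0.
  rewrite mulrBl; apply: lerB; last by rewrite mulrC -normrEsg.
  rewrite (le_trans (ler_norm _))// normrM normr_sg ler_piMr//; by case: (_ != 0).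
have lK : L2 P setT (fun w => S K w) := lS K.
have -> : X T = N K by rewrite /N /K gp_last.
rewrite -/(S K) !sqnE// -EFinM lee_fin.
have iS : P.-integrable setT (EFin \o (fun w => \sum_(k < K) eta k w * (N k.+1 w - N k w))).
  have := @integrable_sum _ _ _ P setT measurableT _ (index_enum 'I_K) xpredT (fun k w => (eta k w * (N k.+1 w - N k w))%:E).
  move=> h; apply: (eq_integrable measurableT (fun w => \sum_(k < K) (eta k w * (N k.+1 w - N k w))%:E)%E).
    by move=> w _; rewrite /= sumEFin.
  by apply: h => k _; exact: L2_int_mul.
have i1 := integrableZl measurableT 4 (L2_int_sq (lN K)).
have i2 := integrableZl measurableT 4 iS.
have iD : P.-integrable setT (EFin \o (fun w => 4 * N K w ^+ 2 - 4 * \sum_(k < K) eta k w * (N k.+1 w - N k w))).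
  by have := integrableB measurableT i1 i2; apply: eq_integrable.
apply: (@le_trans _ _ (\int[P]_w (4 * N K w ^+ 2 - 4 * \sum_(k < K) eta k w * (N k.+1 w - N k w)))).
  by apply: le_Rintegral => //; exact: L2_int_sq.
rewrite RintegralB// RintegralZl//; last exact: L2_int_sq.
rewrite RintegralZl// (_ : \int[P]_w \sum_(k < K) _ = 0) ?mulr0 ?subr0//.
rewrite /Rintegral; under eq_integral do rewrite -sumEFin.
rewrite integral_sum//; last by move=> k; exact: L2_int_mul.
rewrite big1// => k _.
have -> : (\int[P]_x (eta k x * (N k.+1 x - N k x))%:E = 0)%E.
  have f := integrable_fin_num measurableT (L2_int_mul measurableT (leta k) (dN k)).
  by rewrite -(fineK f); congr (_%:E); exact: z.
by [].
Qed.

(** A continuous path attains its maximum at some c', and the grid maxima lie between the value at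
    the grid point before c' and this maximum. They converge to it, which gives a measurable
    supremum and, by Fatou, the bound. *)
Lemma sup_of_grid (X : R -> Om -> R) (C : \bar R) :
  (forall s, t <= s <= T -> FM s (X s)) ->
  (forall w, continuous (fun s => X (clamp t T s) w)) ->
  (forall n, (sqn P setT (fun w => (rmax (fun k => `|X (gp t T n k) w|) (gnum t T n))%R) <= C)%E) ->
  exists f : Om -> R, [/\ measurable_fun setT f, forall w, 0 <= f w,
      forall w s, t <= s <= T -> `|X s w| <= f w & (sqn P setT f <= C)%E].
Proof.
move=> fX cX SC.
pose S n w := rmax (fun k => `|X (gp t T n k) w|) (gnum t T n).
have S0 n w : 0 <= S n w by exact: rmax_ge0.
have mS n : measurable_fun setT (S n).
  apply: (@FM_meas T) => //; apply: (FM_rmax (N := fun k w => `|X (gp t T n k) w|)) => k _.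
  apply: FM_norm; apply: FM_mono (gp_le _ _ _ _) (fX _ _); by rewrite gp_ge// gp_le.
have hf w : exists y, S ^~ w @ \oo --> y /\ forall s, t <= s <= T -> `|X s w| <= y.
  have c : {within `[t, T], continuous (fun s => `|X (clamp t T s) w|)}.
    apply: continuous_subspaceT => s.
    by apply: (continuous_comp (f := fun s => X (clamp t T s) w)); [exact: cX|exact: norm_continuous].
  have [c' hc0 hc'] := EVT_max tT c.
  rewrite in_itv/= in hc0; case/andP: (hc0) => tc cT.
  exists `|X c' w|; split; last first.
    move=> s hs; have := hc' s; rewrite !clamp_id//; apply.
    by rewrite in_itv/= hs.
  have lb n : `|X (gp t T n (gidx t n c')) w| <= S n w.
    by apply: (@rmax_ge _ (fun k => `|X (gp t T n k) w|)); apply: ltnW; exact: gidx_le.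
  have ub n : S n w <= `|X c' w|.
    apply: rmax_le => k; have := hc' (gp t T n k); rewrite !clamp_id ?gp_ge ?gp_le//.
    by apply; rewrite in_itv/= gp_ge// gp_le.
  apply: (@squeeze_cvgr _ _ _ _ (fun n => `|X (gp t T n (gidx t n c')) w|) (cst `|X c' w|)).
  - by near=> n; rewrite lb ub.
  - by apply: cvg_norm; apply: (gp_cvg_fun (f := X ^~ w)) => //; exact: cX.
  - exact: cvg_cst.
have [f Hf] := choice hf; exists f.
have mf : measurable_fun setT f.
  by apply: (measurable_fun_cvg mS) => w _; case: (Hf w).
split => //.
- by move=> w; have [_ h] := Hf w; apply: le_trans (normr_ge0 _) (h t _); rewrite lexx.
- by move=> w s hs; have [_] := Hf w; exact.
- apply: (@sqn_fatou _ _ _ P setT measurableT S f) => //.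
  + by apply: aeW => w _; case: (Hf w).
  + by apply: nearW => n; exact: SC.
Unshelve. all: by end_near. Qed.

Lemma elem_sup Z X : elem Z X -> exists f : Om -> R,
  [/\ measurable_fun setT f, forall w, 0 <= f w,
      forall w s, t <= s <= T -> `|X s w| <= f w & (sqn P setT f <= 4%:E * sqn P setT (X T))%E].
Proof.
move=> e; apply: sup_of_grid.
- by move=> s /andP[ts _]; exact: elem_FM e ts.
- by move=> w; exact: elem_cont e.
- by move=> n; exact: (doob_grid n e).
Qed.

(** Left-endpoint step processes on a grid of [t, s] use only values at times up to s, so they are
    jointly measurable for F_s, and continuity makes them converge pointwise. *)
Lemma adapted_cont_prog (X : R -> Om -> R) : (forall s, t <= s <= T -> FM s (X s)) ->
  (forall w, continuous (fun s => X (clamp t T s) w)) -> progressive P t T W X.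
Proof.
move=> fX cX s; rewrite in_itv/= => /andP[ts sT].
pose x n (k : nat) : R := t + k%:R / n.+1%:R.
(* These half-open intervals belong to the unstopped grid, so the end point u = s is covered too. *)
pose J n (k : nat) : set R := `[x n k, x n k.+1[%classic.
pose F n (p : R * Fs s) : R := \sum_(k < gnum t s n) \1_(J n k) p.1 * X (gp t s n k) p.2.
have mF n : measurable_fun (`[t, s] `*` [set: Fs s]) (F n).
  apply: measurable_funTS; apply: measurable_sum => k.
  apply: measurable_funM.
    apply: (@measurableT_comp _ _ _ _ _ _ (\1_(J n k) : R -> R)).
      by apply: measurable_indic; exact: measurable_itv.
    exact: measurable_fst.
  apply: (@measurableT_comp _ _ _ _ _ _ (X (gp t s n k) : Fs s -> R)); last exact: measurable_snd.
  apply: FM_mono (gp_le _ _ _ _) (fX _ _).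
  by rewrite gp_ge//= (le_trans (gp_le _ _ _ _)).
apply: (measurable_fun_cvg mF) => -[u w] [] /=; rewrite in_itv/= => /andP[tu us] _.
have -> : F ^~ (u, w) = fun n => X (gp t T n (gidx t n u)) w.
  apply/funext => n; rewrite /F /=.
  have K := gidx_le n tu us.
  have /andP[h1 h2] := gidx_itv n tu.
  rewrite (bigD1 (Ordinal K))//= big1 ?addr0; last first.
    move=> k; rewrite -val_eqE/= => kn; rewrite indicE memNset ?mul0r// /J/= in_itv/= => /andP[k1 k2].
    have : (k < (gidx t n u).+1)%N.
      have := le_lt_trans k1 h2; rewrite /x ltrD2l ltr_pM2r ?invr_gt0//.
      by rewrite ltr_nat.
    rewrite ltnS leq_eqVlt (negbTE kn)/= => kl.
    suff : u < u by rewrite ltxx.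
    apply: (lt_le_trans k2); apply: le_trans h1.
    by rewrite /x lerD2l ler_wpM2r ?invr_ge0// ler_nat.
  rewrite indicE mem_set ?mul1r; last by rewrite /J/= in_itv/= h1 h2.
  by rewrite /gp min_r ?(le_trans h1)// min_r// (le_trans h1)// (le_trans us).
by apply: (gp_cvg_fun (f := X ^~ w)) => //; [exact: le_trans sT|exact: cX].
Qed.

Lemma progressive_FM X s : progressive P t T W X -> t <= s <= T -> FM s (X s).
Proof.
move=> pX hs; have hs' : s \in `[t, T] by rewrite in_itv.
case/andP: hs => ts sT _ B mB.
have mA : measurable ((`[t, s] `*` setT) `&` (fun p : measurableTypeR R * Fs s => X p.1 p.2) @^-1` B).
  by apply: (pX s hs') => //; apply: measurableX => //; exact: measurable_itv.
have := @pair1_measurable _ _ (measurableTypeR R) (Fs s) s measurableT _ mA; rewrite !setTI.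
congr (measurable _); apply/seteqP; split => w /=; first by move=> [[]].
by move=> Bw; split => //; split => //; rewrite /= in_itv/= lexx ts.
Qed.


(** * The Ito integral *)

Local Notation pv := (progressive_vec P t T W (k := m)).

Lemma pv_sub Z Z' : pv Z -> pv Z' -> pv (fun s w => Z s w - Z' s w).
Proof.
move=> pZ pZ' j s hs.
have -> : (fun x : R * Fs s => (Z x.1 x.2 - Z' x.1 x.2) ord0 j) =
    (fun x : R * Fs s => Z x.1 x.2 ord0 j - Z' x.1 x.2 ord0 j).
  by apply/funext => x; rewrite !mxE.
by apply: measurable_funB; [exact: pZ|exact: pZ'].
Qed.

Lemma cproc_meas Z j : pv Z -> measurable_fun DT (cproc Z j).
Proof. by move=> pZ; exact: prog_meas (pZ j). Qed.

Lemma nZ_ge0 Z : (0 <= nZ Z)%E.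
Proof. by apply: sume_ge0 => j _; exact: sqn_ge0. Qed.

Lemma nZ_youngD (e : R) A B : 0 < e -> pv A -> pv B ->
  (nZ (fun s w => A s w + B s w)%R <= (1 + e)%:E * nZ A + (1 + e^-1)%:E * nZ B)%E.
Proof.
move=> e0 pA pB; rewrite /nZ.
rewrite !ge0_sume_distrr; [|by move=> j _; exact: sqn_ge0|by move=> j _; exact: sqn_ge0].
rewrite -big_split/=; apply: lee_sum => j _.
rewrite (@sqn_eq _ _ _ mu2 DT _ (fun p => cproc A j p + cproc B j p)).
  exact: (sqn_young _ mDT e0 (cproc_meas j pA) (cproc_meas j pB)).
by move=> p _; rewrite /cproc !mxE.
Qed.

Lemma nZ_triB A B : pv A -> pv B -> (nZ (fun s w => A s w - B s w)%R <= 2%:E * nZ A + 2%:E * nZ B)%E.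
Proof.
move=> pA pB; have pN : pv (fun s w => - B s w).
  by have := pv_sub (elem_prog elem0) pB; congr progressive_vec; apply/funext => s; apply/funext => w; rewrite sub0r.
have := nZ_youngD ltr01 pA pN; rewrite invr1.
rewrite (_ : nZ (fun s w => - B s w) = nZ B); last first.
  by apply: eq_bigr => j _; rewrite -sqnN; apply: sqn_eq => p _; rewrite /cproc !mxE opprK.
exact.
Qed.

Lemma sqn_lt_half (e : R) (a b : \bar R) :
  (a <= (e / 4)%:E -> b <= (e / 4)%:E -> 2%:E * a + 2%:E * b <= e%:E)%E.
Proof.
move=> ha hb; apply: (@le_trans _ _ (2%:E * (e / 4)%:E + 2%:E * (e / 4)%:E)%E).
  by apply: leeD; apply: lee_wpmul2l.
by rewrite -!EFinM -EFinD lee_fin; lra.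
Qed.

Lemma nZ_tri A B C : pv A -> pv B -> pv C ->
  (nZ (fun s w => A s w - C s w)%R <=
   2%:E * nZ (fun s w => A s w - B s w)%R + 2%:E * nZ (fun s w => B s w - C s w)%R)%E.
Proof.
move=> pA pB pC; have := nZ_youngD ltr01 (pv_sub pA pB) (pv_sub pB pC); rewrite invr1.
by congr (nZ _ <= _)%E; apply/funext => s; apply/funext => w; rewrite addrA subrK.
Qed.

Lemma nZ_sym A B : nZ (fun s w => A s w - B s w) = nZ (fun s w => B s w - A s w).
Proof.
apply: eq_bigr => j _; rewrite -sqnN; apply: sqn_eq => p _.
by rewrite /cproc !mxE opprB.
Qed.

Lemma cvg_rmax (u : nat -> nat -> R) (v : nat -> R) n : (forall k, u ^~ k @ \oo --> v k) ->
  (fun i => rmax (u i) n) @ \oo --> rmax v n.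
Proof.
move=> h; elim: n => [|n IH] /=; first exact: h.
rewrite maxr_absE; under eq_fun do rewrite maxr_absE.
by apply: cvgMl; apply: cvgD; [exact: cvgD|apply: cvg_norm; exact: cvgB].
Qed.

Lemma uniform_cont (u : nat -> R -> R) (v : R -> R) (K : R) :
  (forall n, continuous (u n)) -> (forall n s, `|u n s - v s| <= K / 2 ^+ n) -> continuous v.
Proof.
move=> cu uv s; apply/cvgrPdist_lt => e e0.
have c0 : K / 2 ^+ n @[n --> \oo] --> (0 : R).
  have := @cvg_geometric R K (2^-1); rewrite ger0_norm// invf_lt1 ?ltr1n// => /(_ isT).
  by rewrite /geometric/=; under eq_fun do rewrite exprVn.
have e3 : 0 < e / 3 by rewrite divr_gt0.
have [n hn] : exists n, K / 2 ^+ n < e / 3.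
  move/cvgrPdist_lt : c0 => /(_ _ e3) [n _ /(_ n (leqnn n))].
  by rewrite /= sub0r normrN => h; exists n; exact: le_lt_trans (ler_norm _) h.
move/cvgrPdist_lt : (cu n s) => /(_ _ e3); apply: filterS => s' h.
have h1 := uv n s; have h2 := uv n s'.
have -> : v s - v s' = (u n s - u n s') - (u n s - v s) + (u n s' - v s') by ring.
rewrite (le_lt_trans (ler_normD _ _))// (le_lt_trans (lerD (ler_normB _ _) (lexx _)))//.
by move: h h1 h2; set a := `|_|; set b := `|_|; set c := `|_|; move: hn; set k := K / _; lra.
Qed.

(** Approximations at speed 8^-n have consecutive differences whose suprema in time decay
    geometrically outside a null set, by Doob and [ae_fast_decay]; the integral is their uniform
    limit. The constant 2 in the comparison is crude, but serves only to show that differences tend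
    to 0. *)
Lemma ito_exists Z : pv Z ->
  (forall e : R, 0 < e -> exists Z' X', elem Z' X' /\ (nZ (fun s w => Z' s w - Z s w)%R <= e%:E)%E) ->
  exists I : R -> Om -> R,
  [/\ progressive P t T W I, (forall w, continuous (fun s => I (clamp t T s) w)),
      (forall s, t <= s <= T -> FM s (I s)),
      (forall s Z' X', t <= s <= T -> elem Z' X' ->
         (sqn P setT (fun w => X' s w - I s w)%R <= 2%:E * nZ (fun s w => Z' s w - Z s w)%R)%E) &
      exists f, L2 P setT f /\ forall w s, t <= s <= T -> `|I s w| <= f w].
Proof.
move=> pZ app.
have /choice[ZX hZX] : forall n, exists p : (R -> Om -> 'rV[R]_m) * (R -> Om -> R),
    elem p.1 p.2 /\ (nZ (fun s w => p.1 s w - Z s w)%R <= (1 / 8 ^+ n)%:E)%E.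
  move=> n; have : 0 < 1 / 8 ^+ n :> R by rewrite divr_gt0// exprn_gt0.
  by move=> /app[Z' [X' [h1 h2]]]; exists (Z', X').
pose Zn n := (ZX n).1; pose Xn n := (ZX n).2.
have en n : elem (Zn n) (Xn n) by case: (hZX n).
have zn n : (nZ (fun s w => Zn n s w - Z s w)%R <= (1 / 8 ^+ n)%:E)%E by case: (hZX n).
have pZn n : pv (Zn n) by exact: elem_prog (en n).
have edn n := elem_sub (en n.+1) (en n).
have dn n : (nZ (fun s w => Zn n.+1 s w - Zn n s w)%R <= (4 / 8 ^+ n)%:E)%E.
  apply: (le_trans (nZ_tri (pZn n.+1) pZ (pZn n))); rewrite (nZ_sym Z (Zn n)).
  apply: (@le_trans _ _ (2%:E * (1 / 8 ^+ n.+1)%:E + 2%:E * (1 / 8 ^+ n)%:E)%E).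
    by apply: leeD; apply: lee_wpmul2l.
  rewrite -!EFinM -EFinD lee_fin exprS.
  have : 0 < (8 ^+ n)^-1 :> R by rewrite invr_gt0 exprn_gt0.
  by rewrite invfM !mul1r; set x := _^-1; lra.
have /choice[g hg] := fun n => elem_sup (edn n).
have gC n : (sqn P setT (g n) <= (16 / 8 ^+ n)%:E)%E.
  have [_ _ _ h] := hg n; apply: (le_trans h).
  rewrite (isometry (edn n)) (@le_trans _ _ (4%:E * (4 / 8 ^+ n)%:E)%E)//.
    by apply: lee_wpmul2l.
  by rewrite -EFinM lee_fin mulrA -natrM.
pose G w := exists K, forall n, `|g n w| <= K / 2 ^+ n.
have aeG : {ae P, forall w, G w}.
  have := ae_fast_decay measurableT (fun n => let: And4 h _ _ _ := hg n in h) gC.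
  by apply: filterS => w; exact.
(* Replacing the bad paths by 0 keeps adaptedness, thanks to the augmentation, and makes the limit
   continuous on every path. *)
pose X' n s w := if `[< G w >] then Xn n s w else 0.
have hK w : exists K, forall n s, t <= s <= T -> `|X' n.+1 s w - X' n s w| <= K / 2 ^+ n.
  rewrite /X'; case: asboolP => [[K hK]|_]; last first.
    by exists 0 => n s _; rewrite subrr normr0 mul0r.
  exists K => n s hs; apply: le_trans (hK n); rewrite (le_trans _ (ler_norm _))//.
  by have [_ _ h _] := hg n; exact: h.
pose I s w := limn (fun n => X' n s w).
have cI w s : t <= s <= T -> X' ^~ s ^~ w @ \oo --> I s w.
  by move=> hs; have [K h] := hK w; have [] := @fast_decay_cvg R (fun n => X' n s w) K (fun n => h n s hs).
have X'ae n s : {ae P, forall w, Xn n s w = X' n s w}.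
  by apply: filterS aeG => w Gw; rewrite /X'; case: asboolP.
have fX' n s : t <= s <= T -> FM s (X' n s).
  by move=> /andP[ts _]; apply: (FM_ae (elem_FM (en n) ts)).
have fI s : t <= s <= T -> FM s (I s).
  move=> hs; apply: (@measurable_fun_cvg _ (Fs s) R setT (fun n => X' n s)).
    by move=> n; exact: fX'.
  by move=> w _; exact: cI.
have ccX' n w : continuous (fun s => X' n (clamp t T s) w).
  rewrite /X'; case: asboolP => _; last exact: cst_continuous.
  by move=> s; exact: (@elem_cont (Zn n) (Xn n) w (en n) s).
have ccI w : continuous (fun s => I (clamp t T s) w).
  have [K h] := hK w.
  apply: (@uniform_cont (fun n s => X' n (clamp t T s) w) _ (2 * K)); first by move=> n; exact: ccX'.
  move=> n s; have hs := clamp_in tT s.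
  by have [_] := @fast_decay_cvg R (fun n => X' n (clamp t T s) w) K (fun n => h n _ hs); apply.
have mX n s : t <= s <= T -> measurable_fun setT (Xn n s).
  by move=> /andP[ts sT]; exact: FM_meas sT (elem_FM (en n) ts).
have mI s : t <= s <= T -> measurable_fun setT (I s).
  by move=> hs; case/andP: (hs) => ts sT; exact: FM_meas sT (fI s hs).
have aeI : {ae P, forall w, forall s, t <= s <= T -> Xn ^~ s ^~ w @ \oo --> I s w}.
  apply: filterS aeG => w Gw s hs; have := cI w s hs.
  by rewrite /X'; case: asboolP.
exists I; split => //.
- exact: adapted_cont_prog.
- move=> s Z1 X1 hs e1; case/andP: (hs) => ts sT.
  (* The given elementary integral is compared with the n-th approximation by the isometry, and
     Fatou passes to the limit in n. *)
  apply/lee_addgt0Pr => e e0.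
  apply: (@sqn_fatou _ _ _ P setT measurableT (fun n w => X1 s w - Xn n s w)).
  + move=> n; apply: measurable_funB; last exact: mX.
    exact: FM_meas sT (elem_FM e1 ts).
  + by apply: measurable_funB; [exact: FM_meas sT (elem_FM e1 ts)|exact: mI].
  + apply: filterS aeI => w h _; apply: cvgB; first exact: cvg_cst.
    exact: h.
  + have c0 : 2 / 8 ^+ n @[n --> \oo] --> (0 : R).
      have := @cvg_geometric R 2 (8^-1); rewrite ger0_norm// invf_lt1 ?ltr1n// => /(_ isT).
      by rewrite /geometric/=; under eq_fun do rewrite exprVn.
    move/cvgrPdist_lt : c0 => /(_ _ e0); apply: filterS => n; rewrite sub0r normrN => hn.
    have es := elem_sub e1 (en n).
    apply: (le_trans (elem_sq_le es hs)); rewrite (isometry es).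
    apply: (le_trans (nZ_tri (elem_prog e1) pZ (pZn n))); apply: leeD => //.
    rewrite nZ_sym (@le_trans _ _ (2%:E * (1 / 8 ^+ n)%:E)%E) ?lee_wpmul2l//.
    by rewrite -EFinM lee_fin mulrA mulr1 (le_trans (ler_norm _))// ltW.
- have fin0 : nZ (Zn 0%N) \is a fin_num.
    by rewrite -(isometry (en 0%N)) sqnE//; exact: elem_L2 (en 0%N) tT.
  (* Doob's estimate bounded uniformly in n: the n-th integrand is compared with Z, then Z with the
     integrand of rank 0, which has finite norm. *)
  pose C := (4%:E * (2%:E * (2%:E * 1%:E + 2%:E * 1%:E) + 2%:E * nZ (Zn 0%N)))%E.
  have XC n : (4%:E * sqn P setT (Xn n T) <= C)%E.
    rewrite /C lee_wpmul2l// (isometry (en n)).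
    have e00 : pv (fun _ _ => 0 : 'rV[R]_m) by exact: elem_prog elem0.
    have E Z1 : nZ Z1 = nZ (fun s w => Z1 s w - 0) by apply: eq_bigr => j _; apply: sqn_eq => p _; rewrite /cproc subr0.
    rewrite (E (Zn n)) (E (Zn 0%N)); apply: (le_trans (nZ_tri (pZn n) (pZn 0%N) e00)).
    rewrite leeD// lee_wpmul2l//; apply: (le_trans (nZ_tri (pZn n) pZ (pZn 0%N))).
    rewrite (nZ_sym Z); apply: leeD; rewrite lee_wpmul2l// (le_trans (zn _))// lee_fin.
      by rewrite ler_pdivrMr ?exprn_gt0// mul1r exprn_ege1// ler1n.
    by rewrite expr0 divr1.
  have Coo : (C < +oo)%E.
    rewrite /C -(fineK fin0); exact: ltry.
  have [f [mf f0 hf fC]] : exists f : Om -> R, [/\ measurable_fun setT f, forall w, 0 <= f w,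
      forall w s, t <= s <= T -> `|I s w| <= f w & (sqn P setT f <= C)%E].
    apply: sup_of_grid => // n.
    have gin k : t <= gp t T n k <= T by rewrite gp_ge// gp_le.
    apply: (@sqn_fatou _ _ _ P setT measurableT (fun i w => rmax (fun k => `|Xn i (gp t T n k) w|) (gnum t T n))).
    + move=> i; apply: (@FM_meas T) => //.
      apply: (FM_rmax (N := fun k w => `|Xn i (gp t T n k) w|)) => k _; apply: FM_norm.
      by case/andP: (gin k) => h1 h2; exact: FM_mono h2 (elem_FM (en i) h1).
    + apply: (@FM_meas T) => //.
      apply: (FM_rmax (N := fun k w => `|I (gp t T n k) w|)) => k _; apply: FM_norm.
      by case/andP: (gin k) => h1 h2; exact: FM_mono h2 (fI _ (gin k)).
    + apply: filterS aeI => w h _.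
      by apply: (@cvg_rmax (fun i k => `|Xn i (gp t T n k) w|)) => k; apply: cvg_norm; exact: h.
    + by apply: nearW => i; apply: le_trans (XC i); exact: (doob_grid n (en i)).
  by exists f; split => //; split => //; exact: le_lt_trans fC Coo.
Qed.


(** * Density of simple processes *)

Local Notation Ib r s := (`[r, s]%classic : set (measurableTypeR R)).

(** Coordinates split a simple process into atoms; the integrals agree only almost surely, because
    one uses [W] and the other [Wt]. *)
Lemma sp_elem (h : simple_process P t T W) : exists X, elem (sp_process h) X /\
  {ae P, forall w, forall s, X s w = sp_integral h s w}.
Proof.
case: h => N tau v tin tmono vmeas [M vM].
pose A j i : R -> Om -> R := atomX (tau j) (tau j.+1) i (fun w => v j w ord0 i).
exists (fun s w => \sum_(j < N) \sum_i A j i s w); split.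
  rewrite (_ : sp_process _ = fun s w => \sum_(j < N) \sum_i atomZ (tau j) (tau j.+1) i (fun w => v j w ord0 i) s w).
    apply: elem_sum => j; apply: elem_sum => i.
    have jN := ltn_ord j.
    have := tin j (ltnW jN); have := tin j.+1 jN; rewrite !in_itv/= => /andP[_ h1] /andP[h2 _].
    apply: (@elem_atom _ _ _ _ M) => //; [exact: tmono|exact: vmeas|].
    by move=> w; exact: vM.
  apply/funext => s; apply/funext => w; apply: eq_bigr => j _.
  rewrite [RHS](_ : _ = \sum_i ((s \in `]tau j, tau j.+1])%:R * v j w ord0 i) *: delta_mx ord0 i)//=.
  case: ifPn => _; last by rewrite big1// => i _; rewrite mul0r scale0r.
  by rewrite [LHS]row_sum_delta; apply: eq_bigr => i _; rewrite mul1r.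
apply: filterS Wt_ae => w hw s; apply: eq_bigr => j _; apply: eq_bigr => i _.
by rewrite /A /atomX /incr !hw.
Qed.

Lemma prog_sub_meas f r s : progressive P t T W f -> t <= r -> s <= T -> t <= s ->
  measurable_fun (`[r, s] `*` setT) (fun p : measurableTypeR R * Fs s => f p.1 p.2).
Proof.
move=> pf tr sT ts.
have hs : s \in `[t, T] by rewrite in_itv/= ts sT.
apply: (@measurable_funS _ _ _ _ (`[t, s] `*` setT)); last exact: (pf s hs).
  by apply: measurableX => //; exact: measurable_itv.
move=> p [/= h _]; split => //; move: h; rewrite /= !in_itv/= => /andP[rp ->].
by rewrite (le_trans tr rp).
Qed.

Lemma prog_Rint f r s : progressive P t T W f -> t <= r -> s <= T -> t <= s ->
  FM s (fun w => Rintegral (@lebesgue_measure R) `[r, s] (f ^~ w)).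
Proof.
move=> pf tr sT ts.
have := @strip_Rint_meas _ (Fs s) R `[r, s]%classic (measurable_itv _) _ (prog_sub_meas pf tr sT ts).
exact.
Qed.

Lemma prog_section f w : progressive P t T W f -> measurable_fun (Ib t T) (f ^~ w).
Proof. by move=> /prog_meas; apply: strip_section; exact: measurable_itv. Qed.

Definition stepval (Z : R -> Om -> 'rV[R]_m) n k w : 'rV[R]_m :=
  \row_j step_avg t T (fun s => Z s w ord0 j) n k.

Lemma stepval_FM Z n k j : pv Z -> (k < gnum t T n)%N -> FM (gp t T n k) (fun w => stepval Z n k w ord0 j).
Proof.
move=> pZ _; rewrite /stepval; under eq_fun do rewrite mxE.
case: k => [|k] /=; first exact: FM_cst.
apply: FM_M; first exact: FM_cst.
by apply: prog_Rint; rewrite ?gp_ge ?gp_le//; exact: pZ.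
Qed.

(** The factor n + 1 times the length of a grid interval is at most 1, also where the grid is cut
    off at T. *)
Lemma stepval_bdd Z M n k w j : pv Z -> (forall s w j, `|Z s w ord0 j| <= M) -> `|stepval Z n k w ord0 j| <= M.
Proof.
move=> pZ ZM; rewrite mxE; have M0 : 0 <= M := le_trans (normr_ge0 _) (ZM 0 w j).
case: k => [|k] /=; first by rewrite normr0.
rewrite normrM gtr0_norm//.
have mg : measurable_fun (Ib (gp t T n k) (gp t T n k.+1)) (fun s => Z s w ord0 j).
  apply: measurable_funS (prog_section w (pZ j)); first exact: measurable_itv.
  move=> s; rewrite /= !in_itv/= => /andP[h1 h2].
  by rewrite (le_trans (gp_ge _ _ tT) h1) (le_trans h2 (gp_le _ _ _ _)).
have := bdd_Rint_le (gp_mono t T n k) mg (fun s => ZM s w j).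
move=> h; rewrite mulrC -ler_pdivlMr//; apply: (le_trans h); rewrite ler_wpM2l//; exact: gp_step.
Qed.

Lemma step_sp Z M n : pv Z -> (forall s w j, `|Z s w ord0 j| <= M) ->
  exists h : simple_process P t T W, forall s w j, sp_process h s w ord0 j =
   \sum_(k < gnum t T n) (if s \in `]gp t T n k, gp t T n k.+1] then step_avg t T (fun s => Z s w ord0 j) n k else 0).
Proof.
move=> pZ ZM.
have h1 k : (k <= gnum t T n)%N -> gp t T n k \in `[t, T] by rewrite in_itv/= gp_ge// gp_le.
have h4 : exists M : R, forall k w (i : 'I_m), (k < gnum t T n)%N -> `|stepval Z n k w ord0 i| <= M.
  by exists M => k w i _; exact: stepval_bdd.
exists (@SimpleProcess _ _ _ _ _ _ _ _ _ (gp t T n) (stepval Z n) h1 (fun k _ => gp_mono t T n k) (fun k j h => stepval_FM j pZ h) h4).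
move=> s w j; rewrite /sp_process/= summxE; apply: eq_bigr => k _.
by case: ifPn => _; rewrite mxE.
Qed.

Lemma mu2_fubini (F : measurableTypeR R * Om -> R) : measurable_fun DT F ->
  sqn mu2 DT F = (\int[P]_w sqn (@lebesgue_measure R) (Ib t T) (fun s => F (s, w)))%E /\
  measurable_fun setT (fun w => sqn (@lebesgue_measure R) (Ib t T) (fun s => F (s, w))).
Proof.
move=> mF.
have mI := mIb t T.
split.
  apply: (@strip_fubini _ Om R _ mI P (fun p => (F p ^+ 2)%:E)); first exact: msq.
  by move=> p _; rewrite lee_fin sqr_ge0.
apply: (@strip_meas _ Om R _ mI (fun p => (F p ^+ 2)%:E)); first exact: msq.
by move=> p _; rewrite lee_fin sqr_ge0.
Qed.

(** For a fixed path the step processes converge in L2(dt) by [step_cvg] and bounded convergence; a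
    second bounded convergence integrates over Omega. Quantifying over [h] after [n] lets a single
    simple process serve all coordinates. *)
Lemma step_dense Z M j (e : R) : pv Z -> (forall s w j, `|Z s w ord0 j| <= M) -> 0 < e ->
  \forall n \near \oo, forall h : simple_process P t T W, (forall s w j, sp_process h s w ord0 j =
   \sum_(k < gnum t T n) (if s \in `]gp t T n k, gp t T n k.+1] then step_avg t T (fun s => Z s w ord0 j) n k else 0)) ->
  (sqn mu2 DT (cproc (fun s w => sp_process h s w - Z s w)%R j) <= e%:E)%E.
Proof.
move=> pZ ZM e0.
have /choice[h hh] := fun n => @step_sp Z M n pZ ZM.
pose F n := cproc (fun s w => sp_process (h n) s w - Z s w) j.
have mF n : measurable_fun DT (F n).
  by apply: cproc_meas; apply: pv_sub => //; have [X [eX _]] := sp_elem (h n); exact: elem_prog eX.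
have mI := mIb t T.
pose S n w s := sp_process (h n) s w ord0 j.
have mZ w : measurable_fun (Ib t T) (fun s => Z s w ord0 j) by exact: prog_section (pZ j).
have mS n w : measurable_fun (Ib t T) (S n w).
  by have [X [eX _]] := sp_elem (h n); have h1 := elem_prog eX; exact: (prog_section w (h1 j)).
have M0 w : 0 <= M := le_trans (normr_ge0 _) (ZM 0 w j).
have SM n w s : `|S n w s| <= M.
  rewrite /S hh; apply: (@disj_sum_le R (gp t T n) (step_avg t T (fun s => Z s w ord0 j) n)) => [||k]; [|exact: (M0 w)|].
    exact: gp_mono.
  by have := @stepval_bdd Z M n k w j pZ ZM; rewrite mxE.
have c0 : (fun n => sqn mu2 DT (F n)) @ \oo --> 0%E.
  rewrite (_ : (fun n => _) = fun n => (\int[P]_w sqn (@lebesgue_measure R) (Ib t T) (fun s => (S n w s - Z s w ord0 j)%R))%E); last first.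
    apply/funext => n; rewrite (mu2_fubini (mF n)).1; apply: eq_integral => w _.
    by apply: sqn_eq => s _; rewrite /F /cproc/= !mxE.
  have L2c c : L2 (@lebesgue_measure R) (Ib t T) (cst c) by apply: (@L2_Ib_bdd _ _ _ _ `|c|).
  have bnd n w : (sqn (@lebesgue_measure R) (Ib t T) (fun s => (S n w s - Z s w ord0 j)%R) <= sqn (@lebesgue_measure R) (Ib t T) (cst (M + M)%R))%E.
    apply: sqn_le => //; first exact: measurable_funB.
    move=> s _; rewrite (le_trans (ler_normB _ _))// (le_trans _ (ler_norm _))//.
    by rewrite lerD.
  have fin : (sqn (@lebesgue_measure R) (Ib t T) (cst (M + M)%R) \is a fin_num)%E.
    by rewrite sqnE.
  have := @dominated_cvg _ _ _ P setT measurableT (fun n w => sqn (@lebesgue_measure R) (Ib t T) (fun s => (S n w s - Z s w ord0 j)%R)) (cst 0%E) (cst (sqn (@lebesgue_measure R) (Ib t T) (cst (M + M)%R))%E).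
  rewrite integral0; apply => //.
  - move=> n; have := (mu2_fubini (mF n)).2; congr measurable_fun; apply/funext => w.
    by apply: sqn_eq => s _; rewrite /F /cproc/= !mxE.
  - move=> w _; apply: (@sqn_dct _ _ _ _ _ mI (fun n => S n w) (fun s => Z s w ord0 j) (cst M)) => //.
    have := @step_cvg R t T tT (fun s => Z s w ord0 j) (L2_Ib_integrable (L2_Ib_bdd (mZ w) (fun s => ZM s w j))).
    (* [step_cvg] says nothing at the left end t, which is a null set. *)
    have : {ae @lebesgue_measure R, forall x, x != t}.
      by exists [set t]; split => [||x /= /negP/negPn/eqP //]; [exact: measurable_set1|exact: lebesgue_measure_set1].
    apply: (@filterS2 _ _ (ae_filter_ringOfSetsType (@lebesgue_measure R))) => x xt hx.
    rewrite /= in_itv/= => /andP[tx xT].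
    have := hx _ xT; rewrite lt_neqAle eq_sym xt tx => /(_ isT).
    by rewrite /S; under [X in _ -> X @ _ --> _]eq_fun do rewrite hh.
  - rewrite -(fineK fin); exact: finite_measure_integrable_cst.
  - by move=> n w _; rewrite gee0_abs ?sqn_ge0.
apply: filterS (cvg0_le c0 e0) => n hn h' hh'; rewrite (_ : cproc _ j = F n)//.
by apply/funext => p; rewrite /F /cproc !mxE hh hh'.
Qed.

Lemma simple_dense_bdd Z M (e : R) : pv Z -> (forall s w j, `|Z s w ord0 j| <= M) -> 0 < e ->
  exists h : simple_process P t T W, (nZ (fun s w => sp_process h s w - Z s w)%R <= e%:E)%E.
Proof.
(* Dividing by m + 1 rather than m covers m = 0. *)
move=> pZ ZM e0; have e1 : 0 < e / m.+1%:R by rewrite divr_gt0.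
have [n _ /(_ n (leqnn n)) hn] := filter_forall _ (fun j => step_dense j pZ ZM e1).
have [h hh] := step_sp n pZ ZM; exists h.
rewrite /nZ (@le_trans _ _ (\sum_(j < m) (e / m.+1%:R)%:E)%E)//.
  by apply: lee_sum => j _; exact: hn.
rewrite sumEFin lee_fin sumr_const card_ord -[X in X <= _]mulr_natr mulrAC ler_pdivrMr//.
by rewrite ler_pM2l// ler_nat.
Qed.

Definition truncZ (n : nat) (Z : R -> Om -> 'rV[R]_m) s w : 'rV[R]_m :=
  \row_j clamp (- n%:R) n%:R (Z s w ord0 j).

Lemma truncZ_prog n Z : pv Z -> pv (truncZ n Z).
Proof.
move=> pZ j s hs; rewrite (_ : (fun p => _) = (clamp (- n%:R) n%:R) \o (fun p : R * Fs s => Z p.1 p.2 ord0 j)); last first.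
  by apply/funext => p; rewrite /= mxE.
by apply: measurableT_comp (pZ j s hs); apply: continuous_measurable_fun; exact: clamp_cont.
Qed.

Lemma truncZ_bdd n Z s w j : `|truncZ n Z s w ord0 j| <= n%:R.
Proof. by rewrite mxE ler_norml; apply: clamp_in; rewrite ge0_cp. Qed.

Lemma clamp_sym_le (N x : R) : 0 <= N -> `|clamp (- N) N x| <= `|x|.
Proof.
move=> N0; rewrite /clamp; have [h1|h1] := leP x N.
  have [h2|h2] := leP (- N) x => //.
  by rewrite normrN (ger0_norm N0) ler0_norm; lra.
have h2 : - N <= N by lra.
by rewrite max_r// !ger0_norm; lra.
Qed.

(** Truncation is eventually exact at each point and moves every coordinate towards 0, so the
    absolute value of the coordinate dominates. *)
Lemma truncZ_dense Z (e : R) : pv Z -> (nZ Z < +oo)%E -> 0 < e ->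
  exists n, (nZ (fun s w => truncZ n Z s w - Z s w)%R <= e%:E)%E.
Proof.
move=> pZ fZ e0; have e1 : 0 < e / m.+1%:R by rewrite divr_gt0.
have cj j : \forall n \near \oo, (sqn mu2 DT (cproc (fun s w => truncZ n Z s w - Z s w)%R j) <= (e / m.+1%:R)%:E)%E.
  apply: (cvg0_le _ e1).
  have LZ : L2 mu2 DT (cproc Z j).
    split; first exact: cproc_meas.
    apply: le_lt_trans fZ; rewrite /nZ (bigD1 j)//= leeDl// sume_ge0// => i _; exact: sqn_ge0.
  have := @sqn_dct _ _ _ mu2 DT mDT (fun n => cproc (truncZ n Z) j) (cproc Z j) (fun p => `|cproc Z j p|).
  have -> : (fun n => sqn mu2 DT (fun x => (cproc (truncZ n Z) j x - cproc Z j x)%R)) =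
    (fun n => sqn mu2 DT (cproc (fun s w => truncZ n Z s w - Z s w)%R j)).
    by apply/funext => n; apply: sqn_eq => p _; rewrite /cproc !mxE.
  apply.
  - by move=> n; apply: cproc_meas; exact: truncZ_prog.
  - by case: LZ.
  - apply: (@L2_le _ _ _ _ _ mDT _ (cproc Z j)) => //; last by move=> p _; rewrite normr_id.
    by apply: measurableT_comp (LZ.1); exact: normr_measurable.
  - apply: aeW => p _; apply: cvg_near_cst.
    apply: filterS (nbhs_infty_ger `|cproc Z j p|) => n hn.
    by rewrite /cproc mxE clamp_id// -ler_norml.
  - by move=> n p _; rewrite /cproc mxE clamp_sym_le.
have [n _ /(_ n (leqnn n)) hn] := filter_forall _ cj; exists n.
rewrite /nZ (@le_trans _ _ (\sum_(j < m) (e / m.+1%:R)%:E)%E)//.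
  by apply: lee_sum => j _; exact: hn.
rewrite sumEFin lee_fin sumr_const card_ord -[X in X <= _]mulr_natr mulrAC ler_pdivrMr//.
by rewrite ler_pM2l// ler_nat.
Qed.

Lemma simple_dense Z (e : R) : pv Z -> (nZ Z < +oo)%E -> 0 < e ->
  exists h : simple_process P t T W, (nZ (fun s w => sp_process h s w - Z s w)%R <= e%:E)%E.
Proof.
move=> pZ fZ e0; have e4 : 0 < e / 4 by rewrite divr_gt0.
have [n hn] := truncZ_dense pZ fZ e4.
have [h hh] := simple_dense_bdd (@truncZ_prog n Z pZ) (@truncZ_bdd n Z) e4.
exists h; have [X [eX _]] := sp_elem h.
apply: (le_trans (nZ_tri (elem_prog eX) (@truncZ_prog n Z pZ) pZ)).
rewrite (@le_trans _ _ (2%:E * (e / 4)%:E + 2%:E * (e / 4)%:E)%E)//.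
  by apply: leeD; apply: lee_wpmul2l.
by rewrite -!EFinM -EFinD lee_fin; lra.
Qed.


(** * Existence, isometry and uniqueness of the Ito integral *)

Lemma H2_normE Z : pv Z -> H2_normsq P t T Z = nZ Z.
Proof.
move=> pZ; have mc j := mu2_fubini (cproc_meas j pZ).
rewrite /nZ; under [RHS]eq_bigr do rewrite (mc _).1.
rewrite -ge0_integral_sum//; last 2 first.
- by move=> j; exact: (mc j).2.
- by move=> j w _; exact: sqn_ge0.
apply: eq_integral => w _; rewrite /sqn -ge0_integral_sum//; last 2 first.
- by move=> j; apply: msq; exact: prog_section (pZ j).
- by move=> j s _; rewrite lee_fin sqr_ge0.
by apply: eq_integral => s _; rewrite /sqnorm /dotv -sumEFin.
Qed.

Lemma nZ_fin Z : (nZ Z < +oo)%E -> nZ Z = (fine (nZ Z))%:E.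
Proof. by move=> f; rewrite fineK// ge0_fin_numE// nZ_ge0. Qed.

Lemma nZ_sub_fin A B : pv A -> pv B -> (nZ A < +oo)%E -> (nZ B < +oo)%E ->
  (nZ (fun s w => A s w - B s w)%R < +oo)%E.
Proof.
move=> pA pB fA fB; apply: (le_lt_trans (nZ_triB pA pB)).
by rewrite (nZ_fin fA) (nZ_fin fB) -!EFinM -EFinD ltry.
Qed.

Lemma elem_dense Z (e : R) : pv Z -> (nZ Z < +oo)%E -> 0 < e ->
  exists Z' X', elem Z' X' /\ (nZ (fun s w => Z' s w - Z s w)%R <= e%:E)%E.
Proof.
move=> pZ fZ e0; have [h hh] := simple_dense pZ fZ e0; have [X [eX _]] := sp_elem h.
by exists (sp_process h), X.
Qed.

(** A version that is adapted, continuous on every path and bounded by one square integrable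
    variable: the regularity that the solution Y inherits, whereas [ito_integral] is an arbitrary
    version. *)
Lemma ito_nice Z : pv Z -> (nZ Z < +oo)%E -> exists I : R -> Om -> R,
  [/\ is_ito_integral P t T W Z I, (forall w, continuous (fun s => I (clamp t T s) w)),
      (forall s, t <= s <= T -> FM s (I s)) &
      exists f, L2 P setT f /\ forall w s, t <= s <= T -> `|I s w| <= f w].
Proof.
move=> pZ fZ; have [I [pI cI fI aI LI]] := ito_exists pZ (fun e => elem_dense pZ fZ).
exists I; split => //; split => //.
  by apply: aeW => w; apply: clamp_within; exact: cI.
have /choice[h hh] : forall n, exists h : simple_process P t T W,
    (nZ (fun s w => sp_process h s w - Z s w)%R <= (n.+1%:R^-1)%:E)%E.
  by move=> n; apply: simple_dense => //; rewrite invr_gt0.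
exists h; split.
  apply: (@cvg0_harmonic R _ 1) => n; rewrite H2_normE ?nZ_ge0//.
  + by have [X [eX _]] := sp_elem (h n); apply: pv_sub => //; exact: elem_prog eX.
  + by rewrite mul1r.
  + by have [X [eX _]] := sp_elem (h n); apply: pv_sub => //; exact: elem_prog eX.
move=> s; rewrite in_itv/= => hs; apply: (@cvg0_harmonic R _ 2) => n.
  by apply: integral_ge0 => w _; rewrite lee_fin sqr_ge0.
have [X [eX aX]] := sp_elem (h n).
have mX : measurable_fun setT (X s).
  by case/andP: hs => ts sT; exact: FM_meas sT (elem_FM eX ts).
have mI : measurable_fun setT (I s) by case/andP: (hs) => ts sT; exact: FM_meas sT (fI s hs).
have msp : measurable_fun setT (fun w => sp_integral (h n) s w).
  case/andP: (hs) => ts sT; apply: (FM_meas sT); apply: (FM_ae (elem_FM eX ts)).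
  by apply: filterS aX => w; exact.
rewrite -[leLHS]/(sqn P setT (fun w => sp_integral (h n) s w - I s w)).
rewrite (@sqn_ae _ _ _ P setT measurableT _ (fun w => X s w - I s w)).
- apply: (le_trans (aI s _ _ hs eX)).
  rewrite (@le_trans _ _ (2%:E * (n.+1%:R^-1)%:E)%E)// lee_wpmul2l//; exact: hh.
- exact: measurable_funB.
- exact: measurable_funB.
- by apply: filterS aX => w h1 _; rewrite h1.
Qed.

(* [J] is the value at time s of the Ito integral of Z. *)
Definition ito_lim Z s (J : Om -> R) := measurable_fun setT J /\ forall e : R, 0 < e ->
  exists Z' X', [/\ elem Z' X', (nZ (fun s w => Z' s w - Z s w)%R <= e%:E)%E &
    (sqn P setT (fun w => X' s w - J w)%R <= e%:E)%E].

Lemma ito_limP Z I s : pv Z -> is_ito_integral P t T W Z I -> t <= s <= T -> ito_lim Z s (I s).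
Proof.
move=> pZ [pI cI [h [h1 h2]]] hs; case/andP: (hs) => ts sT.
have mI : measurable_fun setT (I s) by exact: FM_meas sT (progressive_FM pI hs).
split => // e e0.
have hs' : s \in `[t, T] by rewrite in_itv.
have [n [hn1 hn2]] : exists n, (H2_normsq P t T (fun s w => sp_process (h n) s w - Z s w)%R <= e%:E)%E /\
   (\int[P]_w ((sp_integral (h n) s w - I s w) ^+ 2)%:E <= e%:E)%E.
  have c1 := cvg0_le h1 e0; have c2 := cvg0_le (h2 s hs') e0.
  by have [n _ /(_ n (leqnn n)) hn] := filterI c1 c2; exists n.
have [X [eX aX]] := sp_elem (h n); exists (sp_process (h n)), X; split => //.
  by rewrite -H2_normE//; apply: pv_sub => //; exact: elem_prog eX.
have mX : measurable_fun setT (X s) by exact: FM_meas sT (elem_FM eX ts).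
have msp : measurable_fun setT (fun w => sp_integral (h n) s w).
  by apply: (FM_meas sT); apply: (FM_ae (elem_FM eX ts)); apply: filterS aX => w; exact.
rewrite (@sqn_ae _ _ _ P setT measurableT _ (fun w => sp_integral (h n) s w - I s w)) //.
- exact: measurable_funB.
- exact: measurable_funB.
- by apply: filterS aX => w h3 _; rewrite h3.
Qed.

Lemma ito_lim_L2 Z s J : t <= s -> ito_lim Z s J -> L2 P setT J.
Proof.
move=> ts [mJ /(_ 1 ltr01)[Z' [X' [eX _ h]]]].
have LX := elem_L2 eX ts.
have L1 : L2 P setT (fun w => X' s w - J w).
  by split; [exact: measurable_funB LX.1 mJ|exact: le_lt_trans h (ltry _)].
have := L2B measurableT LX L1; rewrite (_ : (fun w => _) = J)//.
by apply/funext => w; ring.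
Qed.

(** Elementary approximations reproduce J - J' and Z - Z' up to a squared error x; Young's
    inequality, used once in each space, yields the shape of [young_limit_le]. For s < T an
    inequality is the best possible in general, as the norm runs over all of [t, T]. *)
Lemma ito_lim_le Z Z' s J J' : t <= s <= T -> pv Z -> pv Z' ->
  (nZ (fun s w => Z s w - Z' s w)%R < +oo)%E ->
  ito_lim Z s J -> ito_lim Z' s J' ->
  (sqn P setT (fun w => J w - J' w)%R <= nZ (fun s w => Z s w - Z' s w)%R)%E.
Proof.
move=> hs pZ pZ' fin [mJ hJ] [mJ' hJ']; case/andP: (hs) => ts sT.
rewrite (nZ_fin fin); apply: young_limit_le; first by rewrite fine_ge0// nZ_ge0.
move=> e x e0 x0; rewrite -nZ_fin//.
have x4 : 0 < x / 4 by rewrite divr_gt0.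
have [A [X [eA A1 A2]]] := hJ _ x4; have [B [Y [eB B1 B2]]] := hJ' _ x4.
have eAB := elem_sub eA eB.
have mX := (elem_L2 eA ts).1; have mY := (elem_L2 eB ts).1.
have pA := elem_prog eA; have pB := elem_prog eB.
rewrite (@sqn_eq _ _ _ P setT _ (fun w => (X s w - Y s w) + ((J w - X s w) - (J' w - Y s w)))); last first.
  by move=> w _; ring.
have i0 : 0 <= 1 + e^-1 by rewrite addr_ge0// invr_ge0 ltW.
apply: le_trans (sqn_young _ measurableT e0 _ _) _.
- exact: measurable_funB.
- by apply: measurable_funB; exact: measurable_funB.
apply: leeD; last first.
  apply: lee_wpmul2l; rewrite ?lee_fin//.
  apply: le_trans (sqnB _ measurableT _ _) _; [exact: measurable_funB|exact: measurable_funB|].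
  by apply: sqn_lt_half; [rewrite -sqnN|rewrite -sqnN]; under sqn_eq do rewrite opprB.
apply: lee_wpmul2l; first by rewrite lee_fin addr_ge0// ltW.
apply: (le_trans (elem_sq_le eAB hs)); rewrite (isometry eAB).
rewrite (_ : (fun s w => A s w - B s w) = fun s w => (Z s w - Z' s w) + ((A s w - Z s w) - (B s w - Z' s w))); last first.
  by apply/funext => u; apply/funext => w; apply/rowP => i; rewrite !mxE; ring.
apply: le_trans (nZ_youngD e0 _ _) _; [exact: pv_sub|by apply: pv_sub; exact: pv_sub|].
apply: leeD => //; apply: lee_wpmul2l; rewrite ?lee_fin//.
apply: le_trans (nZ_triB _ _) _; [exact: pv_sub|exact: pv_sub|].
exact: sqn_lt_half.
Qed.

(** The argument of [ito_lim_le] read backwards: at time T the elementary isometry is an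
    equality. *)
Lemma ito_lim_ge Z Z' J J' : pv Z -> pv Z' ->
  ito_lim Z T J -> ito_lim Z' T J' ->
  (nZ (fun s w => Z s w - Z' s w)%R <= sqn P setT (fun w => J w - J' w)%R)%E.
Proof.
move=> pZ pZ' iJ iJ'; have LJ := ito_lim_L2 tT iJ; have LJ' := ito_lim_L2 tT iJ'.
have [mJ hJ] := iJ; have [mJ' hJ'] := iJ'.
have LB := L2B measurableT LJ LJ'.
rewrite sqnE//; apply: young_limit_le; first by rewrite -lee_fin -sqnE// sqn_ge0.
move=> e x e0 x0; rewrite -sqnE//.
have x4 : 0 < x / 4 by rewrite divr_gt0.
have [A [X [eA A1 A2]]] := hJ _ x4; have [B [Y [eB B1 B2]]] := hJ' _ x4.
have eAB := elem_sub eA eB.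
have mX := (elem_L2 eA tT).1; have mY := (elem_L2 eB tT).1.
have pA := elem_prog eA; have pB := elem_prog eB.
have i0 : 0 <= 1 + e^-1 by rewrite addr_ge0// invr_ge0 ltW.
rewrite (_ : (fun s w => Z s w - Z' s w) = fun s w => (A s w - B s w) + ((Z s w - A s w) - (Z' s w - B s w))); last first.
  by apply/funext => u; apply/funext => w; apply/rowP => i; rewrite !mxE; ring.
apply: le_trans (nZ_youngD e0 _ _) _; [exact: pv_sub|by apply: pv_sub; exact: pv_sub|].
apply: leeD; last first.
  apply: lee_wpmul2l; rewrite ?lee_fin//.
  apply: le_trans (nZ_triB _ _) _; [exact: pv_sub|exact: pv_sub|].
  by apply: sqn_lt_half; rewrite nZ_sym.
apply: lee_wpmul2l; first by rewrite lee_fin addr_ge0// ltW.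
rewrite -(isometry eAB).
rewrite (@sqn_eq _ _ _ P setT _ (fun w => (J w - J' w) + ((X T w - J w) - (Y T w - J' w)))); last first.
  by move=> w _; ring.
apply: le_trans (sqn_young _ measurableT e0 _ _) _.
- exact: measurable_funB.
- by apply: measurable_funB; exact: measurable_funB.
apply: leeD => //; apply: lee_wpmul2l; rewrite ?lee_fin//.
apply: le_trans (sqnB _ measurableT _ _) _; [exact: measurable_funB|exact: measurable_funB|].
exact: sqn_lt_half.
Qed.

Lemma ito_isometry Z Z' J J' : pv Z -> pv Z' ->
  (nZ Z < +oo)%E -> (nZ Z' < +oo)%E -> ito_lim Z T J -> ito_lim Z' T J' ->
  sqn P setT (fun w => J w - J' w) = nZ (fun s w => Z s w - Z' s w).
Proof.
move=> pZ pZ' fZ fZ' iJ iJ'; apply/eqP; rewrite eq_le ito_lim_ge// andbT.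
by apply: (@ito_lim_le _ _ T) => //; [rewrite tT lexx|exact: nZ_sub_fin].
Qed.

Lemma ito_lim_start Z J : ito_lim Z t J -> {ae P, forall w, J w = 0}.
Proof.
move=> [mJ hJ]; suff : sqn P setT J = 0%E.
  by move=> /(sqn0_ae measurableT mJ); apply: filterS => w; apply.
apply/eqP; rewrite eq_le sqn_ge0 andbT; apply/lee_addgt0Pr => e e0; rewrite add0e.
have [A [X [eA _ h]]] := hJ _ e0; apply: le_trans h; rewrite -sqnN.
by rewrite (@sqn_eq _ _ _ P setT _ (fun w => X t w - J w))// => w _; rewrite (elem_start _ eA) sub0r.
Qed.

(* Pythagoras: an F_t-measurable variable is orthogonal to elementary integrals. *)
Lemma ito_lim_orth Z J D : ito_lim Z T J -> FM t D -> L2 P setT D ->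
  {ae P, forall w, J w = D w} -> {ae P, forall w, D w = 0}.
Proof.
move=> [mJ hJ] fD LD JD; suff : sqn P setT D = 0%E.
  by move=> /(sqn0_ae measurableT LD.1); apply: filterS => w; apply.
apply/eqP; rewrite eq_le sqn_ge0 andbT; apply/lee_addgt0Pr => e e0; rewrite add0e.
have [A [X [eA _ h]]] := hJ _ e0; apply: le_trans h.
have LX := elem_L2 eA tT.
rewrite [leRHS](@sqn_ae _ _ _ P setT measurableT _ (fun w => X T w - D w)); last first.
- by apply: filterS JD => w -> .
- exact: measurable_funB LX.1 LD.1.
- exact: measurable_funB LX.1 mJ.
have LB := L2B measurableT LX LD.
rewrite !sqnE// lee_fin.
have o := elem_mart eA (lexx t) tT (lexx T) fD LD.
have o' : \int[P]_w (D w * X T w) = 0.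
  by rewrite -[RHS]o; apply: eq_Rintegral => w _; rewrite (elem_start _ eA) subr0.
rewrite [leRHS](@eq_Rintegral _ _ _ P setT (fun w => (D w ^+ 2 + X T w ^+ 2) - 2 * (D w * X T w))); last first.
  by move=> w _; ring.
have i1 := L2_int_sq LD; have i2 := L2_int_sq LX.
have i3 := L2_int_mul measurableT LD LX.
rewrite RintegralB//; last 2 first.
- exact: (integrableD measurableT i1 i2).
- exact: (integrableZl measurableT 2 i3).
by rewrite RintegralD// RintegralZl// o' mulr0 subr0 lerDl -lee_fin -sqnE// sqn_ge0.
Qed.

(** The square of a mean is at most the second moment, so the zero mean of elementary integrals
    passes to L2 limits. *)
Lemma ito_lim_mean Z J : ito_lim Z T J -> \int[P]_w J w = 0.
Proof.
move=> iJ; have LJ := ito_lim_L2 tT iJ; have [mJ hJ] := iJ.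
suff : ((\int[P]_w J w) ^+ 2 <= 0).
  by move=> h; apply/eqP; rewrite -sqrf_eq0 eq_le h sqr_ge0.
apply/ler_addgt0Pr => e e0; rewrite add0r -lee_fin.
have [A [X [eA _ h]]] := hJ _ e0; apply: le_trans h.
have LX := elem_L2 eA tT; have LB := L2B measurableT LX LJ.
apply: le_trans (Rintegral_sq_le LB).
have o' := elem_mean0 eA.
by rewrite RintegralB ?o' ?sub0r ?sqrrN//; exact: L2_int.
Qed.

(** Almost sure agreement at the countably many grid points extends to all times by continuity. *)
Lemma cont_indist (I I' : R -> Om -> R) :
  {ae P, forall w, {within `[t, T], continuous (I ^~ w)}} ->
  {ae P, forall w, {within `[t, T], continuous (I' ^~ w)}} ->
  (forall s, t <= s <= T -> {ae P, forall w, I s w = I' s w}) ->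
  {ae P, forall w, forall s, t <= s <= T -> I s w = I' s w}.
Proof.
move=> cI cI' h.
have hg : {ae P, forall w, forall n k, I (gp t T n k) w = I' (gp t T n k) w}.
  (* The pairs (n, k) are enumerated through [pickle]; an integer that codes no pair falls back to
     (0, 0). *)
  have h1 p : {ae P, forall w, (fun p w => I (gp t T p.1 p.2) w = I' (gp t T p.1 p.2) w) (odflt (0%N, 0%N) (unpickle p)) w}.
    by apply: h; rewrite gp_ge// gp_le.
  apply: filterS (ae_foralln h1) => w hw n k.
  by have := hw (pickle (n, k)); rewrite pickleK.
move: cI cI' hg; apply: filterS3 => w c1 c2 hw s /andP[ts sT].
have e1 := @gp_cvg_fun R t T (I ^~ w) s tT ts sT (within_clamp tT c1).
have e2 := @gp_cvg_fun R t T (I' ^~ w) s tT ts sT (within_clamp tT c2).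
have e3 : (fun n => I (gp t T n (gidx t n s)) w) = (fun n => I' (gp t T n (gidx t n s)) w).
  by apply/funext => n; exact: hw.
by rewrite e3 in e1; exact: cvg_unique e1 e2.
Qed.

(** Two integrands are allowed because both cases occur: two versions for one integrand, and
    integrands that agree only almost everywhere. *)
Lemma ito_unique Z Z' I I' : pv Z -> pv Z' -> nZ (fun s w => Z s w - Z' s w) = 0%E ->
  is_ito_integral P t T W Z I -> is_ito_integral P t T W Z' I' ->
  {ae P, forall w, forall s, t <= s <= T -> I s w = I' s w}.
Proof.
move=> pZ pZ' h0 iI iI'; have [_ cI _] := iI; have [_ cI' _] := iI'.
apply: cont_indist => // s hs.
have l1 := ito_limP pZ iI hs; have l2 := ito_limP pZ' iI' hs.
have := ito_lim_le hs pZ pZ'; rewrite h0 ltry => /(_ _ _ isT l1 l2) le0.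
have : sqn P setT (fun w => I s w - I' s w) = 0%E by apply/eqP; rewrite eq_le le0 sqn_ge0.
move=> /(sqn0_ae measurableT (measurable_funB l1.1 l2.1)); apply: filterS => w /(_ Logic.I)/eqP.
by rewrite subr_eq0 => /eqP.
Qed.

Lemma ito_integralP Z : pv Z -> (nZ Z < +oo)%E -> is_ito_integral P t T W Z (ito_integral P t T W Z).
Proof.
move=> pZ fZ; have [I [iI _ _ _]] := ito_nice pZ fZ.
exact: (@xgetPex _ _ [set I | is_ito_integral P t T W Z I]) (ex_intro _ I iI).
Qed.


(** * Martingale representation *)

(* The L2-closure of the constants plus elementary integrals up to T; it turns
   out to be all of L2(F_T). *)
Definition chaos (eta : Om -> R) := L2 P setT eta /\ forall e : R, 0 < e ->
  exists c Z X, elem Z X /\ (sqn P setT (fun w => eta w - (c + X T w))%R <= e%:E)%E.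

Lemma chaos_cst c : chaos (cst c).
Proof.
split; first exact: L2_cst.
move=> e e0; exists c, (fun _ _ => 0), (fun _ _ => 0); split; first exact: elem0.
rewrite (@sqn_eq _ _ _ P setT _ (cst 0)); last by move=> w _; rewrite /= addr0 subrr.
by rewrite /sqn; under eq_integral do rewrite expr0n/=; rewrite integral0 lee_fin ltW.
Qed.

Lemma elem_affine_L2 c Z X : elem Z X -> L2 P setT (fun w => c + X T w).
Proof. by move=> e; apply: L2D => //; [exact: L2_cst|exact: elem_L2 e tT]. Qed.

Lemma chaos_closed eta : L2 P setT eta ->
  (forall e : R, 0 < e -> exists eta', chaos eta' /\ (sqn P setT (fun w => eta w - eta' w)%R <= e%:E)%E) ->
  chaos eta.
Proof.
move=> Le h; split => // e e0; have e4 : 0 < e / 4 by rewrite divr_gt0.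
have [eta' [[Le' ve'] he']] := h _ e4; have [c [Z [X [eX hX]]]] := ve' _ e4.
exists c, Z, X; split => //; have LX := elem_affine_L2 c eX.
rewrite (@sqn_eq _ _ _ P setT _ (fun w => (eta w - eta' w) + (eta' w - (c + X T w)))); last first.
  by move=> w _; ring.
apply: le_trans (sqnD _ measurableT (L2B measurableT Le Le').1 (L2B measurableT Le' LX).1) _.
exact: sqn_lt_half.
Qed.

Lemma chaos_add eta eta' : chaos eta -> chaos eta' -> chaos (fun w => eta w + eta' w).
Proof.
move=> [L1 v1] [L2_ v2]; split; first exact: L2D.
move=> e e0; have e4 : 0 < e / 4 by rewrite divr_gt0.
have [c [Z [X [eX hX]]]] := v1 _ e4; have [c' [Z' [X' [eX' hX']]]] := v2 _ e4.
exists (c + c'); eexists; eexists; split; first exact: (elem_add eX eX').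
rewrite (@sqn_eq _ _ _ P setT _ (fun w => (eta w - (c + X T w)) + (eta' w - (c' + X' T w)))); last first.
  by move=> w _; ring.
have LX := elem_affine_L2 c eX; have LX' := elem_affine_L2 c' eX'.
apply: le_trans (sqnD _ measurableT (L2B measurableT L1 LX).1 (L2B measurableT L2_ LX').1) _.
exact: sqn_lt_half.
Qed.

Lemma chaos_scale k eta : chaos eta -> chaos (fun w => k * eta w).
Proof.
move=> [L1 v1]; split; first exact: L2Z.
(* Dividing by k^2 + 1 rather than k^2 covers k = 0. *)
move=> e e0; have k0 : 0 < k ^+ 2 + 1 by rewrite ltr_wpDl ?sqr_ge0.
have ek : 0 < e / (k ^+ 2 + 1) by rewrite divr_gt0.
have [c [Z [X [eX hX]]]] := v1 _ ek.
exists (k * c); eexists; eexists; split; first exact: (elem_scale k eX).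
rewrite (@sqn_eq _ _ _ P setT _ (fun w => k * (eta w - (c + X T w)))); last by move=> w _; ring.
have LX := elem_affine_L2 c eX.
rewrite (sqnZ P measurableT k (L2B measurableT L1 LX).1).
apply: (@le_trans _ _ ((k ^+ 2)%:E * (e / (k ^+ 2 + 1))%:E)%E).
  by apply: lee_wpmul2l => //; rewrite lee_fin sqr_ge0.
rewrite -EFinM lee_fin mulrCA ger_pMr// ler_pdivrMr// mul1r lerDl//.
Qed.

Lemma chaos_sum (I : Type) (r : seq I) (f : I -> Om -> R) : (forall i, chaos (f i)) ->
  chaos (fun w => \sum_(i <- r) f i w).
Proof.
move=> h; elim: r => [|i r IH].
  by have := chaos_cst 0; congr chaos; apply/funext => w; rewrite big_nil.
by have := chaos_add (h i) IH; congr chaos; apply/funext => w; rewrite big_cons.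
Qed.

Lemma chaos_dct (f : nat -> Om -> R) (eta g : Om -> R) : (forall n, chaos (f n)) -> measurable_fun setT eta ->
  L2 P setT g -> {ae P, forall w, f ^~ w @ \oo --> eta w} -> (forall n w, `|f n w| <= g w) -> chaos eta.
Proof.
move=> vf me Lg fe fg.
have c0 := @sqn_dct _ _ _ P setT measurableT f eta g (fun n => (vf n).1.1) me Lg.
have fe' : {ae P, forall w, [set: Om] w -> f ^~ w @ \oo --> eta w} by apply: filterS fe => w h _.
have {}c0 := c0 fe' (fun n w _ => fg n w).
have Le : L2 P setT eta.
  have [n _ /(_ n (leqnn n)) hn] := cvg0_le c0 ltr01.
  have L1 : L2 P setT (fun w => f n w - eta w).
    by split; [exact: measurable_funB (vf n).1.1 me|exact: le_lt_trans hn (ltry _)].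
  have := L2B measurableT (vf n).1 L1; rewrite (_ : (fun w => _) = eta)//.
  by apply/funext => w; ring.
apply: chaos_closed => // e e0.
have [n _ /(_ n (leqnn n)) hn] := cvg0_le c0 e0.
exists (f n); split => //; rewrite -sqnN.
by rewrite (@sqn_eq _ _ _ P setT _ (fun w => f n w - eta w))// => w _; rewrite opprB.
Qed.

Lemma chaos_ae (eta eta' : Om -> R) : chaos eta -> measurable_fun setT eta' -> {ae P, forall w, eta w = eta' w} ->
  chaos eta'.
Proof.
move=> ve me h; apply: (@chaos_dct (fun _ => eta) _ (fun w => `|eta w|)) => //.
  by apply: L2_norm; case: ve.
by apply: filterS h => w ->; exact: cvg_cst.
Qed.

(** * Trigonometric functions of Brownian increments *)

Definition lin (lam : 'I_m -> R) (x : 'rV[R]_m) : R := \sum_i lam i * x ord0 i.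

Lemma lin_meas lam : measurable_fun [set: RV R m] (lin lam : RV R m -> R).
Proof.
rewrite /lin; apply: measurable_sum => i.
by apply: measurable_funM => //; exact: coord_meas.
Qed.

Lemma lin_flip lam x : lin lam (flip predT x) = - lin lam x.
Proof. by rewrite /lin -sumrN; apply: eq_bigr => i _; rewrite flipE /= mulrN. Qed.

Lemma lin_incr_FM lam r s u : t <= r -> r <= s -> s <= u -> FM u (fun w => lin lam (incr r s w)).
Proof.
move=> tr rs su; rewrite /lin; apply: measurable_sum => i.
by apply: FM_M; [exact: FM_cst|exact: FM_incr_coord].
Qed.

Lemma lin_incr_L2 lam r s : t <= r -> r <= s -> s <= T -> L2 P setT (fun w => lin lam (incr r s w)).
Proof.
move=> tr rs sT; rewrite /lin.
elim: (index_enum _) => [|i l IH].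
  by have := L2_cst 0; congr L2; apply/funext => w; rewrite big_nil.
have := L2D measurableT (L2Z measurableT (lam i) (incr_L2 i tr rs sT)) IH.
by congr L2; apply/funext => w; rewrite big_cons.
Qed.

(** The constant 8 comes from (x + b)^2 <= 2 (x^2 + b^2) used twice; the exponent 2 * 2 matches an
    iterated square. *)
Lemma add_pow4 (k a b : R) : (k * a + b) ^+ (2 * 2) <= 8 * k ^+ 4 * a ^+ 4 + 8 * b ^+ (2 * 2).
Proof.
have -> : 8 * k ^+ 4 * a ^+ 4 = 8 * (k * a) ^+ 4 by ring.
move: (k * a) => x.
have h1 : 0 <= (x - b) ^+ 2 by exact: sqr_ge0.
have h2 : 0 <= (x ^+ 2 - b ^+ 2) ^+ 2 by exact: sqr_ge0.
have h3 : (x + b) ^+ 2 <= 2 * (x ^+ 2 + b ^+ 2) by move: h1; rewrite !expr2; lra.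
have h4 : ((x + b) ^+ 2) ^+ 2 <= (2 * (x ^+ 2 + b ^+ 2)) ^+ 2.
  by rewrite lerXn2r ?nnegrE ?sqr_ge0// mulr_ge0// addr_ge0// sqr_ge0.
have e4 y : y ^+ 4 = (y ^+ 2) ^+ 2 :> R by rewrite -exprM.
rewrite !exprM !e4; apply: (le_trans h4); move: h2.
move: (x ^+ 2) (b ^+ 2) => u v; rewrite !expr2; lra.
Qed.

(** Only the order (s - r)^2 matters, so the coordinates are added one at a time with [add_pow4], at
    the price of a constant that grows with their number. *)
Lemma lin_incr_pow4 lam : exists K : R, 0 <= K /\ forall r s, t <= r -> r <= s -> s <= T ->
  (sqn P setT (fun w => (lin lam (incr r s w) ^+ 2)%R) <= (K * (s - r) ^+ 2)%:E)%E.
Proof.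
rewrite /lin; elim: (index_enum _) => [|i l [K [K0 IH]]].
  exists 0; split => // r s _ _ _; rewrite mul0r /sqn.
  by under eq_integral do rewrite big_nil !expr0n/=; rewrite integral0.
pose C : R := 48 * expR (2^-1); have C0 : 0 <= C by rewrite mulr_ge0// expR_ge0.
exists (8 * lam i ^+ 4 * C + 8 * K); split.
  have h : 0 <= lam i ^+ 4 by exact: exprn_even_ge0.
  by rewrite addr_ge0// mulr_ge0// mulr_ge0.
move=> r s tr rs sT.
have mi := incr_coord_meas i tr rs sT.
have ml : measurable_fun setT (fun w => \sum_(j <- l) lam j * incr r s w ord0 j).
  by apply: measurable_sum => j; apply: measurable_funM => //; exact: incr_coord_meas.
have m4 (f : Om -> R) n : measurable_fun setT f -> measurable_fun setT (fun w => (f w ^+ n)%:E).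
  by move=> mf; apply/measurable_EFinP; exact: measurable_funX.
apply: (@le_trans _ _ (\int[P]_w ((8 * lam i ^+ 4)%:E * ((incr r s w ord0 i) ^+ 4)%:E +
    8%:E * (((\sum_(j <- l) lam j * incr r s w ord0 j) ^+ 2) ^+ 2)%:E)%E)%E).
  apply: ge0_le_integral => //.
  - by move=> w _; rewrite lee_fin sqr_ge0.
  - under eq_fun do rewrite -exprM big_cons; apply: m4; apply: measurable_funD => //.
    exact: measurable_funM.
  - apply: emeasurable_funD; apply: measurable_funeM; [exact: m4|].
    by under eq_fun do rewrite -exprM; exact: m4.
  - move=> w _; rewrite -!EFinM -EFinD lee_fin big_cons -!exprM.
    exact: add_pow4.
have k1 : 0 <= 8 * lam i ^+ 4 by rewrite mulr_ge0// exprn_even_ge0.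
rewrite ge0_integralD//; last 4 first.
- by move=> w _; rewrite -EFinM lee_fin mulr_ge0// exprn_even_ge0.
- by apply: measurable_funeM; exact: m4.
- by move=> w _; rewrite -EFinM lee_fin mulr_ge0// sqr_ge0.
- by apply: measurable_funeM; under eq_fun do rewrite -exprM; exact: m4.
rewrite !ge0_integralZl_EFin//; last 4 first.
- by move=> w _; rewrite lee_fin sqr_ge0.
- by under eq_fun do rewrite -exprM; exact: m4.
- by move=> w _; rewrite lee_fin exprn_even_ge0.
- exact: m4.
apply: (@le_trans _ _ ((8 * lam i ^+ 4)%:E * (C * (s - r) ^+ 2)%:E + 8%:E * (K * (s - r) ^+ 2)%:E)%E).
  apply: leeD; apply: lee_wpmul2l; rewrite ?lee_fin//; [exact: incr_pow4|exact: IH].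
by rewrite -!EFinM -EFinD lee_fin; lra.
Qed.

Lemma FM_comp s (phi : R -> R) f : measurable_fun setT phi -> FM s f -> FM s (fun w => phi (f w)).
Proof. by move=> mp mf; exact: (measurableT_comp mp mf). Qed.

Lemma cos_meas : measurable_fun [set: R] (cos : R -> R).
Proof. by apply: continuous_measurable_fun; exact: continuous_cos. Qed.

Lemma sin_meas : measurable_fun [set: R] (sin : R -> R).
Proof. by apply: continuous_measurable_fun; exact: continuous_sin. Qed.

Lemma abs_cos_le1 (x : R) : `|cos x| <= 1.
Proof. by rewrite ler_norml cos_geN1 cos_le1. Qed.

Lemma abs_sin_le1 (x : R) : `|sin x| <= 1.
Proof. by rewrite ler_norml sin_geN1 sin_le1. Qed.


(* [cos (Theta + D) = c cos Theta - sin Theta * D + error] for a Brownian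
   increment [D] after [Theta], [c = E (cos D)]; the error is orthogonal to the
   past and has second moment O((s - r)^2), so the errors of the n steps of a
   uniform grid add up to O(1/n) in L2. *)
Lemma one_step_error lam : exists K : R, 0 <= K /\ forall r s (U V rho : Om -> R) (D := fun w => lin lam (incr r s w))
   (c := \int[P]_w cos (D w)), t <= r -> r <= s -> s <= T -> FM r U -> FM r V -> FM r rho -> L2 P setT rho ->
   (forall w, `|U w| <= 1) -> (forall w, `|V w| <= 1) ->
   `|c| <= 1 /\ let rho' := fun w => c * rho w + (U w * (cos (D w) - c) - V w * (sin (D w) - D w)) in
   [/\ FM s rho', L2 P setT rho' & (sqn P setT rho' <= sqn P setT rho + (K * (s - r) ^+ 2)%:E)%E].
Proof.
(* With q = K (s - r)^2, the two error terms have second moments at most q and q / 4, and 2 q + 2 (q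
   / 4) <= 4 q. *)
have [K [K0 hK]] := lin_incr_pow4 lam; exists (4 * K); split; first by rewrite mulr_ge0.
move=> r s U V rho D c tr rs sT fU fV fr Lr U1 V1.
have mD : measurable_fun [set: RV R m] (lin lam : RV R m -> R) by exact: lin_meas.
have fD : FM s D by exact: lin_incr_FM.
have LD : L2 P setT D by exact: lin_incr_L2.
have mDO : measurable_fun setT D := LD.1.
have mc : measurable_fun setT (fun w => cos (D w)) by exact: (measurableT_comp cos_meas mDO).
have ms : measurable_fun setT (fun w => sin (D w)) by exact: (measurableT_comp sin_meas mDO).
have Lc : L2 P setT (fun w => cos (D w)).
  by apply: (@L2_bdd _ _ _ _ _ measurableT _ 1) => [||w]; [exact: prob_fin|exact: mc|exact: abs_cos_le1].
have Ls : L2 P setT (fun w => sin (D w)).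
  by apply: (@L2_bdd _ _ _ _ _ measurableT _ 1) => [||w]; [exact: prob_fin|exact: ms|exact: abs_sin_le1].
pose al w := cos (D w) - c; pose be w := sin (D w) - D w.
have La : L2 P setT al by apply: L2B => //; exact: L2_cst.
have Lb : L2 P setT be by exact: L2B.
set q := K * (s - r) ^+ 2 in hK *.
have hq : (sqn P setT (fun w => (D w ^+ 2)%R) <= q%:E)%E by exact: hK.
have mD2 : measurable_fun setT (fun w => D w ^+ 2) by exact: measurable_funX.
(* Whatever is below D^2 / 2 has second moment at most q / 4; this covers sin D - D and 1 - cos
   D. *)
have half (f : Om -> R) : measurable_fun setT f -> (forall w, `|f w| <= D w ^+ 2 / 2) -> (sqn P setT f <= (q / 4)%:E)%E.
  move=> mf hf; apply: (@le_trans _ _ (sqn P setT (fun w => (2^-1 * D w ^+ 2)%R))).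
    apply: sqn_le => //; first exact: measurable_funM.
    by move=> w _; rewrite (le_trans (hf w))// mulrC ler_norm.
  rewrite (sqnZ P measurableT _ mD2) (@le_trans _ _ (((2^-1) ^+ 2)%:E * q%:E)%E)//.
    by apply: lee_wpmul2l => //; rewrite lee_fin sqr_ge0.
  by rewrite -EFinM lee_fin exprVn mulrC -natrX.
have hbe : (sqn P setT be <= (q / 4)%:E)%E by apply: half; [exact: Lb.1|move=> w; exact: sin_sub_le].
have L1c : L2 P setT (fun w => 1 - cos (D w)) by apply: L2B => //; exact: L2_cst.
have h1c : (sqn P setT (fun w => (1 - cos (D w))%R) <= (q / 4)%:E)%E.
  apply: half; first exact: L1c.1.
  by move=> w; have /andP[c1 c2] := cos_sub1_le (D w); rewrite ger0_norm.
have Ec : \int[P]_w (1 - cos (D w)) = 1 - c.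
  rewrite RintegralB//; [|exact: L2_int (L2_cst 1)|exact: L2_int].
  by rewrite (Rintegral_prob_cst 1).
(* [al] is the mean 1 - c of 1 - cos D minus that variable, and the squared mean is at most the
   second moment. *)
have hal : (sqn P setT al <= q%:E)%E.
  rewrite (@sqn_eq _ _ _ P setT _ (fun w => cst (1 - c) w - (1 - cos (D w)))); last by move=> w _; rewrite /al /=; ring.
  apply: le_trans (sqnB _ measurableT (L2_cst (1 - c)).1 L1c.1) _.
  rewrite (@le_trans _ _ (2%:E * (q / 4)%:E + 2%:E * (q / 4)%:E)%E)//; last by rewrite -!EFinM -EFinD lee_fin; lra.
  apply: leeD; apply: lee_wpmul2l => //.
  apply: le_trans h1c; rewrite -Ec; apply: le_trans (Rintegral_sq_le L1c).
  by rewrite (sqnE measurableT (L2_cst _)) lee_fin (Rintegral_prob_cst (_ ^+ 2)).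
have c1 : `|c| <= 1.
  have : 0 <= \int[P]_w (1 - cos (D w)) by apply: Rintegral_ge0 => w _; rewrite subr_ge0 cos_le1.
  have : 0 <= \int[P]_w (1 + cos (D w)).
    by apply: Rintegral_ge0 => w _; have := cos_geN1 (D w); lra.
  rewrite Ec RintegralD//; [|exact: L2_int (L2_cst 1)|exact: L2_int].
  by rewrite (Rintegral_prob_cst 1) ler_norml -/c; lra.
split => // rho'.
have mal : measurable_fun [set: RV R m] (fun x : RV R m => cos (lin lam x) - c).
  by apply: measurable_funB => //; exact: (measurableT_comp cos_meas mD).
have mbe : measurable_fun [set: RV R m] (fun x : RV R m => sin (lin lam x) - lin lam x).
  by apply: measurable_funB => //; exact: (measurableT_comp sin_meas mD).
have Eal : \int[P]_w al w = 0.
  rewrite RintegralB//; [|exact: L2_int|exact: L2_int (L2_cst c)].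
  by rewrite (Rintegral_prob_cst c) subrr.
have Ebe : \int[P]_w be w = 0.
  apply: (@incr_odd0 r s predT (fun x => sin (lin lam x) - lin lam x)) => //; first exact: L2_int.
  by move=> x; rewrite lin_flip sinN; ring.
have sT' : r <= T := le_trans rs sT.
have mr := FM_meas sT' fr; have mU := FM_meas sT' fU; have mV := FM_meas sT' fV.
have LUa : L2 P setT (fun w => U w * al w) by exact: (L2_bdd_mul measurableT mU U1 La).
have LVb : L2 P setT (fun w => V w * be w) by exact: (L2_bdd_mul measurableT mV V1 Lb).
pose Q w := U w * al w - V w * be w.
have LQ : L2 P setT Q by exact: L2B.
have Lcr : L2 P setT (fun w => c * rho w) by exact: L2Z.
have Lr' : L2 P setT rho' by exact: L2D.
have frho' : FM s rho'.
  apply: FM_D; first by apply: FM_M; [exact: FM_cst|exact: FM_mono fr].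
  apply: FM_B; apply: FM_M; [exact: FM_mono fU| |exact: FM_mono fV|].
  - by apply: FM_B; [exact: FM_comp cos_meas fD|exact: FM_cst].
  - by apply: FM_B => //; exact: FM_comp sin_meas fD.
split => //.
have Lru : L2 P setT (fun w => U w * rho w) by exact: (L2_bdd_mul measurableT mU U1 Lr).
have Lrv : L2 P setT (fun w => V w * rho w) by exact: (L2_bdd_mul measurableT mV V1 Lr).
have [_ x1] := FM_indep tr rs sT (FM_M fU fr) mal (L2_int Lru) (L2_int La).
have [_ x2] := FM_indep tr rs sT (FM_M fV fr) mbe (L2_int Lrv) (L2_int Lb).
have i1 := L2_int_mul measurableT Lru La; have i2 := L2_int_mul measurableT Lrv Lb.
(* [U * rho] and [V * rho] are known at time r, while [al] and [be] are centred functions of the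
   increment: the first by the choice of c, the second by oddness. *)
have cross : \int[P]_w (rho w * Q w) = 0.
  rewrite (@eq_Rintegral _ _ _ P setT (fun w => U w * rho w * al w - V w * rho w * be w)); last by move=> w _; rewrite /Q; ring.
  by rewrite RintegralB// x1 x2 -/(al _) Eal Ebe !mulr0 subrr.
have QE : (sqn P setT Q <= (4 * q)%:E)%E.
  apply: le_trans (sqnB _ measurableT LUa.1 LVb.1) _.
  rewrite (@le_trans _ _ (2%:E * q%:E + 2%:E * (q / 4)%:E)%E)//; last first.
    rewrite -!EFinM -EFinD lee_fin; have : 0 <= q by rewrite mulr_ge0// sqr_ge0.
    lra.
  apply: leeD; apply: lee_wpmul2l => //.
    apply: le_trans hal; apply: sqn_le => //; [exact: LUa.1|exact: La.1|].
    by move=> w _; rewrite normrM ler_piMl.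
  apply: le_trans hbe; apply: sqn_le => //; [exact: LVb.1|exact: Lb.1|].
  by move=> w _; rewrite normrM ler_piMl.
apply: (@le_trans _ _ (sqn P setT rho + sqn P setT Q)%E); last first.
  by rewrite leeD2l// (le_trans QE)// /q mulrA.
rewrite !sqnE// -EFinD lee_fin.
have i3 := L2_int_sq Lr; have i4 := L2_int_sq LQ; have i5 := L2_int_mul measurableT Lr LQ.
rewrite [leLHS](@eq_Rintegral _ _ _ P setT (fun w => (c ^+ 2 * rho w ^+ 2 + Q w ^+ 2) + (2 * c) * (rho w * Q w))); last first.
  by move=> w _; rewrite /rho' -/(al w) -/(be w) -/(Q w); ring.
have i6 := integrableZl measurableT (c ^+ 2) i3.
have i7 := integrableZl measurableT (2 * c) i5.
rewrite RintegralD//; last exact: (integrableD measurableT i6 i4).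
rewrite RintegralD// !RintegralZl// cross mulr0 addr0 lerD2r ler_piMl//.
  by rewrite -lee_fin -sqnE// sqn_ge0.
by rewrite -[X in X <= _]ger0_norm ?sqr_ge0// normrX exprn_ile1.
Qed.

Lemma phase_step a b lam Theta : t <= a -> a <= b -> b <= T -> FM a Theta ->
  chaos (fun w => cos (Theta w)) -> chaos (fun w => cos (Theta w + lin lam (incr a b w))).
Proof.
move=> ta ab bT fTh [Lc hc].
have [K [K0 hK]] := one_step_error lam.
pose U j n w := cos (Theta w + lin lam (incr a (gp a b n j) w)).
pose V j n w := sin (Theta w + lin lam (incr a (gp a b n j) w)).
have tg n j : t <= gp a b n j by rewrite (le_trans ta)// gp_ge.
have gT n j : gp a b n j <= T by rewrite (le_trans (gp_le _ _ _ _)).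
have fA j n : FM (gp a b n j) (fun w => Theta w + lin lam (incr a (gp a b n j) w)).
  apply: FM_D; first by apply: FM_mono fTh; exact: gp_ge.
  by apply: lin_incr_FM => //; exact: gp_ge.
have fU j n : FM (gp a b n j) (U j n) by exact: FM_comp cos_meas (fA j n).
have fV j n : FM (gp a b n j) (V j n) by exact: FM_comp sin_meas (fA j n).
(* Invariant after j grid steps: a multiple of cos Theta, an elementary integral, and an error whose
   second moment grows by at most K / (n + 1)^2 per step. *)
have ind n j : exists k Z X rho, [/\ `|k| <= 1 /\ elem Z X, FM (gp a b n j) rho, L2 P setT rho,
    (sqn P setT rho <= (j%:R * (K * n.+1%:R^-1 ^+ 2))%:E)%E &
    forall w, U j n w = k * cos (Theta w) + X T w + rho w].
  elim: j => [|j [k [Z [X [rho [[k1 eX] fr Lr hr E]]]]]].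
    exists 1, (fun _ _ => 0), (fun _ _ => 0), (cst 0); split.
    - by rewrite normr1; split => //; exact: elem0.
    - exact: FM_cst.
    - exact: L2_cst.
    - rewrite mul0r /sqn; under eq_integral do rewrite /= expr0n/=.
      by rewrite integral0.
    - by move=> w; rewrite /U gp0// incr_self /lin big1 ?addr0 ?mul1r// => i _; rewrite mxE mulr0.
  have := hK (gp a b n j) (gp a b n j.+1) (U j n) (V j n) rho (tg n j) (gp_mono a b n j) (gT n j.+1)
    (fU j n) (fV j n) fr Lr (fun w => abs_cos_le1 _) (fun w => abs_sin_le1 _).
  set c := Rintegral _ _ _ => -[c1 [fr' Lr' hr']].
  set rho' := fun w => _ in fr' Lr' hr'.
  (* The linear term of the expansion is the integral of - V lam over one grid interval, and V is
     known at its left end. *)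
  have eS : elem (fun s w => \sum_i atomZ (gp a b n j) (gp a b n j.+1) i (fun w => - lam i * V j n w) s w)
                 (fun s w => \sum_i atomX (gp a b n j) (gp a b n j.+1) i (fun w => - lam i * V j n w) s w).
    apply: elem_sum => i; apply: (@elem_atom _ _ _ _ `|lam i|) => //; [exact: gp_mono| |].
      by apply: FM_M => //; exact: FM_cst.
    by move=> w; rewrite normrM normrN ler_piMr// abs_sin_le1.
  exists (c * k); move: (elem_add (elem_scale c eX) eS).
  set Zn := (fun s w => c *: Z s w + _); set Xn := (fun s w => c * X s w + _) => eN; exists Zn, Xn, rho'; split; last 1 first.
  - move=> w; have EU : U j.+1 n w = U j n w * cos (lin lam (incr (gp a b n j) (gp a b n j.+1) w))
       - V j n w * sin (lin lam (incr (gp a b n j) (gp a b n j.+1) w)).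
      rewrite /U /V -cosD -addrA; congr (cos (_ + _)).
      rewrite /lin -big_split/=; apply: eq_bigr => i _; rewrite -mulrDr; congr (_ * _).
      exact: incrD.
    rewrite EU /rho'.
    have -> : Xn T w =
      c * X T w - V j n w * lin lam (incr (gp a b n j) (gp a b n j.+1) w).
      rewrite /Xn /lin mulr_sumr -sumrN; congr (_ + _); apply: eq_bigr => i _.
      by rewrite /atomX !(min_r (gT _ _)); ring.
    by rewrite E -/c; ring.
  - by rewrite normrM mulr_ile1//; split.
  - exact: fr'.
  - exact: Lr'.
  - apply: (le_trans hr'); rewrite -natr1 mulrDl mul1r EFinD; apply: leeD => //.
    rewrite lee_fin ler_wpM2l// lerXn2r ?nnegrE ?invr_ge0//; last exact: gp_step.
    by rewrite subr_ge0 gp_mono.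
have LA : L2 P setT (fun w => cos (Theta w + lin lam (incr a b w))).
  apply: (@L2_bdd _ _ _ _ _ measurableT _ 1) => [||w].
  - exact: prob_fin.
  - apply: (FM_meas bT); apply: (FM_comp cos_meas); apply: FM_D; first exact: FM_mono fTh.
    exact: lin_incr_FM.
  - exact: abs_cos_le1.
apply: chaos_closed => // e e0.
have c0 : (fun n => ((gnum a b n)%:R * (K * n.+1%:R^-1 ^+ 2))%:E) @ \oo --> 0%E.
  (* There are at most (b - a)(n + 1) + 1 steps, hence a total error of at most (b - a + 1) K / (n +
     1). *)
  apply: (@cvg0_harmonic R _ ((b - a + 1) * K)) => n.
    by rewrite lee_fin mulr_ge0// mulr_ge0// sqr_ge0.
  rewrite lee_fin expr2 !mulrA ler_wpM2r ?invr_ge0// mulrAC ler_wpM2r//.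
  rewrite /gnum -natr1 mulrDl mul1r lerD//; last by rewrite invf_le1// ler1n.
  by have /andP[h _] := gidx_itv n ab; rewrite lerBrDl.
have [n _ /(_ n (leqnn n)) hn] := cvg0_le c0 e0.
have [k [Z [X [rho [[k1 eX] fr Lr hr E]]]]] := ind n (gnum a b n).
exists (fun w => k * cos (Theta w) + X T w); split.
  apply: chaos_add; first by apply: chaos_scale; split.
  split; first exact: elem_L2 eX tT.
  move=> e' e'0; exists 0, Z, X; split => //.
  rewrite (@sqn_eq _ _ _ P setT _ (cst 0)); last by move=> w _; rewrite /= add0r subrr.
  by rewrite /sqn; under eq_integral do rewrite expr0n/=; rewrite integral0 lee_fin ltW.
rewrite (@sqn_eq _ _ _ P setT _ rho); first exact: le_trans hr hn.
by move=> w _; have := E w; rewrite /U gp_last// => ->; ring.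
Qed.


Local Notation ptype := (R * {ffun 'I_m -> R})%type.

Definition phase (L : seq ptype) (w : Om) : R := \sum_(x <- L) lin x.2 (Wt x.1 w).
Definition in_time (L : seq ptype) := all (fun x => t <= x.1 <= T) L.

Lemma lin_Wt_FM lam u s : t <= u -> u <= s -> FM s (fun w => lin lam (Wt u w)).
Proof.
move=> tu us; rewrite /lin; apply: measurable_sum => i.
by apply: FM_M; [exact: FM_cst|exact: Wt_FM].
Qed.

Lemma phase_FM L s : all (fun x : ptype => t <= x.1 <= s) L -> FM s (phase L).
Proof.
rewrite /phase; elim: L => [_|x L IH /andP[/andP[h1 h2] h3]].
  by rewrite [X in FM s X](_ : _ = cst 0); [exact: FM_cst|apply/funext => w; rewrite big_nil].
under eq_fun do rewrite big_cons.
by apply: FM_D; [exact: lin_Wt_FM|exact: IH].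
Qed.

Lemma linB lam x y : lin lam (x - y) = lin lam x - lin lam y.
Proof. by rewrite /lin -sumrB; apply: eq_bigr => i _; rewrite !mxE mulrBr. Qed.

Local Notation later := (fun x y : ptype => y.1 <= x.1).

(** The latest time comes first: lam.W_u is lam.(W_u - W_u') plus lam.W_u', and the second term
    merges with the coefficient at the next time u'. What remains is known at u', so [phase_step]
    can add the last increment. The induction ends with an increment from time t, where [Wt]
    vanishes. *)
Lemma phase_sorted_chaos L u (lam : {ffun 'I_m -> R}) theta : path later (u, lam) L -> in_time ((u, lam) :: L) ->
  chaos (fun w => cos (theta + phase ((u, lam) :: L) w)).
Proof.
have tr : transitive later by move=> x y z /= h1 h2; exact: le_trans h2 h1.
elim: L u lam theta => [|[u' lam'] L IH] u lam theta.
  move=> _ /=; rewrite /in_time/= => /andP[/andP[tu uT] _].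
  have := @phase_step t u lam (cst theta) (lexx t) tu uT (@FM_cst t theta) (chaos_cst (cos theta)).
  congr chaos; apply/funext => w; rewrite /phase big_seq1/= /incr linB Wt_start.
  by rewrite [lin _ 0]big1 ?subr0// => i _; rewrite mxE mulr0.
rewrite /in_time /= => /andP[u'u pL] /and3P[/andP[tu uT] /andP[tu' u'T] tL].
pose mu : {ffun 'I_m -> R} := [ffun i => lam i + lam' i].
have pm : path later (u', mu) L by move: pL; rewrite !path_sortedE.
have im : in_time ((u', mu) :: L) by rewrite /in_time /= tu' u'T.
have h := IH u' mu theta pm im.
have fp : FM u' (fun w => theta + phase ((u', mu) :: L) w).
  apply: FM_D; first exact: FM_cst.
  apply: phase_FM; rewrite /= tu' lexx/=.
  have /allP h2 := order_path_min tr pL; move/allP: tL => h1.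
  apply/allP => x xL /=; have /andP[-> _] := h1 x xL; exact: h2.
have := @phase_step u' u lam _ tu' u'u uT fp h; congr chaos; apply/funext => w.
rewrite /phase !big_cons/= /incr linB; congr cos.
rewrite (_ : lin mu (Wt u' w) = lin lam (Wt u' w) + lin lam' (Wt u' w)); first by ring.
by rewrite /lin -big_split; apply: eq_bigr => i _; rewrite ffunE mulrDl.
Qed.

Lemma phase_chaos L theta : in_time L -> chaos (fun w => cos (theta + phase L w)).
Proof.
move=> iL; pose L' := sort later L.
have pL : perm_eq L' L by rewrite perm_sort.
have E w : phase L w = phase L' w by rewrite /phase (perm_big _ pL).
have iL' : in_time L' by rewrite /in_time (perm_all _ pL).
have sL : sorted later L' by apply: sort_sorted => x y; exact: le_total.
under eq_fun do rewrite E.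
case: L' iL' sL {E pL} => [_ _|[u lam] L' iL' sL]; last exact: phase_sorted_chaos.
by have := chaos_cst (cos theta); congr chaos; apply/funext => w; rewrite /phase big_nil addr0.
Qed.

(* Products reduce to sums, so trigonometric polynomials in the values of W form
   an algebra. *)
Inductive trig : (Om -> R) -> Prop :=
| trig_cos L theta : in_time L -> trig (fun w => cos (theta + phase L w))
| trig_add f g : trig f -> trig g -> trig (fun w => f w + g w)
| trig_scale k f : trig f -> trig (fun w => k * f w).

Lemma trig_chaos f : trig f -> chaos f.
Proof.
elim => [L theta|f1 g1 _ h1 _ h2|k f1 _ h1]; [exact: phase_chaos|exact: chaos_add|exact: chaos_scale].
Qed.

Lemma trig_cst c : trig (cst c).
Proof.
have := trig_scale c (@trig_cos [::] 0 isT); congr trig; apply/funext => w.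
by rewrite /phase big_nil addr0 cos0 mulr1.
Qed.

Definition phase_opp (L : seq ptype) : seq ptype := [seq (x.1, [ffun i : 'I_m => - x.2 i]) | x : ptype <- L].

Lemma phase_oppE L w : phase (phase_opp L) w = - phase L w.
Proof.
rewrite /phase big_map -sumrN; apply: eq_bigr => x _.
by rewrite /lin -sumrN; apply: eq_bigr => i _; rewrite ffunE mulNr.
Qed.

Lemma phase_cat L L' w : phase (L ++ L') w = phase L w + phase L' w.
Proof. by rewrite /phase big_cat. Qed.

Lemma trig_mul f g : trig f -> trig g -> trig (fun w => f w * g w).
Proof.
move=> tf tg; elim: tf => [L th iL|f1 f2 _ h1 _ h2|k f1 _ h1]; last 2 first.
- by have := trig_add h1 h2; congr trig; apply/funext => w; rewrite mulrDl.
- by have := trig_scale k h1; congr trig; apply/funext => w; rewrite mulrA.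
elim: tg => [L' th' iL'|f1 f2 _ h1 _ h2|k f1 _ h1]; last 2 first.
- by have := trig_add h1 h2; congr trig; apply/funext => w; rewrite mulrDr.
- by have := trig_scale k h1; congr trig; apply/funext => w; rewrite mulrCA.
have i1 : in_time (L ++ L') by rewrite /in_time all_cat; apply/andP.
have i2 : in_time (L ++ phase_opp L') by rewrite /in_time all_cat; apply/andP; split => //; rewrite all_map.
have := trig_scale (2^-1) (trig_add (trig_cos (th + th') i1) (trig_cos (th - th') i2)).
congr trig; apply/funext => w; rewrite !phase_cat phase_oppE.
rewrite (_ : th + th' + (phase L w + phase L' w) = (th + phase L w) + (th' + phase L' w)); last by ring.
rewrite (_ : th - th' + (phase L w - phase L' w) = (th + phase L w) - (th' + phase L' w)); last by ring.
by rewrite cosD cosB; field.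
Qed.

Lemma trig_smoothstep n f : trig f -> trig (fun w => iter n (@smoothstep R) (f w)).
Proof.
move=> tf; elim: n => //= n IH.
have := trig_add (trig_scale (3 / 2) IH) (trig_scale (- 2^-1) (trig_mul IH (trig_mul IH IH))).
by congr trig; apply/funext => w; rewrite /smoothstep; field.
Qed.

(** * Indicators of rectangles and the monotone class argument *)

Local Notation ctype := (R * 'I_m * R)%type.

(* Approximates the indicator of {q.2 < W_(q.1.1)^(q.1.2)} as n, then k, tends
   to infinity. *)
Definition soft_ind (k n : nat) (q : ctype) (w : Om) : R :=
  (1 + iter n (@smoothstep R) (sin ((Wt q.1.1 w ord0 q.1.2 - q.2 - k.+1%:R^-1) / k.+1%:R))) / 2.

Lemma soft_ind_trig k n q : t <= q.1.1 <= T -> trig (soft_ind k n q).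
Proof.
case: q => [[u i] c] /= hu.
pose L : seq ptype := [:: (u, [ffun j => (j == i)%:R / k.+1%:R])].
have iL : in_time L by rewrite /in_time /= hu.
(* The shift of the constant phase expresses sin x as cos (x - pi / 2). *)
have := trig_cos ((- c - k.+1%:R^-1) / k.+1%:R - pi / 2) iL.
move=> /(trig_smoothstep n) /(trig_scale (2^-1)) /(trig_add (trig_cst (2^-1))).
congr trig; apply/funext => w; rewrite /soft_ind /= [RHS]mulrC mulrDr mulr1; congr (_ + _ * iter n _ _).
rewrite addrAC cosBpihalf /phase big_seq1 /lin (bigD1 i)//= big1 ?addr0; last first.
  by move=> j /negbTE ji; rewrite ffunE ji !mul0r.
by rewrite ffunE eqxx mul1r; congr sin; field.
Qed.

Lemma soft_ind_le1 k n q w : `|soft_ind k n q w| <= 1.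
Proof.
have := smoothstep_iter_le n (abs_sin_le1 ((Wt q.1.1 w ord0 q.1.2 - q.2 - k.+1%:R^-1) / k.+1%:R)).
by rewrite /soft_ind !ler_norml; lra.
Qed.

(** Finite intersections of open half-line conditions: a pi-system, and the half-lines generate the
    Borel sets of the line. *)
Definition rects : set (set Om) := [set A | exists Q : seq ctype,
  all (fun q => t <= q.1.1 <= T) Q /\ A = [set w | all (fun q => q.2 < Wt q.1.1 w ord0 q.1.2) Q]].

Lemma trig_prod (Q : seq ctype) k n : all (fun q => t <= q.1.1 <= T) Q ->
  trig (fun w => \prod_(q <- Q) soft_ind k n q w).
Proof.
elim: Q => [_|q Q IH /andP[h1 h2]].
  by have := trig_cst 1; congr trig; apply/funext => w; rewrite big_nil.
by have := trig_mul (soft_ind_trig k n h1) (IH h2); congr trig; apply/funext => w; rewrite big_cons.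
Qed.

(** The limit in n replaces the smooth steps by signs, the limit in k turns the signs into strict
    inequalities; all products stay bounded by 1, which dominates both limits. *)
Lemma rects_chaos A : rects A -> chaos \1_A.
Proof.
move=> [Q [hQ ->]].
pose g k w := \prod_(q <- Q) ((1 + Num.sg (sin ((Wt q.1.1 w ord0 q.1.2 - q.2 - k.+1%:R^-1) / k.+1%:R))) / 2).
have cg k w : (fun n => \prod_(q <- Q) soft_ind k n q w) @ \oo --> g k w.
  apply: cvg_prod_seq => q; apply: cvgMl; apply: cvgD; first exact: cvg_cst.
  by apply: smoothstep_iter_cvg; exact: abs_sin_le1.
have ck k : chaos (g k).
  apply: (@chaos_dct (fun n w => \prod_(q <- Q) soft_ind k n q w) _ (cst 1)).
  - by move=> n; apply: trig_chaos; exact: trig_prod.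
  - apply: (@measurable_fun_cvg _ _ R setT (fun n w => \prod_(q <- Q) soft_ind k n q w)) => //.
    by move=> n; have [[]] := trig_chaos (trig_prod k n hQ).
  - exact: L2_cst.
  - by apply: aeW => w; exact: cg.
  - by move=> n w; apply: prod_seq_le1 => q; exact: soft_ind_le1.
have cc w : (fun k => g k w) @ \oo --> (\1_[set w | all (fun q => q.2 < Wt q.1.1 w ord0 q.1.2) Q] w : R).
  rewrite (_ : \1_ _ w = \prod_(q <- Q) (0 < Wt q.1.1 w ord0 q.1.2 - q.2)%R%:R).
    by apply: cvg_prod_seq => q; exact: sg_sin_cvg.
  rewrite indicE; under eq_bigr do rewrite subr_gt0.
  rewrite (_ : (w \in _) = all (fun q => q.2 < Wt q.1.1 w ord0 q.1.2) Q); last first.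
    by apply/idP/idP; rewrite inE.
  by elim: (Q) => [|q Q' IH] /=; rewrite ?big_nil// big_cons -IH -mulnb natrM.
apply: (@chaos_dct g _ (cst 1)) => //.
- apply: (@measurable_fun_cvg _ Om R setT g); last by move=> w _; apply: cc.
  by move=> k; have [[]] := ck k.
- exact: L2_cst.
- by apply: aeW => w; exact: cc.
- move=> k w; apply: prod_seq_le1 => q.
  by set z := sin _; case: (sgrP z) => _; rewrite ler_norml; lra.
Qed.

Lemma rects_setI : setI_closed rects.
Proof.
move=> A B [Q [hQ ->]] [Q' [hQ' ->]]; exists (Q ++ Q'); split; first by rewrite all_cat hQ.
by apply/seteqP; split => w /=; rewrite all_cat => /andP.
Qed.

Lemma chaos_indic_meas A : chaos \1_A -> measurable A.
Proof. by move=> [[h _] _]; apply/(measurable_indicP R). Qed.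

Lemma sigma_rects_chaos A : <<s rects >> A -> chaos \1_A.
Proof.
apply: (@dynkin_induction _ (g_sigma_algebraType rects) rects (fun A => chaos \1_A)) => //.
- exact: rects_setI.
- by have := chaos_cst 1; congr chaos; apply/funext => w; rewrite indicT.
- exact: rects_chaos.
- move=> S _ vS; have := chaos_add (chaos_cst 1) (chaos_scale (-1) vS).
  congr chaos; apply/funext => w; rewrite !indicE in_setC /=.
  by case: (w \in S) => /=; ring.
move=> F mF tF vF.
have mU : measurable (\bigcup_k F k : set Om) by apply: bigcup_measurable => k _; exact: chaos_indic_meas.
(* Disjointness makes the partial sums indicators, hence bounded by 1, and provides the
   domination. *)
have E n w : \sum_(k < n) (\1_(F k) w : R) = if `[< exists2 k, (k < n)%N & F k w >] then 1 else 0.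
  case: asboolP => [[k kn Fk]|h].
    rewrite (bigD1 (Ordinal kn))//= big1 ?addr0 ?indicE ?mem_set// => i /eqP ik.
    rewrite indicE memNset// => Fi; apply: ik; apply: val_inj => /=.
    by apply: (tF i k) => //; exists w.
  by rewrite big1// => k _; rewrite indicE memNset// => Fk; apply: h; exists k.
apply: (@chaos_dct (fun n w => \sum_(k < n) (\1_(F k) w : R)) _ (cst 1)).
- by move=> n; exact: chaos_sum.
- exact: measurable_indic.
- exact: L2_cst.
- apply: aeW => w; rewrite indicE; case: (boolP (w \in _)) => [|]; last first.
    rewrite notin_setE => h; apply: cvg_near_cst; apply: nearW => n; rewrite E.
    by case: asboolP => // -[k _ Fk]; exfalso; apply: h; exists k.
  rewrite inE => -[k _ Fk]; apply: cvg_near_cst; exists k.+1 => // n /= kn; rewrite E.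
  by case: asboolP => // h; exfalso; apply: h; exists k.
- by move=> n w; rewrite E; case: ifP => _; rewrite ?normr0 ?normr1.
Qed.

(** Removing the null sets and replacing [W] by [Wt] almost surely leaves the sigma-algebra
    generated by half-line conditions. *)
Lemma Fs_rects (A : set Om) : measurable (A : set (Fs T)) ->
  exists A', <<s rects >> A' /\ {ae P, forall w, A w <-> A' w}.
Proof.
move: A; apply: (g_sigma_sub (ae_sigma_algebra P rects)) => A [[u [i [B [Du mB ->]]]]|nA]; last first.
  exists set0; split; first exact: sigma_algebra0.
  by apply: filterS (negligible_ae nA) => w nw; split.
exists [set w | B (Wt u w ord0 i)]; split; last by apply: filterS Wt_ae => w hw /=; rewrite hw.
have : measurable_fun [set: g_sigma_algebraType rects]
    ((fun w => Wt u w ord0 i) : g_sigma_algebraType rects -> measurableTypeR R).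
  apply: (measurability _ (RGenOInfty.measurableE R)) => _ [_ [c ->] <-].
  rewrite setTI; apply: sub_sigma_algebra; exists [:: (u, i, c)]; split.
    by move: Du; rewrite /= in_itv/= => ->.
  by apply/seteqP; split => w /=; rewrite in_itv/= ?andbT.
move=> /(_ measurableT B mB); rewrite setTI; exact.
Qed.

Lemma Fs_chaos (A : set Om) : measurable (A : set (Fs T)) -> chaos \1_A.
Proof.
move=> mA; have [A' [sA' AA']] := Fs_rects mA.
apply: chaos_ae (sigma_rects_chaos sA') _ _.
  by apply: measurable_indic; exact: Fs_sub mA.
apply: filterS AA' => w h; rewrite !indicE; congr (_%:R).
by congr nat_of_bool; apply/idP/idP; rewrite !inE => /h.
Qed.

Import HBNNSimple.

(** Simple functions measurable for F_T increase to [eta] and are dominated by it. *)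
Lemma ge0_chaos eta : FM T eta -> L2 P setT eta -> (forall w, 0 <= eta w) -> chaos eta.
Proof.
move=> fe Le e0.
have mE : measurable_fun [set: Fs T] (EFin \o eta) by exact/measurable_EFinP.
pose f := nnsfun_approx (@measurableT _ (Fs T)) mE.
have cf (w : Om) : (fun n => f n w) @ \oo --> eta w.
  have := @cvg_nnsfun_approx _ (Fs T) R setT measurableT _ mE (fun w _ => e0 w) w Logic.I.
  by move=> /fine_cvg.
apply: (@chaos_dct (fun n (w : Om) => f n w) _ eta) => //.
- move=> n; rewrite (_ : (fun w => _) = fun w => \sum_(y <- finmap.enum_fset (fset_set (range (f n)))) y * \1_(f n @^-1` [set y]) w).
    apply: chaos_sum => y; apply: chaos_scale; apply: Fs_chaos.
    exact: (measurable_funPTI (f n)).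
  by apply/funext => w; rewrite fimfunE fsbig_finite//; exact: fimfunP.
- by case: Le.
- by apply: aeW => w; exact: cf.
- move=> n w; rewrite ger0_norm//.
  have nd : nondecreasing_seq (fun n => f n w).
    by move=> a b ab; have /lefP := @nd_nnsfun_approx _ (Fs T) R setT measurableT _ mE a b ab; exact.
  have := nondecreasing_cvgn_le nd (cvgP _ (cf w)) n.
  by rewrite (cvg_lim _ (cf w)).
Qed.

Lemma chaos_full eta : FM T eta -> L2 P setT eta -> chaos eta.
Proof.
move=> fe Le.
have part (f : Om -> R) : FM T f -> L2 P setT f -> chaos (fun w => Num.max (f w) 0).
  move=> ff Lf.
  have fm : FM T (fun w => Num.max (f w) 0) by apply: measurable_maxr => //; exact: FM_cst.
  apply: ge0_chaos => //; last by move=> w; rewrite le_max lexx orbT.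
  apply: (@L2_le _ _ _ _ _ measurableT _ f) => //; first exact: FM_meas (lexx T) fm.
  by move=> w _; rewrite /Num.max; case: ifP => h; rewrite ?normr0.
have fN : FM T (fun w => - eta w).
  by have := FM_M (@FM_cst T (-1)) fe; congr measurable_fun; apply/funext => w; rewrite mulN1r.
have LN : L2 P setT (fun w => - eta w) by exact: L2N.
have := chaos_add (part _ fe Le) (chaos_scale (-1) (part _ fN LN)).
congr chaos; apply/funext => w; rewrite mulN1r.
by have [h1|h1] := leP (eta w) 0; have [h2|h2] := leP (- eta w) 0; lra.
Qed.


(** * The representing integrand *)

Lemma chaos_centered eta (e : R) : chaos eta -> 0 < e -> exists Z X, elem Z X /\
  (sqn P setT (fun w => X T w - (eta w - \int[P]_x eta x))%R <= e%:E)%E.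
Proof.
move=> [Le h] e0; have [c [Z [X [eX hX]]]] := h _ e0; exists Z, X; split => //.
have LX := elem_affine_L2 c eX; have LY := L2B measurableT Le LX; have LX0 := elem_L2 eX tT.
(* Subtracting the mean does not increase the L2 norm, and the elementary integral is centred, so
   the free constant becomes the mean of [eta]. *)
apply: le_trans hX; apply: le_trans (variance_le LY).
rewrite -sqnN (@sqn_eq _ _ _ P setT _ (fun w => eta w - (c + X T w) - \int[P]_x (eta x - (c + X T x))))// => w _.
have -> : \int[P]_x (eta x - (c + X T x)) = \int[P]_x eta x - c.
  rewrite RintegralB//; [|exact: L2_int|exact: L2_int].
  rewrite RintegralD//; [|exact: L2_int (L2_cst c)|exact: L2_int].
  by rewrite (Rintegral_prob_cst c) (elem_mean0 eX) addr0.
by ring.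
Qed.

Lemma cprocB A B j p : cproc (fun s w => A s w - B s w) j p = cproc A j p - cproc B j p.
Proof. by rewrite /cproc !mxE. Qed.

Lemma cvg_geo8 (K : R) : (fun n => K / 8 ^+ n) @ \oo --> (0 : R).
Proof.
have := @cvg_geometric R K (8^-1); rewrite ger0_norm// invf_lt1 ?ltr1n// => /(_ isT).
by rewrite /geometric/=; under eq_fun do rewrite exprVn.
Qed.

(** By the isometry, the integrands of approximations converging at speed 8^-n form a Cauchy
    sequence in H^2; Fatou turns their mutual distances into distances to the limit. *)
Lemma representation eta : FM T eta -> L2 P setT eta -> exists Z,
  [/\ pv Z, (nZ Z < +oo)%E & ito_lim Z T (fun w => eta w - \int[P]_x eta x)].
Proof.
move=> fe Le; have ve := chaos_full fe Le.
set c := Rintegral _ _ _; pose zeta w := eta w - c.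
have Lz : L2 P setT zeta by apply: L2B => //; exact: L2_cst.
have /choice[ZX hZX] : forall n, exists p : (R -> Om -> 'rV[R]_m) * (R -> Om -> R),
    elem p.1 p.2 /\ (sqn P setT (fun w => p.2 T w - zeta w)%R <= (1 / 8 ^+ n)%:E)%E.
  move=> n; have : 0 < 1 / 8 ^+ n :> R by rewrite divr_gt0// exprn_gt0.
  by move=> /(chaos_centered ve)[Z' [X' [h1 h2]]]; exists (Z', X').
pose Zn n := (ZX n).1; pose Xn n := (ZX n).2.
have en n : elem (Zn n) (Xn n) by case: (hZX n).
have xn n : (sqn P setT (fun w => Xn n T w - zeta w)%R <= (1 / 8 ^+ n)%:E)%E by case: (hZX n).
have pZn n : pv (Zn n) by exact: elem_prog (en n).
have LXn n : L2 P setT (Xn n T) by exact: elem_L2 (en n) tT.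
have dn n k : (n <= k)%N -> (nZ (fun s w => Zn n s w - Zn k s w)%R <= (4 / 8 ^+ n)%:E)%E.
  move=> nk; have es := elem_sub (en n) (en k); rewrite -(isometry es).
  rewrite (@sqn_eq _ _ _ P setT _ (fun w => (Xn n T w - zeta w) - (Xn k T w - zeta w))); last by move=> w _; ring.
  apply: le_trans (sqnB _ measurableT (L2B measurableT (LXn n) Lz).1 (L2B measurableT (LXn k) Lz).1) _.
  apply: (@le_trans _ _ (2%:E * (1 / 8 ^+ n)%:E + 2%:E * (1 / 8 ^+ n)%:E)%E).
    apply: leeD; apply: lee_wpmul2l => //; apply: (le_trans (xn k)).
    by rewrite lee_fin ler_wpM2l// lef_pV2 ?posrE ?exprn_gt0// ler_weXn2l// ler1n.
  by rewrite -!EFinM -EFinD lee_fin; lra.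
(* The upper limit exists everywhere and is measurable on each strip, so Z is progressive without
   any correction; almost everywhere it is a true limit, and [fine] sends infinite values to 0. *)
pose Z s w : 'rV[R]_m := \row_j fine (limn_esup (fun n => (Zn n s w ord0 j)%:E)).
have pZ : pv Z.
  move=> j s hs; rewrite (_ : (fun p => _) = fine \o (fun p : R * Fs s => limn_esup (fun n => (Zn n p.1 p.2 ord0 j)%:E))); last first.
    by apply/funext => p; rewrite /= mxE.
  apply: measurableT_comp; first exact: fine_measurable.
  apply: measurable_fun_limn_esup => n; apply/measurable_EFinP; exact: (pZn n j s hs).
have cvgj j : {ae mu2, forall p, DT p -> (fun n => cproc (Zn n) j p) @ \oo --> cproc Z j p}.
  have h1 n : (sqn mu2 DT (fun p => (cproc (Zn n.+1) j p - cproc (Zn n) j p)%R) <= (4 / 8 ^+ n)%:E)%E.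
    apply: le_trans (dn n n.+1 (leqnSn n)); rewrite -sqnN.
    rewrite (@sqn_eq _ _ _ mu2 DT _ (cproc (fun s w => Zn n s w - Zn n.+1 s w) j)).
      by rewrite /nZ (bigD1 j)//= leeDl// sume_ge0// => i _; exact: sqn_ge0.
    by move=> p _; rewrite /cproc !mxE opprB.
  have h2 n : measurable_fun DT (fun p => cproc (Zn n.+1) j p - cproc (Zn n) j p).
    by apply: measurable_funB; exact: cproc_meas.
  apply: filterS (ae_fast_decay mDT h2 h1) => p h Dp; have [K hK] := h Dp.
  have [cv _] := @fast_decay_cvg R (fun n => cproc (Zn n) j p) K hK.
  rewrite {2}/cproc /Z mxE.
  have ce : (fun n => (cproc (Zn n) j p)%:E) @ \oo --> (limn (fun n => cproc (Zn n) j p))%:E.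
    by apply: cvg_EFin => //; exact: nearW.
  by rewrite (cvg_limn_einf_sup ce).2/=; exact: cv.
have lim n : (nZ (fun s w => Zn n s w - Z s w)%R <= (m%:R * (4 / 8 ^+ n))%:E)%E.
  rewrite /nZ (@le_trans _ _ (\sum_(j < m) (4 / 8 ^+ n)%:E)%E)//; last first.
    by rewrite sumEFin lee_fin sumr_const card_ord -[X in X <= _]mulr_natl.
  apply: lee_sum => j _.
  rewrite (@sqn_eq _ _ _ mu2 DT _ (fun p => cproc (Zn n) j p - cproc Z j p)); last by move=> p _; rewrite cprocB.
  apply: (@sqn_fatou _ _ _ mu2 DT mDT (fun k p => cproc (Zn n) j p - cproc (Zn k) j p)).
  - by move=> k; apply: measurable_funB; exact: cproc_meas.
  - by apply: measurable_funB; exact: cproc_meas.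
  - by apply: filterS (cvgj j) => p h Dp; apply: cvgB; [exact: cvg_cst|exact: h].
  - exists n => // k /= nk; apply: le_trans (dn n k nk).
    rewrite (@sqn_eq _ _ _ mu2 DT _ (cproc (fun s w => Zn n s w - Zn k s w) j)).
      by rewrite /nZ (bigD1 j)//= leeDl// sume_ge0// => i _; exact: sqn_ge0.
    by move=> p _; rewrite cprocB.
have fin0 : (nZ (Zn 0%N) < +oo)%E.
  by rewrite -(isometry (en 0%N)); case: (LXn 0%N).
exists Z; split => //.
  have := nZ_triB (pZn 0%N) (pv_sub (pZn 0%N) pZ).
  rewrite (_ : (fun s w => Zn 0%N s w - (Zn 0%N s w - Z s w)) = Z); last first.
    by apply/funext => s; apply/funext => w; rewrite opprB addrC subrK.
  move=> /le_lt_trans; apply; rewrite (nZ_fin fin0) (nZ_fin (le_lt_trans (lim 0%N) (ltry _))).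
  by rewrite -!EFinM -EFinD ltry.
split; first by case: Lz.
(* The factor m + 1 makes one sequence dominate both error bounds, 4 m / 8^n and 1 / 8^n. *)
move=> e e0; have c1 : (fun n => ((m.+1%:R * 4) / 8 ^+ n : R)%:E) @ \oo --> (0%E : \bar R).
  by apply: cvg_EFin; [exact: nearW|exact: cvg_geo8].
have [n _ /(_ n (leqnn n)) hn] := cvg0_le c1 e0.
have p0 : 0 <= (8 ^+ n)^-1 :> R by rewrite invr_ge0 exprn_ge0.
exists (Zn n), (Xn n); split => //.
  apply: (le_trans (lim n)); apply: le_trans hn; rewrite lee_fin mulrA ler_wpM2r//.
  by rewrite ler_wpM2r// ler_nat.
apply: (le_trans (xn n)); apply: le_trans hn; rewrite lee_fin ler_wpM2r//.
by rewrite -natrM ler1n.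
Qed.


Lemma ito_lim_sub Z Z' J J' : pv Z -> pv Z' -> ito_lim Z T J -> ito_lim Z' T J' ->
  ito_lim (fun s w => Z s w - Z' s w) T (fun w => J w - J' w).
Proof.
move=> pZ pZ' [mJ hJ] [mJ' hJ']; split; first exact: measurable_funB.
move=> e e0; have e4 : 0 < e / 4 by rewrite divr_gt0.
have [A [X [eA A1 A2]]] := hJ _ e4; have [B [Y [eB B1 B2]]] := hJ' _ e4.
eexists; eexists; split; first exact: (elem_sub eA eB).
  rewrite (_ : (fun s w => _) = fun s w => (A s w - Z s w) - (B s w - Z' s w)); last first.
    by apply/funext => s; apply/funext => w; apply/rowP => i; rewrite !mxE; ring.
  apply: (le_trans (nZ_triB (pv_sub (elem_prog eA) pZ) (pv_sub (elem_prog eB) pZ'))).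
  exact: sqn_lt_half.
rewrite (@sqn_eq _ _ _ P setT _ (fun w => (X T w - J w) - (Y T w - J' w))); last by move=> w _; ring.
have mX := (elem_L2 eA tT).1; have mY := (elem_L2 eB tT).1.
apply: le_trans (sqnB _ measurableT (measurable_funB mX mJ) (measurable_funB mY mJ')) _.
exact: sqn_lt_half.
Qed.

(** * The equation *)

Section bsde.
Variables (xi : Om -> R) (f : R -> Om -> R).
Hypotheses (xi_L2 : L2_F P t W T xi) (f_H2 : H2 P t T W f).
Local Notation leb := (@lebesgue_measure R).

(* [Aint s] is int_t^s f, set to 0 on the null set where f is not in L2(dt). *)
Definition f_sq w := sqn leb (Ib t T) (f ^~ w).
Definition Aint (s : R) (w : Om) : R :=
  if `[< (f_sq w < +oo)%E >] then Rintegral leb (Ib t s) (f ^~ w) else 0.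
Definition Aabs (w : Om) : R :=
  if `[< (f_sq w < +oo)%E >] then Rintegral leb (Ib t T) (fun s => `|f s w|) else 0.

Lemma f_strip : measurable_fun DT (fun p : measurableTypeR R * Om => f p.1 p.2).
Proof. by apply: prog_meas; case: f_H2. Qed.

Lemma f_sq_meas : measurable_fun setT f_sq.
Proof. exact: (mu2_fubini f_strip).2. Qed.

Lemma f_sq_ae : {ae P, forall w, (f_sq w < +oo)%E}.
Proof.
have i : P.-integrable setT f_sq.
  apply/integrableP; split; first exact: f_sq_meas.
  under eq_integral do rewrite gee0_abs ?sqn_ge0//.
  by case: f_H2.
have := integrable_ae measurableT i; apply: filterS => w /(_ Logic.I).
by rewrite ge0_fin_numE// sqn_ge0.
Qed.

Lemma f_L2 w : (f_sq w < +oo)%E -> L2 leb (Ib t T) (f ^~ w).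
Proof. by move=> h; split => //; apply: prog_section; case: f_H2. Qed.

Lemma f_abs_L2 w : (f_sq w < +oo)%E -> L2 leb (Ib t T) (fun s => `|f s w|).
Proof.
move=> /f_L2 h; apply: (@L2_le _ _ _ _ _ (mIb t T) _ (f ^~ w)) => //.
  by apply: measurableT_comp h.1; exact: normr_measurable.
by move=> s _; rewrite normr_id.
Qed.

Lemma Aint_FM s : t <= s <= T -> FM s (Aint s).
Proof.
move=> /andP[ts sT]; have [pf _] := f_H2.
apply: (FM_ae (prog_Rint pf (lexx t) sT ts)).
by apply: filterS f_sq_ae => w h; rewrite /Aint asboolT.
Qed.

Lemma Aint_cont w : continuous (fun s => Aint (clamp t T s) w).
Proof.
rewrite /Aint; case: asboolP => h; last exact: cst_continuous.
have c := parameterized_integral_continuous tT (L2_Ib_integrable (f_L2 h)).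
exact: (within_clamp tT c).
Qed.

Lemma Aabs_ge0 w : 0 <= Aabs w.
Proof. by rewrite /Aabs; case: asboolP => // _; apply: Rintegral_ge0. Qed.

Lemma Aint_le s w : t <= s <= T -> `|Aint s w| <= Aabs w.
Proof.
move=> /andP[ts sT]; rewrite /Aint /Aabs; case: asboolP => [h|_]; last by rewrite normr0.
have sub : Ib t s `<=` Ib t T.
  by move=> u; rewrite /= !in_itv/= => /andP[-> /le_trans ->].
have i1 := L2_Ib_integrable (f_L2 h); have i2 := L2_Ib_integrable (f_abs_L2 h).
have i1' := integrableS (mIb t T) (mIb t s) sub i1.
have i2' := integrableS (mIb t T) (mIb t s) sub i2.
apply: (le_trans (le_normr_Rintegral (mIb t s) i1')).
rewrite /Rintegral fine_le//.
- exact: (integrable_fin_num (mIb t s) i2').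
- exact: (integrable_fin_num (mIb t T) i2).
apply: (ge0_subset_integral leb (mIb t s) (mIb t T)) => //.
  by apply/measurable_EFinP; exact: (f_abs_L2 h).1.
Qed.

(** Cauchy-Schwarz, from the nonnegative integral of (g - k)^2 with k the mean of g over the
    interval. *)
Lemma Rint_sq_Ib (g : R -> R) : L2 leb (Ib t T) g ->
  (Rintegral leb (Ib t T) g) ^+ 2 <= (T - t) * Rintegral leb (Ib t T) (fun s => g s ^+ 2).
Proof.
move=> Lg; pose c := Rintegral leb (Ib t T) g; pose q := Rintegral leb (Ib t T) (fun s => g s ^+ 2).
rewrite -[leLHS]/(c ^+ 2) -[leRHS]/((T - t) * q).
have i1 := L2_Ib_integrable Lg; have i2 := L2_int_sq Lg.
(* The mean k divides by T - t, so the degenerate interval is treated apart. *)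
have [tT0|tlT] : t = T \/ t < T by move: tT; rewrite le_eqVlt => /predU1P[|]; [left|right].
  suff -> : c = 0 by rewrite expr0n/= -tT0 subrr mul0r.
  by rewrite /c -tT0 [Ib t t](set_itv1 t) Rintegral_set1.
have d0 : 0 < T - t by rewrite subr_gt0.
pose k := c / (T - t).
have Lk (x : R) : L2 leb (Ib t T) (cst x) by apply: (@L2_Ib_bdd _ _ _ _ `|x|).
have : 0 <= Rintegral leb (Ib t T) (fun s => (g s - k) ^+ 2).
  by apply: Rintegral_ge0 => s _; exact: sqr_ge0.
rewrite (@eq_Rintegral _ _ _ leb (Ib t T) (fun s => (g s ^+ 2 - (2 * k) * g s) + cst (k ^+ 2) s)); last first.
  by move=> s _ /=; ring.
have i3 : leb.-integrable (Ib t T) (EFin \o cst (k ^+ 2)) by exact: L2_Ib_integrable.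
have i4 : leb.-integrable (Ib t T) (EFin \o (fun s => (2 * k) * g s)) by exact: (integrableZl (mIb t T) (2 * k) i1).
rewrite (RintegralD (mIb t T))//; last exact: (integrableB (mIb t T) i2 i4).
rewrite (RintegralB (mIb t T))// RintegralZl// -/c -/q.
rewrite (@Rintegral_cst _ _ R leb (Ib t T) (mIb t T)) [X in fine X](leb_Ib tT)/=.
have ck : c = k * (T - t) by rewrite /k divfK// gt_eqF.
rewrite {2}ck; move: d0; set D := T - t => d0 h.
have h2 : k ^+ 2 * D <= q by move: h; rewrite ck -/D !expr2; lra.
have -> : (k * D) ^+ 2 = D * (k ^+ 2 * D) by ring.
by rewrite ler_wpM2l// ltW.
Qed.

Lemma Aabs_L2 : L2 P setT Aabs.
Proof.
have mA : measurable_fun setT Aabs.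
  have pabs : progressive P t T W (fun s w => `|f s w|).
    move=> s hs; have [pf _] := f_H2.
    by apply: measurableT_comp (pf s hs); exact: normr_measurable.
  apply: (FM_meas (lexx T)); apply: (FM_ae (prog_Rint pabs (lexx t) (lexx T) tT)).
  by apply: filterS f_sq_ae => w h; rewrite /Aabs asboolT.
(* Cauchy-Schwarz in time: the square of [Aabs] is at most (T - t) [f_sq]. *)
split => //; apply: (@le_lt_trans _ _ ((T - t)%:E * \int[P]_w f_sq w)%E); last first.
  by rewrite lte_mul_pinfty ?lee_fin ?subr_ge0//; case: f_H2.
rewrite -ge0_integralZl//; last 3 first.
- exact: f_sq_meas.
- by move=> w _; exact: sqn_ge0.
- by rewrite lee_fin subr_ge0.
apply: ge0_le_integral => //.
- by move=> w _; rewrite lee_fin sqr_ge0.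
- exact: msq.
- by apply: measurable_funeM; exact: f_sq_meas.
move=> w _; rewrite /Aabs; case: asboolP => h; last first.
  by rewrite expr0n/= mule_ge0 ?sqn_ge0// lee_fin subr_ge0.
rewrite /f_sq sqnE; [|exact: mIb|exact: f_L2].
rewrite -EFinM lee_fin; apply: (le_trans (Rint_sq_Ib (f_abs_L2 h))).
rewrite ler_wpM2l ?subr_ge0// (@eq_Rintegral _ _ _ leb (Ib t T) (fun s => f s w ^+ 2))// => s _.
by rewrite real_normK// num_real.
Qed.

Lemma Aint_split s w : t <= s <= T -> (f_sq w < +oo)%E ->
  Rintegral leb `[s, T] (f ^~ w) = Aint T w - Aint s w.
Proof.
move=> /andP[ts sT] h; rewrite /Aint asboolT//.
have i1 := L2_Ib_integrable (f_L2 h).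
rewrite (Rintegral_itvB i1) ?bnd_simp//.
rewrite Rintegral_itv_obnd_cbnd//.
apply: integrableS i1; [exact: measurable_itv|exact: measurable_itv|].
by move=> u; rewrite /= !in_itv/= => /andP[/ltW su ->]; rewrite (le_trans ts su).
Qed.

Lemma bsde_well_posed : exists (Y : R -> Om -> R) (Z : R -> Om -> 'rV[R]_m),
    [/\ bsde_solution P t T W xi f Y Z,
        forall Y' Z', bsde_solution P t T W xi f Y' Z' ->
          same_solution P t T Y Y' Z Z' &
        forall z, H2_vec P t T W z ->
          let Ytilde := bsde_rhs P t T W xi f z in
          ('E_P[fun w => (`|Ytilde t w - fine 'E_P[Ytilde t]| ^+ 2)%R] =
          H2_normsq P t T (fun s w => (Z s w - z s w)%R))%E].
Proof.
have hT : t <= T <= T by rewrite tT lexx.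
have ht : t <= t <= T by rewrite tT lexx.
have [fxi xi2] := xi_L2.
have Lxi : L2 P setT xi by split => //; exact: FM_meas (lexx T) fxi.
have fAT := Aint_FM hT; have mAT := FM_meas (lexx T) fAT.
have LAT : L2 P setT (Aint T).
  apply: (@L2_le _ _ _ _ _ measurableT _ Aabs) => //; last exact: Aabs_L2.
  by move=> w _; rewrite [leRHS]ger0_norm ?Aabs_ge0// Aint_le.
(* Y plus the running integral of f is to be a martingale, and [eta] is its terminal value. *)
pose eta w := xi w + Aint T w.
have feta : FM T eta by exact: FM_D.
have Leta : L2 P setT eta by exact: L2D.
have [Z [pZ fZ iZ]] := representation feta Leta.
set c := Rintegral _ _ _ in iZ.
have [I [iI cI fI [f0 [Lf0 hf0]]]] := ito_nice pZ fZ.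
pose Y s w := c + I s w - Aint s w.
have iII := ito_integralP pZ fZ.
have nZ0 : nZ (fun s w => Z s w - Z s w) = 0%E.
  rewrite /nZ big1// => j _; rewrite (@sqn_eq _ _ _ mu2 DT _ (cst 0)); last by move=> p _; rewrite cprocB subrr.
  by rewrite /sqn; under eq_integral do rewrite /= expr0n/=; rewrite integral0.
have indI := ito_unique pZ pZ nZ0 iII iI.
(* [representation] gives eta - c only as an L2 limit attached to Z; the isometry with equal
   integrands identifies it with the last value of [I]. *)
have IT : {ae P, forall w, I T w = eta w - c}.
  have iIT := ito_limP pZ iI hT.
  have := ito_isometry pZ pZ fZ fZ iIT iZ; rewrite nZ0 => s0.
  have := sqn0_ae measurableT (measurable_funB iIT.1 iZ.1) s0.
  by apply: filterS => w /(_ Logic.I) /eqP; rewrite subr_eq0 => /eqP.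
have fY s : t <= s <= T -> FM s (Y s).
  move=> hs; apply: FM_B; last exact: Aint_FM.
  by apply: FM_D; [exact: FM_cst|exact: fI].
(* One square integrable variable dominates Y at all times, hence also the supremum in [S2]. *)
have Ybd : L2 P setT (fun w => `|c| + f0 w + Aabs w).
  exact: (L2D measurableT (L2D measurableT (L2_cst `|c|) Lf0) Aabs_L2).
have Yle s w : t <= s <= T -> `|Y s w| <= `|c| + f0 w + Aabs w.
  move=> hs; rewrite /Y (le_trans (ler_normB _ _))// lerD//; last exact: Aint_le.
  by rewrite (le_trans (ler_normD _ _))// lerD2l; exact: hf0.
have sY : bsde_solution P t T W xi f Y Z.
  split.
  - split.
      apply: adapted_cont_prog => // w s; apply: cvgB; last exact: Aint_cont.
      by apply: cvgD; [exact: cvg_cst|exact: cI].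
    apply: le_lt_trans Ybd.2; apply: le_integral_nonmeas => w.
      apply: (@le_trans _ _ ((Y t w ^+ 2)%:E)); first by rewrite lee_fin sqr_ge0.
      by apply: ereal_sup_ubound; exists t => //=; rewrite in_itv.
    apply: ge_ereal_sup => _ [s /= hs <-]; rewrite in_itv/= in hs.
    rewrite lee_fin -[leLHS]ger0_norm ?sqr_ge0// normrX lerXn2r ?nnegrE ?normr_ge0//.
      by apply: (le_trans (normr_ge0 _) (Yle s w hs)).
    exact: Yle.
  - by split => //; rewrite H2_normE.
  (* On good paths the equation for Y reduces to I_T = eta - c. *)
  - move: IT indI f_sq_ae; apply: filterS3 => w h1 h2 h3 s; rewrite in_itv/= => hs.
    rewrite /bsde_rhs (Aint_split hs h3) !h2// h1 /Y /eta; ring.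
exists Y, Z; split => //.
- move=> Y' Z' [[pY' sY'] [pZ' fZ'] eY']; rewrite H2_normE// in fZ'.
  have iII' := ito_integralP pZ' fZ'.
  have l1 := ito_limP pZ iII hT; have l2 := ito_limP pZ' iII' hT.
  have l10 := ito_lim_start (ito_limP pZ iII ht); have l20 := ito_lim_start (ito_limP pZ' iII' ht).
  have lD := ito_lim_sub pZ' pZ l2 l1.
  pose D w := Y t w - Y' t w.
  have fY't := progressive_FM pY' ht.
  have fD : FM t D by apply: FM_B => //; exact: fY.
  have LYt : L2 P setT (Y t).
    apply: (@L2_le _ _ _ _ _ measurableT _ (fun w => `|c| + f0 w + Aabs w)) => //.
      exact: FM_meas tT (fY _ ht).
    by move=> w _; rewrite (le_trans (Yle t w ht))// ler_norm.
  have LY't : L2 P setT (Y' t).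
    split; first exact: FM_meas tT fY't.
    apply: le_lt_trans sY'; apply: le_integral_nonmeas => w; first by rewrite lee_fin sqr_ge0.
    by apply: ereal_sup_ubound; exists t => //=; rewrite in_itv.
  have LD : L2 P setT D by exact: L2B.
  have eY := let: And3 _ _ h := sY in h.
  have tin : t \in `[t, T] by rewrite in_itv.
  (* Subtracting the two equations at time t eliminates xi and f. The chosen versions of the
     integrals vanish at t only almost surely, which is where [l10] and [l20] enter. *)
  have e1 : {ae P, forall w, ito_integral P t T W Z' T w - ito_integral P t T W Z T w = D w}.
    have l12 : {ae P, forall w, ito_integral P t T W Z t w = 0 /\ ito_integral P t T W Z' t w = 0}.
      by apply: filterS2 l10 l20 => w.
    move: eY eY' l12; apply: filterS3 => w h3 h4 [h1 h2].
    have key (x a b : R) : b - a = (x - (a - 0)) - (x - (b - 0)) by ring.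
    rewrite /D (h3 t tin) (h4 t tin) /bsde_rhs h1 h2; exact: key.
  have D0 := ito_lim_orth lD fD LD e1.
  have J0 : {ae P, forall w, ito_integral P t T W Z' T w - ito_integral P t T W Z T w = 0}.
    by apply: filterS2 e1 D0 => w ->.
  (* The isometry turns equality of the final integrals into equality of the integrands. *)
  have nZ'0 : nZ (fun s w => Z s w - Z' s w) = 0%E.
    rewrite nZ_sym -(ito_isometry pZ' pZ fZ' fZ l2 l1).
    rewrite (@sqn_ae _ _ _ P setT measurableT _ (cst 0)).
    - by rewrite /sqn; under eq_integral do rewrite /= expr0n/=; rewrite integral0.
    - exact: measurable_funB l2.1 l1.1.
    - exact: measurable_cst.
    - by apply: filterS J0 => w h _.
  have ind := ito_unique pZ pZ' nZ'0 iII iII'.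
  split.
    move: eY eY' ind; apply: filterS3 => w h1 h2 h3 s hs.
    have hs' : t <= s <= T by rewrite in_itv in hs.
    by rewrite (h1 s hs) (h2 s hs) /bsde_rhs (h3 s hs') (h3 T hT).
  have zj j : {ae mu2, forall p, DT p -> cproc (fun s w => Z s w - Z' s w) j p = 0}.
    apply: (sqn0_ae mDT); first exact: cproc_meas (pv_sub pZ pZ').
    apply/eqP; rewrite eq_le sqn_ge0 andbT -nZ'0 /nZ (bigD1 j)//= leeDl// sume_ge0// => i _; exact: sqn_ge0.
  apply: filterS (filter_forall _ zj) => p hp pin; apply/rowP => j.
  have /eqP := hp j (conj pin Logic.I); rewrite cprocB subr_eq0 => /eqP; exact.
- move=> z [pz fz]; rewrite H2_normE// in fz; move=> Yt.
  have iz := ito_integralP pz fz.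
  have lz := ito_limP pz iz hT; have lz0 := ito_lim_start (ito_limP pz iz ht).
  have Lz := ito_lim_L2 tT lz.
  pose V w := eta w - ito_integral P t T W z T w.
  have LV : L2 P setT V by exact: L2B.
  (* The running integral of f is 0 at time t, and so almost surely is the integral of z; hence
     [Yt t] is eta minus the integral of z up to T. *)
  have YV : {ae P, forall w, Yt t w = V w}.
    apply: filterS2 lz0 f_sq_ae => w h1 h2.
    rewrite /Yt /bsde_rhs (Aint_split ht h2) h1 /V /eta.
    rewrite /Aint asboolT// [Ib t t](set_itv1 t) Rintegral_set1; ring.
  have mYt : measurable_fun setT (Yt t).
    apply: (@FM_meas T) => //; apply: (FM_ae (eta := V)); last by apply: filterS YV.
    apply: FM_B => //; apply: progressive_FM hT; by case: iz.
  (* The integral of z is centred, so the mean is c for every z; subtracting it leaves the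
     difference of the integrals of Z and z. *)
  have EYt : fine 'E_P[Yt t] = c.
    rewrite unlock (ae_eq_integral (EFin \o V))//; last 3 first.
    - by apply/measurable_EFinP.
    - by apply/measurable_EFinP; case: LV.
    - by apply: filterS YV => w h _ /=; rewrite h.
    rewrite -/(Rintegral P setT V) RintegralB//; [|exact: L2_int|exact: L2_int].
    by rewrite (ito_lim_mean lz) subr0.
  rewrite H2_normE; last exact: pv_sub.
  rewrite -(ito_isometry pZ pz fZ fz iZ lz) EYt unlock.
  rewrite -(@sqn_ae _ _ _ P setT measurableT (fun w => Yt t w - c)).
  + by apply: eq_integral => w _; rewrite real_normK// num_real.
  + by apply: measurable_funB.
  + exact: measurable_funB iZ.1 lz.1.
  + by apply: filterS YV => w h _; rewrite h /V; ring.
Qed.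
End bsde.

End filtration.

Theorem theorem5 (R : realType) (d : measure_display) (Omega : measurableType d)
  (P : probability Omega R) (m : nat) (t T : R)
  (W : R -> Omega -> 'rV[R]_m)
  (xi : Omega -> R) (f : R -> Omega -> R)
  (complete : measure_is_complete P)
  (t_ge0 : 0 <= t) (t_le_T : t <= T)
  (bmW : brownian_motion P t T W)
  (xi_L2 : L2_F P t W T xi)
  (f_H2 : H2 P t T W f) :
  exists (Y : R -> Omega -> R) (Z : R -> Omega -> 'rV[R]_m),
    [/\ bsde_solution P t T W xi f Y Z,
        forall Y' Z', bsde_solution P t T W xi f Y' Z' ->
          same_solution P t T Y Y' Z Z' &
        forall z, H2_vec P t T W z ->
          let Ytilde := bsde_rhs P t T W xi f z in
          ('E_P[fun w => (`|Ytilde t w - fine 'E_P[Ytilde t]| ^+ 2)%R] =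
          H2_normsq P t T (fun s w => (Z s w - z s w)%R))%E].
Proof.
exact: (bsde_well_posed complete t_le_T bmW xi_L2 f_H2).
Qed.
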